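(* Let $p\geq2$ be an even integer and $q=e^{\pi i/p}$. For every $4$-dimensional $2$-handlebody $W$ and for the zero cohomology class $0\in H^2(W,\partial W;\mathbb Z/2\mathbb Z)$, the refined invariant $J_U$ satisfies $$J_U(W,0)=J_{\bar U}(W),$$ where $J_{\bar U}$ denotes the (non-refined) invariant associated with the small quantum group $\bar U=\bar U_q\mathfrak{sl}_2$, and $J_U$ denotes the refined invariant associated with the ribbon extension $\tilde U=\tilde U_q\mathfrak{sl}_2$ of the restricted quantum group $U=U_q\mathfrak{sl}_2$, regarded as a unimodular ribbon Hopf $\mathbb Z/2\mathbb Z$-coalgebra.
   Context: A $4$-dimensional $2$-handlebody is a connected oriented smooth $4$-manifold obtained from $D^4$ by attaching finitely many $1$- and $2$-handles; it is represented by Kirby diagrams with dotted unknots ($1$-handles) and undotted framed components ($2$-handles). **Notation.** $t=e^{\pi i/(2p)}$, $\{n\}=q^n-q^{-n}$, $[n]=\{n\}/\{1\}$, $[n]!=\prod_{k=1}^n[k]$, $p'=p/2$. **The algebras $U\subset\tilde U$.** $\tilde U$ is the Hopf algebra over $\mathbb C$ with generators $E,F,\tilde K$ and, writing $K=\tilde K^2$, relations $E^p=F^p=0$, $\tilde K^{4p}=1$, $\tilde KE\tilde K^{-1}=qE$, $\tilde KF\tilde K^{-1}=q^{-1}F$, $[E,F]=\frac{K-K^{-1}}{q-q^{-1}}$, with $\Delta(E)=E\otimes K+1\otimes E$, $\Delta(F)=F\otimes1+K^{-1}\otimes F$, $\Delta(\tilde K)=\tilde K\otimes\tilde K$, $\varepsilon(E)=\varepsilon(F)=0$,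 $\varepsilon(\tilde K)=1$, $S(E)=-EK^{-1}$, $S(F)=-KF$, $S(\tilde K)=\tilde K^{-1}$. The restricted quantum group $U$ is the Hopf subalgebra generated by $E,F,K$ (so $K^{2p}=1$). The R-matrix of $\tilde U$ is $$\tilde R=\Bigl(\tfrac1{4p}\sum_{a,b=0}^{4p-1}t^{-ab}\tilde K^a\otimes\tilde K^b\Bigr)\Bigl(\sum_{a=0}^{p-1}\tfrac{\{1\}^a}{[a]!}q^{a(a-1)/2}E^a\otimes F^a\Bigr)\in\tilde U\otimes\tilde U,$$ its pivotal element is $g=K^{p+1}$, and its left integral and two-sided cointegral are $$\tilde\lambda(E^aF^b\tilde K^c)=\tfrac{\sqrt{2p}\,[p-1]!}{i^{p-1}\{1\}^{p-1}}\delta_{a,p-1}\delta_{b,p-1}\delta_{c,2p-2}\ (0\le a,b\le p-1,\,0\le c\le4p-1),$$ $$\tilde\Lambda=\tfrac{i^{p-1}\{1\}^{p-1}}{\sqrt{2p}\,[p-1]!}\sum_{a=0}^{4p-1}E^{p-1}F^{p-1}\tilde K^a.$$ The central idempotents $1_0=\frac{1+K^p}2$, $1_1=\frac{1-K^p}2$ make $\{\tilde U1_\alpha\mid\alpha\in\mathbb Z/2\mathbb Z\}$ a unimodular ribbon Hopf $\mathbb Z/2\mathbb Z$-coalgebra, with R-matrices $\tilde R(1_\alpha\otimes1_\beta)$, pivotal elements $g1_\alpha$, integrals $x1_\alpha\mapsto\tilde\lambda(x1_\alpha)$, and cointegral $\tilde\Lambda$. **The small quantum group $\bar U$.** It is the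 Hopf algebra over $\mathbb C$ with generators $\bar E,\bar F,\bar K$ and relations $\bar E^p=\bar F^p=0$, $\bar K^p=1$, $\bar K\bar E\bar K^{-1}=q^2\bar E$, $\bar K\bar F\bar K^{-1}=q^{-2}\bar F$, $[\bar E,\bar F]=\frac{\bar K-\bar K^{-1}}{q-q^{-1}}$, with $\Delta(\bar E)=\bar E\otimes\bar K+1\otimes\bar E$, $\Delta(\bar F)=\bar F\otimes1+\bar K^{-1}\otimes\bar F$, $\Delta(\bar K)=\bar K\otimes\bar K$, $\varepsilon(\bar E)=\varepsilon(\bar F)=0$, $\varepsilon(\bar K)=1$, $S(\bar E)=-\bar E\bar K^{-1}$, $S(\bar F)=-\bar K\bar F$, $S(\bar K)=\bar K^{-1}$ (it is identified with $U1_0$ via $\bar E=E1_0$, $\bar F=F1_0$, $\bar K=K1_0$). Its R-matrix is $$\bar R=\Bigl(\tfrac1p\sum_{a,b=0}^{p-1}q^{-2ab}\bar K^a\otimes\bar K^b\Bigr)\Bigl(\sum_{a=0}^{p-1}\tfrac{\{1\}^a}{[a]!}q^{a(a-1)/2}\bar E^a\otimes\bar F^a\Bigr),$$ its pivotal element is $\bar g=\bar K$, and its left integral and two-sided cointegral are $$\bar\lambda(\bar E^a\bar F^b\bar K^c)=\tfrac{\sqrt{p'}\,[p-1]!}{i^{p-1}\{1\}^{p-1}}\delta_{a,p-1}\delta_{b,p-1}\delta_{c,p-1}\ (0\le a,b,c\le p-1),$$ $$\bar\Lambda=\tfrac{i^{p-1}\{1\}^{p-1}}{\sqrt{p'}\,[p-1]!}\sum_{a=0}^{p-1}\bar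 E^{p-1}\bar F^{p-1}\bar K^a.$$ **Bead algorithm for data $(R=R'\otimes R'',g,\Lambda)$.** Draw a Kirby diagram generically with respect to a height function, with blackboard framing, crossings formed by two strands monotone in height, each dotted component as a flat circle encircling parallel vertical strands, and orient the undotted components arbitrarily. Place beads as follows. (a) At a crossing with both strands oriented upward: if the over-strand runs from bottom left to top right, put $R'$ on the over-strand and $R''$ on the under-strand; if it runs from bottom right to top left, put $S(R')$ on the over-strand and $R''$ on the under-strand. For strands oriented downward, replace the bead $x$ by $S(x)$. (b) At a local maximum (resp. minimum) oriented from left to right, put $g$ (resp. $g^{-1}$); other extrema get nothing. (c) Remove each dotted component and put the tensor factors of the iterated coproduct $\Lambda_{(1)}\otimes\cdots\otimes\Lambda_{(k)}$ on the $k$ strands piercing its disc, from left to right (with $S$ applied on downward strands); if $k=0$ multiply by $\varepsilon(\Lambda)$. (d) On each undotted component, multiply the beads in the order met along the orientation from a base point, later beads on the left. The result is $\sum x_1\otimes\cdots\otimes x_n$, one factor for each undotted component. **The invariants.** $J_{\bar U}(W)=\sum\prod_j\bar\lambda(x_j\bar g^{-1})$ for the data $(\bar R,\bar g,\bar\Lambda)$. For the data $(\tilde R,g,\tilde\Lambda)$ and a class $\omega\in H^2(W,\partial W;\mathbb Z/2\mathbb Z)$, viewed as a labeling $\alpha_1,\dots,\alpha_n\in\mathbb Z/2\mathbb Z$ of the undotted components (the values of $\omega$ on their meridian discs), $J_U(W,\omega)=\sum\prod_j\tilde\lambda(x_j1_{\alpha_j}g^{-1})$. For $\omega=0$ all labels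 are $0$. *)

(* Defs.v *)
From HB Require Import structures.
From mathcomp Require Import all_boot all_order all_algebra.
From mathcomp Require Import reals trigo.
From mathcomp.real_closed Require Import complex.

Set Implicit Arguments.
Unset Strict Implicit.
Unset Printing Implicit Defensive.

Import Order.TTheory GRing.Theory Num.Theory.

(* A diagram in generic position is read from bottom to top as a list of
   elementary pieces, acting on the row of strands met by a horizontal line;
   strands are numbered from left to right, starting from 0.  Every 1-handle
   is already in the form of a flat circle around parallel vertical strands,
   so no other dotted component occurs, and undotted components carry the
   blackboard framing. *)
Inductive piece :=
| Cup of nat & bool    (* [Cup i o]: local minimum creating strands i and i+1,
                          oriented from left to right iff [o] *)
| Cap of nat           (* [Cap i]: local maximum joining strands i and i+1 *)
| Cross of nat & bool  (* [Cross i s]: crossing of strands i and i+1; the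
                          over-strand runs from bottom left to top right iff
                          [s] *)
| Dotted of nat & nat. (* [Dotted i k]: dotted circle around the k strands
                          i, ..., i+k-1 (k may be 0) *)

(* A place where a bead sits: the piece of the diagram it comes from, which
   tensor factor attached to this piece it carries, and whether the strand is
   oriented upward there. *)
Record place := Place { pl_piece : nat; pl_factor : nat; pl_up : bool }.

(* State of the bottom-to-top scan.  Every strand of [front] is an end of an
   open arc: [true] is the (upward oriented) final end, [false] the (downward
   oriented) initial end.  [arcs] and [loops] list the bead places on every
   arc, resp. closed component, in the order in which they are met along the
   orientation. *)
Record scan := Scan {
  front : seq (bool * nat);
  arcs : seq (seq place);
  loops : seq (seq place) }.

Definition put_place (e m : nat) (arcs : seq (seq place)) (x : bool * nat) :=
  let: (up, l) := x in
  let s := nth [::] arcs l in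
  set_nth [::] arcs l
    (if up then rcons s (Place e m true) else Place e m false :: s).

Fixpoint put_places (e m : nat) (arcs : seq (seq place))
    (xs : seq (bool * nat)) :=
  if xs is x :: xs' then put_places e m.+1 (put_place e m arcs x) xs'
  else arcs.

Definition scan_piece (e : nat) (st : scan) (pc : piece) : option scan :=
  let: Scan fr ar cl := st in
  let strand i := nth (true, 0) fr i in
  match pc with
  | Cup i o =>
      if i <= size fr then
        let l := size ar in
        Some (Scan (take i fr ++ [:: (~~ o, l); (o, l)] ++ drop i fr)
                   (rcons ar (if o then [:: Place e 0 true] else [::])) cl)
      else None
  | Cap i =>
      let: (o1, l1) := strand i in
      let: (o2, l2) := strand i.+1 in
      if (i.+1 < size fr) && (o1 != o2) then
        let: (lin, lout) := if o1 then (l1, l2) else (l2, l1) in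
        (* [o1] holds iff the maximum is oriented from left to right *)
        let s := nth [::] ar lin ++
                 (if o1 then [:: Place e 0 true] else [::]) in
        let fr' := take i fr ++ drop i.+2 fr in
        if lin == lout then Some (Scan fr' ar (rcons cl s))
        else Some (Scan [seq (x.1, if x.2 == lout then lin else x.2) | x <- fr']
                        (set_nth [::] ar lin (s ++ nth [::] ar lout)) cl)
      else None
  | Cross i s =>
      if i.+1 < size fr then
        let: (sl, sr) := (strand i, strand i.+1) in
        (* factor 0 goes to the over-strand, factor 1 to the under-strand *)
        Some (Scan (take i fr ++ [:: sr; sl] ++ drop i.+2 fr)
                   (put_places e 0 ar
                      (if s then [:: sl; sr] else [:: sr; sl])) cl)
      else None
  | Dotted i k =>
      if i + k <= size fr then
        Some (Scan fr (put_places e 0 ar (take k (drop i fr))) cl)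
      else None
  end.

Fixpoint scan_from (e : nat) (st : scan) (w : seq piece) : option scan :=
  if w is pc :: w' then obind (fun st' => scan_from e.+1 st' w')
                              (scan_piece e st pc)
  else Some st.

Definition scan_word : seq piece -> option scan :=
  scan_from 0 (Scan [::] [::] [::]).

Record kirby := Kirby {
  pieces :> seq piece;
  pieces_closed :
    if scan_word pieces is Some st then nilp (front st) else false }.

Definition components (D : kirby) : seq (seq place) :=
  if scan_word D is Some st then loops st else [::].

Definition is_dot (pc : piece) : bool := if pc is Dotted _ _ then true else false.

(* H^2(W, bd W; Z/2) = H_2(W; Z/2) is the group of cellular 2-cycles, as W has
   no 3-handle: the coefficient of a 2-handle is the value of the class on the
   meridian disc of the corresponding undotted component, and the boundary of
   a 2-handle counts mod 2 how often it runs through each dotted circle. *)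
Definition relH2_cycle (D : kirby)
    (al : {ffun 'I_(size (components D)) -> 'Z_2}) : bool :=
  [forall e : 'I_(size D), is_dot (nth (Cap 0) D e) ==>
     (\sum_j al j *+ count (fun x => pl_piece x == e)
                           (nth [::] (components D) j) == 0 :> 'Z_2)%R].

Record relH2 (D : kirby) := RelH2 {
  label :> {ffun 'I_(size (components D)) -> 'Z_2};
  labelP : relH2_cycle label }.

Lemma relH2_cycle0 (D : kirby) : relH2_cycle (D := D) [ffun=> 0%R].
Proof.
apply/forallP => e; apply/implyP => _; apply/eqP.
by rewrite big1 // => j _; rewrite ffunE mul0rn.
Qed.

Definition relH2_zero (D : kirby) : relH2 D := RelH2 (relH2_cycle0 D).

Local Open Scope ring_scope.
Local Open Scope complex_scope.

Section Hopf.
Variables (R : realType) (A : algType R[i]).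

(* Elements of A (x) A are written as finite sums of pure tensors; two sums
   are the same tensor iff no bilinear map distinguishes them. *)
Definition tensor_eq (s t : seq (A * A)) : Prop :=
  forall (V : lmodType R[i]) (f : {bilinear A -> A -> V}),
    \sum_(u <- s) f u.1 u.2 = \sum_(u <- t) f u.1 u.2.

Definition trilinear_map (V : lmodType R[i]) (f : A -> A -> A -> V) : Prop :=
  [/\ forall y z, linear (fun x => f x y z),
      forall x z, linear (fun y => f x y z)
    & forall x y, linear (fun z => f x y z)].

(* Multiplicativity of the antipode is a consequence of the other axioms. *)
Record hopf_structure := HopfStructure {
  comul : A -> seq (A * A);
  counit : {lrmorphism A -> R[i] | *%R};
  antipode : {linear A -> A};
  comul_linear : forall (a : R[i]) (x y : A),
    tensor_eq (comul (a *: x + y))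
              ([seq (a *: u.1, u.2) | u <- comul x] ++ comul y);
  comul1 : tensor_eq (comul 1) [:: (1, 1)];
  comulM : forall x y : A,
    tensor_eq (comul (x * y))
              [seq (u.1 * v.1, u.2 * v.2) | u <- comul x, v <- comul y];
  comul_assoc : forall (x : A) (V : lmodType R[i]) (f : A -> A -> A -> V),
    trilinear_map f ->
    \sum_(u <- comul x) \sum_(v <- comul u.1) f v.1 v.2 u.2 =
    \sum_(u <- comul x) \sum_(v <- comul u.2) f u.1 v.1 v.2;
  counitl : forall x : A, \sum_(u <- comul x) counit u.1 *: u.2 = x;
  counitr : forall x : A, \sum_(u <- comul x) counit u.2 *: u.1 = x;
  antipodel : forall x : A,
    \sum_(u <- comul x) antipode u.1 * u.2 = counit x *: 1;
  antipoder : forall x : A,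
    \sum_(u <- comul x) u.1 * antipode u.2 = counit x *: 1;
  antipode1 : antipode 1 = 1;
  antipodeM : forall x y : A, antipode (x * y) = antipode y * antipode x }.

(* x_(1) (x) ... (x) x_(k), as a finite sum of scaled pure tensors. *)
Fixpoint iter_comul (H : hopf_structure) (k : nat) (x : A) :
    seq (R[i] * seq A) :=
  match k with
  | 0 => [:: (counit H x, [::])]
  | 1 => [:: (1, [:: x])]
  | k'.+1 => flatten [seq [seq (t.1, u.1 :: t.2) | t <- iter_comul H k' u.2]
                     | u <- comul H x]
  end.

Record bead_data := BeadData {
  bd_hopf : hopf_structure;
  bd_rmat : seq (R[i] * (A * A));
  bd_piv : A;
  bd_pivV : A;
  bd_coint : A }.

Variable X : bead_data.

(* The beads created by a piece.  The bead of a minimum or maximum is only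
   used when [scan_piece] has put a place there, i.e. for the orientation from
   left to right; the antipode for downward strands comes in [bead_at]. *)
Definition piece_beads (pc : piece) : seq (R[i] * seq A) :=
  match pc with
  | Cup _ _ => [:: (1, [:: bd_pivV X])]
  | Cap _ => [:: (1, [:: bd_piv X])]
  | Cross _ s =>
      [seq (r.1, [:: if s then r.2.1 else antipode (bd_hopf X) r.2.1; r.2.2])
      | r <- bd_rmat X]
  | Dotted _ k => iter_comul (bd_hopf X) k (bd_coint X)
  end.

(* One pure tensor chosen for every piece, in all possible ways. *)
Fixpoint bead_states (w : seq piece) : seq (R[i] * seq (seq A)) :=
  if w is pc :: w' then
    [seq (t.1 * u.1, t.2 :: u.2) | t <- piece_beads pc, u <- bead_states w']
  else [:: (1, [::])].

Definition bead_at (sg : seq (seq A)) (x : place) : A :=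
  let b := nth 1 (nth [::] sg (pl_piece x)) (pl_factor x) in
  if pl_up x then b else antipode (bd_hopf X) b.

(* The base point is chosen by rotating the cyclic list of bead places. *)
Definition bead_product (sg : seq (seq A)) (base : nat) (s : seq place) : A :=
  foldl (fun y x => bead_at sg x * y) 1 (rot base s).

Definition bead_invariant (D : kirby) (base : 'I_(size (components D)) -> nat)
    (f : 'I_(size (components D)) -> A -> R[i]) : R[i] :=
  \sum_(t <- bead_states D)
     t.1 * \prod_j f j (bead_product t.2 (base j) (nth [::] (components D) j)).

End Hopf.

Section Presentation.
Variable R : realType.

Definition presented (rels : forall B : algType R[i], B -> B -> B -> Prop)
    (A : algType R[i]) (x y z : A) : Prop :=
  [/\ rels A x y z,
      forall (B : algType R[i]) (x' y' z' : B), rels B x' y' z' ->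
        exists f : {lrmorphism A -> B}, [/\ f x = x', f y = y' & f z = z']
    & forall (B : algType R[i]) (f g : {lrmorphism A -> B}),
        f x = g x -> f y = g y -> f z = g z -> f =1 g].

Variable p : nat.

Definition cexp_i (theta : R) : R[i] := cos theta +i* sin theta.
Definition q_root : R[i] := cexp_i (pi / p%:R).
Definition t_root : R[i] := cexp_i (pi / (2 * p)%:R).
Local Notation q := q_root.
Local Notation t := t_root.

Definition qbrace (n : nat) : R[i] := q ^+ n - q ^- n.
Definition qint (n : nat) : R[i] := qbrace n / qbrace 1.
Definition qfact (n : nat) : R[i] := \prod_(1 <= k < n.+1) qint k.

(* Inverses of the group-like generators: Kt ^+ (4p) = 1 in the first
   algebra, K ^+ p = 1 in the second. *)
Definition tinv (B : algType R[i]) (Kt : B) : B := Kt ^+ (4 * p).-1.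
Definition binv (B : algType R[i]) (K : B) : B := K ^+ p.-1.

Definition tilde_rels (B : algType R[i]) (E F Kt : B) : Prop :=
  [/\ E ^+ p = 0 /\ F ^+ p = 0, Kt ^+ (4 * p) = 1,
      Kt * E * tinv Kt = q *: E, Kt * F * tinv Kt = q^-1 *: F
    & E * F - F * E = (q - q^-1)^-1 *: (Kt ^+ 2 - tinv Kt ^+ 2)].

Definition bar_rels (B : algType R[i]) (E F K : B) : Prop :=
  [/\ E ^+ p = 0 /\ F ^+ p = 0, K ^+ p = 1,
      K * E * binv K = q ^+ 2 *: E, K * F * binv K = q ^- 2 *: F
    & E * F - F * E = (q - q^-1)^-1 *: (K - binv K)].

(* [L] is the group-like generator, [LV] its inverse; [K] is [L ^+ 2] for the
   first algebra and [L] for the second one. *)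
Definition sl2_hopf (B : algType R[i]) (H : hopf_structure B)
    (E F K KV L LV : B) : Prop :=
  [/\ [/\ tensor_eq (comul H E) [:: (E, K); (1, E)],
          tensor_eq (comul H F) [:: (F, 1); (KV, F)]
        & tensor_eq (comul H L) [:: (L, L)]],
      [/\ counit H E = 0, counit H F = 0 & counit H L = 1]
    & [/\ antipode H E = - (E * KV), antipode H F = - (K * F)
        & antipode H L = LV]].

(* Product of a finite sum of scaled pure tensors with the quasi R-matrix. *)
Definition rmatrix (B : algType R[i]) (cartan : seq (R[i] * (B * B)))
    (E F : B) : seq (R[i] * (B * B)) :=
  [seq (u.1 * (qbrace 1 ^+ a / qfact a * q ^+ (a * a.-1)./2),
        (u.2.1 * E ^+ a, u.2.2 * F ^+ a))
  | u <- cartan, a <- iota 0 p].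

Definition int_coef (r : R) : R[i] :=
  (Num.sqrt r)%:C * qfact p.-1 / ((0 +i* 1) ^+ p.-1 * qbrace 1 ^+ p.-1).
Definition coint_coef (r : R) : R[i] :=
  (0 +i* 1) ^+ p.-1 * qbrace 1 ^+ p.-1 / ((Num.sqrt r)%:C * qfact p.-1).

(* The Hopf algebra $\tilde U$ with its left integral; the monomials
   E^a F^b Kt^c form a basis, so the integral is determined by its values. *)
Record Utilde := UTilde {
  tU :> algType R[i];
  tE : tU; tF : tU; tK : tU;
  tU_presented : presented tilde_rels tE tF tK;
  tU_hopf : hopf_structure tU;
  tU_hopfE :
    sl2_hopf tU_hopf tE tF (tK ^+ 2) (tinv tK ^+ 2) tK (tinv tK);
  tlambda : {scalar tU};
  tlambdaE : forall a b c : nat, (a < p)%N -> (b < p)%N -> (c < 4 * p)%N ->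
    tlambda (tE ^+ a * tF ^+ b * tK ^+ c) =
    int_coef (2 * p)%:R *
      [&& a == p.-1, b == p.-1 & c == (2 * p - 2)%N]%:R }.

Record Ubar := UBar {
  bU :> algType R[i];
  bE : bU; bF : bU; bK : bU;
  bU_presented : presented bar_rels bE bF bK;
  bU_hopf : hopf_structure bU;
  bU_hopfE : sl2_hopf bU_hopf bE bF bK (binv bK) bK (binv bK);
  blambda : {scalar bU};
  blambdaE : forall a b c : nat, (a < p)%N -> (b < p)%N -> (c < p)%N ->
    blambda (bE ^+ a * bF ^+ b * bK ^+ c) =
    int_coef (p%:R / 2) * [&& a == p.-1, b == p.-1 & c == p.-1]%:R }.

Section Tilde.
Variable U : Utilde.
Local Notation E := (tE U).
Local Notation F := (tF U).
Local Notation Kt := (tK U).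
Local Notation K := (tK U ^+ 2).

Definition tU_rmat : seq (R[i] * (U * U)) :=
  rmatrix [seq ((4 * p)%:R^-1 * t ^- (a * b), (Kt ^+ a, Kt ^+ b))
          | a <- iota 0 (4 * p), b <- iota 0 (4 * p)] E F.

Definition tU_piv : U := K ^+ p.+1.
Definition tU_pivV : U := tinv Kt ^+ 2 ^+ p.+1.

Definition tU_coint : U :=
  coint_coef (2 * p)%:R *:
    \sum_(a < 4 * p) E ^+ p.-1 * F ^+ p.-1 * Kt ^+ a.

Definition tU_data : bead_data U :=
  BeadData (tU_hopf U) tU_rmat tU_piv tU_pivV tU_coint.

Definition tU_idem (al : 'Z_2) : U :=
  if al == 0 then 2^-1 *: (1 + K ^+ p) else 2^-1 *: (1 - K ^+ p).

Definition J_U (D : kirby) (base : 'I_(size (components D)) -> nat)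
    (om : relH2 D) : R[i] :=
  bead_invariant tU_data base
    (fun j x => tlambda U (x * tU_idem (om j) * tU_pivV)).

End Tilde.

Section Bar.
Variable U : Ubar.
Local Notation E := (bE U).
Local Notation F := (bF U).
Local Notation K := (bK U).

Definition bU_rmat : seq (R[i] * (U * U)) :=
  rmatrix [seq (p%:R^-1 * q ^- (2 * a * b), (K ^+ a, K ^+ b))
          | a <- iota 0 p, b <- iota 0 p] E F.

Definition bU_coint : U :=
  coint_coef (p%:R / 2) *: \sum_(a < p) E ^+ p.-1 * F ^+ p.-1 * K ^+ a.

Definition bU_data : bead_data U :=
  BeadData (bU_hopf U) bU_rmat K (binv K) bU_coint.

Definition J_Ubar (D : kirby) (base : 'I_(size (components D)) -> nat) :
    R[i] :=
  bead_invariant bU_data base (fun _ x => blambda U (x * binv K)).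

End Bar.

End Presentation.

(* Main.v *)
(* The label 0 inserts the central idempotent e = 1_0 on every component, so a
   diagram is evaluated by the functional tau x = lambda(x e g^-1), a trace which
   only sees the ideal generated by e, and S e = e.  There is an algebra map
   psi : Ubar -> Utilde with psi bE = E e, psi bF = F e, psi bK = K e + (1 - e);
   modulo e it matches the coproducts, the R-matrices, the pivots and the
   integrals.  The cointegral of Utilde, however, is congruent to that of Ubar
   plus the part y with the odd powers of Kt, and one has to show that y may be
   dropped at each dotted circle in turn.

   All beads are intertwined by the coproducts of K and E, so both elements can
   be slid along a horizontal line through the diagram.  Now y = [E, z_0] for some
   z_0 of weight -2, and z_(n+1) = F z_n - q^(2n+2) z_n F satisfies
   [E, z_(n+1)] = mu_n z_n K with mu_n a nonzero multiple of {n+1}{n+2}.  Sliding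
   E past a circle carrying z_n, with E^n K on the strands to its left, shows that
   the value of [E, z_n] is q^2 - q^(-2n-2) times that of z_n; the factor is 0 for
   n = p - 2.  By descending induction the values of all [E, z_n] vanish. *)

Require Import Defs.
From HB Require Import structures.
From mathcomp Require Import all_boot all_order all_algebra.
From mathcomp Require Import boolp reals trigo ring lra zify.
From mathcomp.real_closed Require Import complex.

Set Implicit Arguments.
Unset Strict Implicit.
Unset Printing Implicit Defensive.

Import Order.TTheory GRing.Theory Num.Theory.

Local Open Scope ring_scope.
Local Open Scope complex_scope.

(** * Evaluation of diagrams on arc values *)

(** The odd part [y] is nonzero modulo [e], so the two state sums cannot be matched piece by piece:
    [y] disappears only because the diagram is closed. One slide is not enough either, since for
    [p > 2] the factor at [n = 0], which is [q^2 - q^-2], is nonzero; passing from [z_n] to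
    [z_(n+1)] multiplies the weight by [q^-2] until it reaches [q^(-2(p-1)) = q^2]. The label
    [E^n K] on the left strands makes consecutive relations share a term.

    Sliding is restricted to [K] and [E] because their iterated coproducts involve nothing but [1],
    [K] and [E], so that a row can be cut into the strands left of a circle, through it and right of
    it.

    Rows of varying length would call for tensor powers of varying length. Instead the diagram above
    a row is a functional of the values carried by the open arcs, and the diagram below it a
    functional of such functionals. Working modulo [e] then means that multiplying a value by [e]
    changes nothing, and a dotted circle is the action of the cointegral through its iterated
    coproduct, taken in either algebra. *)

Definition strand : Type := (bool * nat)%type.

Section TensorEq.
Variables (R : realType) (A : algType R[i]).

Definition bilin (f : A -> A -> R[i]) : Prop :=
  (forall a x y z, f (a *: x + y) z = a * f x z + f y z) /\
  (forall a x y z, f z (a *: x + y) = a * f z x + f z y).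

(** [tensor_eq] quantifies over bundled bilinear maps; an unbundled form is packed here, with the
    ground field as a module over itself. *)
Lemma tensor_eqP (s t : seq (A * A)) (f : A -> A -> R[i]) :
  tensor_eq s t -> bilin f -> \sum_(u <- s) f u.1 u.2 = \sum_(u <- t) f u.1 u.2.
Proof.
move=> st [fl fr].
have fb : bilinear_for (GRing.Scale.Law.clone _ _ *:%R _)
   (GRing.Scale.Law.clone _ _ *:%R _) (f : A -> A -> R[i]^o).
  by split=> z a x y /=; rewrite ?fl ?fr.
pose B := bilinear_isBilinear.Build _ _ _ _ _ _ _ fb.
pose F : {bilinear A -> A -> R[i]^o} := HB.pack (f : A -> A -> R[i]^o) B.
exact: (st _ F).
Qed.

End TensorEq.

Definition upd (T : Type) (va : nat -> T) (l : nat) (x : T) : nat -> T :=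
  fun m => if m == l then x else va m.

Lemma upd_same T (va : nat -> T) l x : upd va l x l = x.
Proof. by rewrite /upd eqxx. Qed.

Lemma upd_other T (va : nat -> T) l m x : m != l -> upd va l x m = va m.
Proof. by rewrite /upd => /negbTE->. Qed.

Lemma upd_upd T (va : nat -> T) l x y : upd (upd va l x) l y = upd va l y.
Proof. by apply/funext => m; rewrite /upd; case: eqP. Qed.

Lemma updC T (va : nat -> T) l m x y : l != m ->
  upd (upd va l x) m y = upd (upd va m y) l x.
Proof.
move=> lm; apply/funext => k; rewrite /upd.
by case: (k =P m) => // ->; rewrite eq_sym (negbTE lm).
Qed.

Lemma upd_id T (va : nat -> T) l : upd va l (va l) = va.
Proof. by apply/funext => m; rewrite /upd; case: eqP => [->|]. Qed.

(** An open arc meets the row in exactly two strands, its initial and its final end; [n] is a fresh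
    arc number. *)
Definition wf_front (fr : seq strand) (n : nat) : Prop :=
  [/\ uniq fr, forall l, ((true, l) \in fr) = ((false, l) \in fr)
    & forall s, s \in fr -> (s.2 < n)%N].

(** What a piece does to the open arcs once positions in the row are forgotten: open an arc, join
    the end of [lin] to the start of [lout] (closing a component when they agree), or lay beads on
    the listed strands in this order. *)
Inductive move :=
| MCup of bool & nat
| MCap of bool & nat & nat
| MPut of seq strand.

Definition ren (lin lout : nat) (x : strand) : strand :=
  (x.1, if x.2 == lout then lin else x.2).

(** The combinatorial half of [scan_piece]: the row and the number [n] of arcs evolve independently
    of the beads. *)
Definition front_step (fr : seq strand) (n : nat) (pc : piece) :
    option (seq strand * nat * move) :=
  let strand i := nth (true, 0) fr i in
  match pc with
  | Cup i o =>
      if i <= size fr then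
        Some (take i fr ++ [:: (~~ o, n); (o, n)] ++ drop i fr, n.+1, MCup o n)
      else None
  | Cap i =>
      let: (o1, l1) := strand i in
      let: (o2, l2) := strand i.+1 in
      if (i.+1 < size fr) && (o1 != o2) then
        let: (lin, lout) := if o1 then (l1, l2) else (l2, l1) in
        Some (map (ren lin lout) (take i fr ++ drop i.+2 fr), n,
              MCap o1 lin lout)
      else None
  | Cross i s =>
      if i.+1 < size fr then
        let: (sl, sr) := (strand i, strand i.+1) in
        Some (take i fr ++ [:: sr; sl] ++ drop i.+2 fr, n,
              MPut (if s then [:: sl; sr] else [:: sr; sl]))
      else None
  | Dotted i k =>
      if i + k <= size fr then Some (fr, n, MPut (take k (drop i fr))) else None
  end%N.

Section Evaluation.
Variables (R : realType) (A : algType R[i]) (HA : hopf_structure A).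
Variable tau : A -> R[i].

(** The final end of an arc is met last, so its bead multiplies on the left; the initial end is met
    first and points downward, whence the antipode on the right. *)
Definition put_bead (b : A) (s : strand) (va : nat -> A) : nat -> A :=
  upd va s.2 (if s.1 then b * va s.2 else va s.2 * antipode HA b).

Fixpoint put_beads (bs : seq A) (ss : seq strand) (va : nat -> A) : nat -> A :=
  if ss is s :: ss' then put_beads (behead bs) ss' (put_bead (head 1 bs) s va) else va.

(* The effect of a piece on the values of the arcs, and the trace of the
   component that it closes, if any. *)
Definition move_values (m : move) (bs : seq A) (va : nat -> A) :
    R[i] * (nat -> A) :=
  match m with
  | MCup o n => (1, upd va n (if o then head 1 bs else 1))
  | MCap o lin lout =>
      let v := va lout * ((if o then head 1 bs else 1) * va lin) in
      if lin == lout then (tau ((if o then head 1 bs else 1) * va lin), va)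
      else (1, upd va lin v)
  | MPut ss => (1, put_beads bs ss va)
  end.

(** Functionals travel downward: [G] reads the arcs above a piece, its pullback the arcs below. *)
Definition pull (T : seq (R[i] * seq A)) (m : move) (G : (nat -> A) -> R[i])
    (va : nat -> A) : R[i] :=
  \sum_(t <- T) t.1 * ((move_values m t.2 va).1 * G (move_values m t.2 va).2).

(** The state sum of the diagram above a row, as a function of the values with which the arcs enter
    it. Ends left open at the top, or a piece that does not fit the row, give 0. *)
Fixpoint evaluate (T : piece -> seq (R[i] * seq A)) (w : seq piece)
    (fr : seq strand) (n : nat) (va : nat -> A) : R[i] :=
  match w with
  | [::] => (nilp fr)%:R
  | pc :: w' =>
      if front_step fr n pc is Some (fr', n', m)
      then pull (T pc) m (evaluate T w' fr' n') va else 0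
  end.

End Evaluation.

(** * Functionals of arc values modulo a central idempotent *)

Section Beads.
Variables (R : realType) (A : algType R[i]) (HA : hopf_structure A).
Variable e : A.
Hypothesis eC : forall x, e * x = x * e.
Hypothesis ee : e * e = e.
Hypothesis Se : antipode HA e = e.
Local Notation S := (antipode HA).
Local Notation put := (put_bead HA).
Local Notation puts := (put_beads HA).

Lemma put_1 s va : put 1 s va = va.
Proof. by rewrite /put_bead (antipode1 HA) mul1r mulr1 if_same upd_id. Qed.

Lemma put_put b b' s va : put b s (put b' s va) = put (b * b') s va.
Proof.
rewrite /put_bead upd_same upd_upd (antipodeM HA).
by case: s.1; rewrite mulrA.
Qed.

(** Beads at the two ends of one arc multiply from opposite sides, so associativity covers the case
    of a common arc. *)
Lemma putC b b' s s' va : s != s' ->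
  put b s (put b' s' va) = put b' s' (put b s va).
Proof.
case: s s' => [u l] [u' l'] neq; rewrite /put_bead /=.
case: (eqVneq l l') neq => [<-|ll'] neq; last first.
  rewrite !upd_other // 1?eq_sym // updC 1?eq_sym //.
rewrite !upd_same !upd_upd.
by case: u u' neq => [] [] //=; rewrite ?eqxx // mulrA.
Qed.

(* Functionals of the arc values that factor through the tensor product, over
   the open arcs of the front, of the ideal [A * e]. *)
Record multilin (fr : seq strand) (G : (nat -> A) -> R[i]) : Prop := Multilin {
  ml_ext : forall va va', (forall s, s \in fr -> va s.2 = va' s.2) ->
    G va = G va';
  ml_lin : forall s va a x y, s \in fr ->
    G (upd va s.2 (a *: x + y)) = a * G (upd va s.2 x) + G (upd va s.2 y);
  ml_e : forall s va, s \in fr -> G (upd va s.2 (va s.2 * e)) = G va }.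

Section Multilin.
Variables (fr : seq strand) (G : (nat -> A) -> R[i]).
Hypothesis GM : multilin fr G.

(** The values are multiplied by [e] strand by strand. Both ends of an arc occur in the row, and
    idempotence makes the second multiplication harmless. *)
Lemma ml_mod va va' : (forall s, s \in fr -> va s.2 * e = va' s.2 * e) ->
  G va = G va'.
Proof.
suff key (ls : seq strand) v : {subset ls <= fr} ->
    G v = G (fun m => if m \in map snd ls then v m * e else v m).
  move=> vv; rewrite (key fr va) // (key fr va') //; apply: (ml_ext GM) => s sfr.
  by rewrite map_f // vv.
elim: ls => [|s ls IH] sub //=.
have sfr : s \in fr by rewrite sub ?mem_head.
rewrite IH => [|x xs]; last by rewrite sub // inE xs orbT.
rewrite -(ml_e GM (s := s)) //; congr G; apply/funext => m; rewrite /upd inE.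
case: (m =P s.2) => [->|] //=; case: ifP => // _; by rewrite -mulrA ee.
Qed.

Lemma ml_put_lin s va : s \in fr -> forall a x y,
  G (put (a *: x + y) s va) = a * G (put x s va) + G (put y s va).
Proof.
move=> sfr a x y; rewrite /put_bead -(ml_lin GM) //; congr (G (upd va _ _)).
by case: s.1; rewrite ?linearP ?mulrDl ?mulrDr -?scalerAl -?scalerAr.
Qed.

(** The antipode fixes [e], so a bead matters only modulo [e] at downward ends as well. *)
Lemma ml_put_e s va b : s \in fr -> G (put (b * e) s va) = G (put b s va).
Proof.
move=> sfr; rewrite -[RHS](ml_e GM (s := s)) // /put upd_same upd_upd.
congr (G (upd va _ _)); rewrite (antipodeM HA) Se.
by case: s.1; rewrite -!mulrA eC.
Qed.

Lemma ml_put_mod s va b c : s \in fr -> b * e = c * e ->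
  G (put b s va) = G (put c s va).
Proof. by move=> sfr bc; rewrite -ml_put_e // bc ml_put_e. Qed.

End Multilin.

Lemma ml_put fr G b s : multilin fr G -> s \in fr ->
  multilin fr (fun va => G (put b s va)).
Proof.
move=> GM sfr; split.
- move=> va va' vv; apply: (ml_ext GM) => x xfr; rewrite /put_bead /upd.
  by case: eqP => // _; rewrite !vv.
- move=> x va a y z xfr.
  case: (eqVneq x.2 s.2) => [->|xs].
    rewrite /put_bead !upd_same !upd_upd -(ml_lin GM) //; congr (G (upd va _ _)).
    by case: s.1; rewrite ?mulrDl ?mulrDr -?scalerAl -?scalerAr.
  rewrite /put_bead !upd_other 1?eq_sym // !(updC _ _ _ xs).
  exact: (ml_lin GM).
- move=> x va xfr.
  case: (eqVneq x.2 s.2) => [->|xs].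
    rewrite /put_bead !upd_same !upd_upd -[RHS](ml_e GM (s := s)) //.
    rewrite upd_same upd_upd; congr (G (upd va _ _)).
    by case: s.1; rewrite -!mulrA ?eC.
  rewrite /put_bead !upd_other 1?eq_sym // !(updC _ _ _ xs).
  set w := upd va s.2 _; have -> : va x.2 = w x.2 by rewrite /w upd_other.
  exact: (ml_e GM).
Qed.

Lemma ml_comb fr (I : Type) (r : seq I) (c : I -> R[i])
    (G : I -> (nat -> A) -> R[i]) :
  (forall i, multilin fr (G i)) ->
  multilin fr (fun va => \sum_(i <- r) c i * G i va).
Proof.
move=> GM; split.
- by move=> va va' vv; apply: eq_bigr => i _; rewrite (ml_ext (GM i) vv).
- move=> s va a x y sfr; rewrite mulr_sumr -big_split /=.
  apply: eq_bigr => i _; rewrite (ml_lin (GM i)) // mulrDr; congr (_ + _).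
  by rewrite mulrCA.
- by move=> s va sfr; apply: eq_bigr => i _; rewrite (ml_e (GM i)).
Qed.

Lemma ml_sum fr (I : Type) (r : seq I) (G : I -> (nat -> A) -> R[i]) :
  (forall i, multilin fr (G i)) ->
  multilin fr (fun va => \sum_(i <- r) G i va).
Proof.
move=> GM; have := ml_comb r (fun=> 1) GM; congr multilin.
by apply/funext => va; apply: eq_bigr => i _; rewrite mul1r.
Qed.

Lemma ml_scale fr (c : R[i]) G : multilin fr G -> multilin fr (fun va => c * G va).
Proof.
move=> GM; have := @ml_comb fr unit [:: tt] (fun=> c) (fun=> G) (fun=> GM).
by congr multilin; apply/funext => va; rewrite big_seq1.
Qed.

(** * Action of a Hopf algebra on the strands of a row *)

Section Action.
Variables (B : algType R[i]) (HB : hopf_structure B) (psi : {lrmorphism B -> A}).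

(* [act f x G] evaluates [G] after multiplying the values of the strands in
   [f] by the tensor factors of the iterated coproduct of [x]. *)
Fixpoint act (f : seq strand) (x : B) (G : (nat -> A) -> R[i]) (va : nat -> A) :
    R[i] :=
  if f is s :: f' then
    \sum_(u <- comul HB x) act f' u.2 G (put (psi u.1) s va)
  else counit HB x * G va.

Lemma act_put f x G s b va : s \notin f ->
  act f x G (put b s va) = act f x (fun v => G (put b s v)) va.
Proof.
elim: f x va => [|s' f IH] x va //=; rewrite inE negb_or => /andP[ss' sf].
by apply: eq_bigr => u _; rewrite putC 1?eq_sym // IH.
Qed.

Lemma act_ext f x G G' va : (forall v, G v = G' v) -> act f x G va = act f x G' va.
Proof. by move=> GG; congr act; apply/funext. Qed.

Lemma act_sum f x (I : Type) (r : seq I) (c : I -> R[i])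
    (G : I -> (nat -> A) -> R[i]) va :
  act f x (fun v => \sum_(i <- r) c i * G i v) va =
  \sum_(i <- r) c i * act f x (G i) va.
Proof.
elim: f x va => [|s f IH] x va /=.
  by rewrite mulr_sumr; apply: eq_bigr => i _; rewrite mulrCA.
under eq_bigr do rewrite IH.
by rewrite exchange_big /=; apply: eq_bigr => i _; rewrite mulr_sumr.
Qed.

Lemma act_sum1 f x (I : Type) (r : seq I) (G : I -> (nat -> A) -> R[i]) va :
  act f x (fun v => \sum_(i <- r) G i v) va = \sum_(i <- r) act f x (G i) va.
Proof.
transitivity (act f x (fun v => \sum_(i <- r) 1 * G i v) va).
  by apply: act_ext => v; apply: eq_bigr => i _; rewrite mul1r.
by rewrite act_sum; apply: eq_bigr => i _; rewrite mul1r.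
Qed.

Lemma act_scale f x c G va : act f x (fun v => c * G v) va = c * act f x G va.
Proof.
have := act_sum f x [:: tt] (fun=> c) (fun=> G) va.
by rewrite big_seq1 => <-; apply: act_ext => v; rewrite big_seq1.
Qed.

Lemma act_lin_fun f x c G H va :
  act f x (fun v => c * G v + H v) va = c * act f x G va + act f x H va.
Proof.
have := act_sum f x [:: true; false] (fun b => if b then c else 1)
  (fun b => if b then G else H) va.
rewrite !big_cons !big_nil /= !addr0 mul1r => <-.
by apply: act_ext => v; rewrite !big_cons !big_nil /= addr0 mul1r.
Qed.

Lemma ml_act f fr x G : {subset f <= fr} -> uniq f -> multilin fr G ->
  multilin fr (act f x G).
Proof.
elim: f x => [|s f IH] x sub /=; first by move=> _; exact: ml_scale.
move=> /andP[sf uf] GM; apply: ml_sum => u; apply: ml_put; last first.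
  by rewrite sub ?mem_head.
by apply: IH => // y yf; rewrite sub // inE yf orbT.
Qed.

Section Fixed.
Variables (fr : seq strand).

Lemma act_linl f G va : {subset f <= fr} -> uniq f -> multilin fr G ->
  forall a x y, act f (a *: x + y) G va = a * act f x G va + act f y G va.
Proof.
elim: f va G => [|s f IH] va G sub /=.
  by move=> _ _ a x y; rewrite linearP mulrDl mulrA.
move=> /andP[sf uf] GM a x y.
have sfr : s \in fr by rewrite sub ?mem_head.
have subf : {subset f <= fr} by move=> z zf; rewrite sub // inE zf orbT.
pose F u v := act f v G (put (psi u) s va).
have Fb : bilin F.
  split=> c u v w; rewrite /F; last exact: IH.
  by rewrite linearP (ml_put_lin (ml_act w subf uf GM)).
rewrite (tensor_eqP (comul_linear HB a x y) Fb) big_cat big_map /=.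
congr (_ + _); rewrite mulr_sumr; apply: eq_bigr => u _.
have := Fb.1 a u.1 0 u.2; rewrite addr0 => ->.
suff -> : F 0 u.2 = 0 by rewrite addr0.
by have := Fb.1 (-1) 0 0 u.2; rewrite scaler0 addr0 mulN1r addNr.
Qed.

Lemma act0 f G va : {subset f <= fr} -> uniq f -> multilin fr G ->
  act f 0 G va = 0.
Proof.
move=> sub uf GM; have := act_linl va sub uf GM (-1) 0 0.
by rewrite scaler0 addr0 mulN1r addNr.
Qed.

Lemma actD f G va x y : {subset f <= fr} -> uniq f -> multilin fr G ->
  act f (x + y) G va = act f x G va + act f y G va.
Proof. by move=> sub uf GM; have := act_linl va sub uf GM 1 x y; rewrite scale1r mul1r. Qed.

Lemma actZ f G va a x : {subset f <= fr} -> uniq f -> multilin fr G ->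
  act f (a *: x) G va = a * act f x G va.
Proof.
by move=> sub uf GM; have := act_linl va sub uf GM a x 0; rewrite act0 // !addr0.
Qed.

Lemma act_suml f G va (I : Type) (r : seq I) (P : pred I) (F : I -> B) :
    {subset f <= fr} -> uniq f -> multilin fr G ->
  act f (\sum_(i <- r | P i) F i) G va = \sum_(i <- r | P i) act f (F i) G va.
Proof.
move=> sub uf GM; apply: (big_morph (fun x => act f x G va)).
- by move=> x y; rewrite actD.
- exact: act0.
Qed.

Lemma act_bilin_cons s f G va : {subset s :: f <= fr} -> uniq (s :: f) ->
  multilin fr G -> bilin (fun u v => act f v G (put (psi u) s va)).
Proof.
move=> sub /= /andP[sf uf] GM.
have sfr : s \in fr by rewrite sub ?mem_head.
have subf : {subset f <= fr} by move=> z zf; rewrite sub // inE zf orbT.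
split=> c u v w; last exact: act_linl.
by rewrite linearP (ml_put_lin (ml_act w subf uf GM)).
Qed.

(** The order is reversed because functionals are pulled back: the beads of [x] are laid first and
    those of [y] come on their left. *)
Lemma act_mul f x y G va : {subset f <= fr} -> uniq f -> multilin fr G ->
  act f x (act f y G) va = act f (y * x) G va.
Proof.
elim: f x y G va => [|s f IH] x y G va sub /=.
  by move=> _ _; rewrite rmorphM mulrA (mulrC (counit HB x)).
move=> usf GM; have /= /andP[sf uf] := usf.
have sfr : s \in fr by rewrite sub ?mem_head.
have subf : {subset f <= fr} by move=> z zf; rewrite sub // inE zf orbT.
rewrite (tensor_eqP (comulM HB y x) (act_bilin_cons va sub usf GM)).
rewrite big_allpairs_dep /= exchange_big /=; apply: eq_bigr => u _.
rewrite act_sum1; apply: eq_bigr => v _.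
by rewrite -act_put // IH // put_put rmorphM.
Qed.

(** The recursion of [act] ends with a counit on the empty list, which the counit axiom absorbs. *)
Lemma act_single s x G va : s \in fr -> multilin fr G ->
  act [:: s] x G va = G (put (psi x) s va).
Proof.
move=> sfr GM /=; rewrite -[in RHS](counitr HB x) raddf_sum.
have G0 : G (put 0 s va) = 0.
  by have := ml_put_lin GM va sfr (-1) 0 0; rewrite scaler0 addr0 mulN1r addNr.
rewrite (big_morph (fun b => G (put b s va)) (id1 := 0) (op1 := +%R)) //; last first.
  by move=> b c; have := ml_put_lin GM va sfr 1 b c; rewrite scale1r mul1r.
apply: eq_bigr => u _.
have := ml_put_lin GM va sfr (counit HB u.2) (psi u.1) 0.
by rewrite G0 !addr0 /= linearZ => ->.
Qed.

(** Coassociativity: the iterated coproduct may be cut at any place of the row. *)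
Lemma act_cat f1 f2 x G va : {subset f1 ++ f2 <= fr} -> uniq (f1 ++ f2) ->
  multilin fr G ->
  act (f1 ++ f2) x G va = \sum_(u <- comul HB x) act f1 u.1 (act f2 u.2 G) va.
Proof.
elim: f1 x va => [|s f IH] x va sub /=.
  move=> uf GM; rewrite -{1}(counitl HB x) act_suml //.
  by apply: eq_bigr => u _; rewrite actZ.
move=> usf GM; have /= /andP[sf uf] := usf.
have sfr : s \in fr by rewrite sub ?mem_head.
have subf : {subset f ++ f2 <= fr} by move=> z zf; rewrite sub // inE zf orbT.
have sub1 : {subset f <= fr} by move=> z zf; rewrite subf // mem_cat zf.
have sub2 : {subset f2 <= fr} by move=> z zf; rewrite subf // mem_cat zf orbT.
have [u1 u2] : uniq f /\ uniq f2 by move: uf; rewrite cat_uniq => /and3P[].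
under eq_bigr do rewrite IH //.
rewrite -(comul_assoc HB x (f := fun a b c =>
   act f b (act f2 c G) (put (psi a) s va) : R[i]^o)) //.
have M2 w := ml_act w sub2 u2 GM.
split=> y z a u v.
- by rewrite linearP (ml_put_lin (ml_act _ sub1 u1 (M2 z)) va sfr).
- exact: act_linl.
- rewrite /GRing.scale /= -act_lin_fun; apply: act_ext => w.
  exact: act_linl.
Qed.

Lemma act_one f G va : {subset f <= fr} -> uniq f -> multilin fr G ->
  act f 1 G va = G va.
Proof.
elim: f va => [|s f IH] va sub /=; first by rewrite rmorph1 mul1r.
move=> usf GM; have /= /andP[sf uf] := usf.
rewrite (tensor_eqP (comul1 HB) (act_bilin_cons va sub usf GM)) big_seq1 /=.
by rewrite rmorph1 put_1 IH // => z zf; rewrite sub // inE zf orbT.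
Qed.

Lemma act_cat_bilin f1 f2 G va : {subset f1 ++ f2 <= fr} -> uniq (f1 ++ f2) ->
  multilin fr G -> bilin (fun u v => act f1 u (act f2 v G) va).
Proof.
rewrite cat_uniq => sub /and3P[u1 _ u2] GM.
have sub1 : {subset f1 <= fr} by move=> z zf; rewrite sub // mem_cat zf.
have sub2 : {subset f2 <= fr} by move=> z zf; rewrite sub // mem_cat zf orbT.
split=> a y z w; first exact: (act_linl _ sub1 u1 (ml_act w sub2 u2 GM)).
by rewrite -act_lin_fun; apply: act_ext => v; apply: act_linl.
Qed.

Section SkewPrimitive.
Variables k x : B.
Hypothesis comul_k : tensor_eq (comul HB k) [:: (k, k)].
Hypothesis comul_x : tensor_eq (comul HB x) [:: (x, k); (1, x)].

Lemma act_cons_grouplike s f G va : {subset s :: f <= fr} -> uniq (s :: f) ->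
  multilin fr G -> act (s :: f) k G va = act f k G (put (psi k) s va).
Proof.
move=> sub usf GM /=.
by rewrite (tensor_eqP comul_k (act_bilin_cons va sub usf GM)) big_seq1.
Qed.

Lemma act_cat_grouplike f1 f2 G va : {subset f1 ++ f2 <= fr} ->
  uniq (f1 ++ f2) -> multilin fr G ->
  act (f1 ++ f2) k G va = act f1 k (act f2 k G) va.
Proof.
move=> sub uf GM; rewrite (act_cat _ _ sub) //.
by rewrite (tensor_eqP comul_k (act_cat_bilin va sub uf GM)) big_seq1.
Qed.

Lemma act_cat_skew f1 f2 G va : {subset f1 ++ f2 <= fr} ->
  uniq (f1 ++ f2) -> multilin fr G ->
  act (f1 ++ f2) x G va = act f1 x (act f2 k G) va + act f2 x G va.
Proof.
move=> sub uf GM; rewrite (act_cat _ _ sub) //.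
rewrite (tensor_eqP comul_x (act_cat_bilin va sub uf GM)) big_cons big_seq1 /=.
have [u1 u2] : uniq f1 /\ uniq f2 by move: uf; rewrite cat_uniq => /and3P[].
rewrite act_one //; first by move=> z zf; rewrite sub // mem_cat zf.
by apply: ml_act => // z zf; rewrite sub // mem_cat zf orbT.
Qed.

End SkewPrimitive.

End Fixed.
End Action.

Lemma uniq_map_inj (T T' : eqType) (g : T -> T') (s : seq T) :
  uniq (map g s) -> {in s &, injective g}.
Proof.
elim: s => [|x s IH] //= /andP[gx us] y z.
rewrite !inE => /predU1P[->|ys] /predU1P[->|zs] // E.
- by rewrite E map_f in gx.
- by rewrite -E map_f in gx.
- exact: IH.
Qed.

(** This turns a dotted circle into an action on the strands through it. The recursions end
    differently, [iter_comul] at one factor and [act] at none, hence the separate case of a single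
    strand. *)
Lemma act_iter_comul_map fr f (B : algType R[i]) (HB : hopf_structure B)
    (psi : {lrmorphism B -> A}) x G va :
  {subset f <= fr} -> multilin fr G ->
  \sum_(t <- iter_comul HB (size f) x) t.1 * G (puts (map psi t.2) f va) =
  act HB psi f x G va.
Proof.
move=> + GM; elim: f x va => [|s f IH] x va sub; first by rewrite /= big_seq1.
have sfr : s \in fr by rewrite sub ?mem_head.
have subf : {subset f <= fr} by move=> z zf; rewrite sub // inE zf orbT.
case: f IH sub subf => [|s' f] IH sub subf.
  by rewrite (act_single HB psi x va sfr GM) /= big_seq1 mul1r.
rewrite [iter_comul _ _ _]/= -/(iter_comul HB (size (s' :: f))).
rewrite big_flatten /= big_map; apply: eq_bigr => u _.
by rewrite big_map -[RHS]IH.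
Qed.

Lemma act_iter_comul fr f x G va : {subset f <= fr} -> multilin fr G ->
  \sum_(t <- iter_comul HA (size f) x) t.1 * G (puts t.2 f va) =
  act HA idfun f x G va.
Proof.
move=> sub GM; rewrite -(act_iter_comul_map HA idfun _ _ sub GM).
by apply: eq_bigr => t _; rewrite map_id.
Qed.

Lemma ml_eq_mem fr fr' G : fr =i fr' -> multilin fr G -> multilin fr' G.
Proof.
move=> ff GM; split.
- by move=> va va' vv; apply: (ml_ext GM) => s sfr; rewrite vv // -ff.
- by move=> s va a x y sfr; rewrite (ml_lin GM) // ff.
- by move=> s va sfr; rewrite (ml_e GM) // ff.
Qed.

Lemma ml_eqfun fr G G' : G =1 G' -> multilin fr G -> multilin fr G'.
Proof. by move=> /funext ->. Qed.

Lemma ml_puts fr G bs ss : {subset ss <= fr} -> multilin fr G ->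
  multilin fr (fun va => G (puts bs ss va)).
Proof.
elim: ss bs G => [|s ss IH] bs G sub GM //=.
apply: (@ml_put fr (fun va => G (puts (behead bs) ss va))).
  by apply: IH => // x xs; rewrite sub // inE xs orbT.
by rewrite sub ?mem_head.
Qed.

(** * Sliding elements through a diagram *)

(** [shape] records only the effect on the row; this ties the move back to the piece, on which the
    beads depend. *)
Definition piece_move (pc : piece) (n : nat) (mid mid' : seq strand) (m : move) :
    Prop :=
  match pc with
  | Cup _ o => m = MCup o n
  | Cap _ => exists o lin lout, m = MCap o lin lout
  | Cross _ s => exists sl sr, [/\ mid = [:: sl; sr], mid' = [:: sr; sl] &
      m = MPut (if s then [:: sl; sr] else [:: sr; sl])]
  | Dotted _ k => [/\ m = MPut mid, size mid = k & mid' = mid]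
  end.

(* A piece turns the front [f1 ++ mid ++ f2] into
   [map r f1 ++ mid' ++ map r f2]. *)
Variant shape (n : nat) :
    seq strand -> (strand -> strand) -> seq strand -> nat -> move -> Prop :=
| ShCup o : shape n [::] id [:: (~~ o, n); (o, n)] n.+1 (MCup o n)
| ShCap (o : bool) lin lout :
    shape n [:: (o, if o then lin else lout); (~~ o, if o then lout else lin)]
      (ren lin lout) [::] n (MCap o lin lout)
| ShCross s1 s2 (b : bool) :
    shape n [:: s1; s2] id [:: s2; s1] n
      (MPut (if b then [:: s1; s2] else [:: s2; s1]))
| ShDot f : shape n f id f n (MPut f).

(** Each end of an arc occurs once in the row, so beside the maximum only the opposite ends of the
    two joined arcs can occur, and none if the maximum closes a component. *)
Lemma cap_ends f1 f2 n (o : bool) lin lout s :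
  wf_front (f1 ++ [:: (o, if o then lin else lout);
                      (~~ o, if o then lout else lin)] ++ f2) n ->
  s \in f1 ++ f2 ->
  [/\ s.2 = lin -> s.1 = false /\ lin != lout
    & s.2 = lout -> s.1 = true /\ lin != lout].
Proof.
move=> -[un _ _] sf.
have sm : s \notin [:: (o, if o then lin else lout);
                      (~~ o, if o then lout else lin)].
  apply: contraL sf => sm; move: un.
  rewrite uniq_catCA cat_uniq => /and3P[_ /hasPn H _].
  by apply: contraL sm => /H.
case: s sm sf => [u l]; rewrite !inE /= negb_or => sm _ {un}.
split=> /= ll; subst l; split.
- by case: u o sm => [] [] //=; rewrite ?eqxx ?andbF.
- by apply/eqP => ll; subst lout; case: u o sm => [] [] //=; rewrite ?eqxx ?andbF.
- by case: u o sm => [] [] //=; rewrite ?eqxx ?andbF.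
- by apply/eqP => ll; subst lout; case: u o sm => [] [] //=; rewrite ?eqxx ?andbF.
Qed.

Lemma cap_other_end f1 f2 n (o : bool) lin lout :
  wf_front (f1 ++ [:: (o, if o then lin else lout);
                      (~~ o, if o then lout else lin)] ++ f2) n ->
  lin != lout -> (false, lin) \in f1 ++ f2 /\ (true, lout) \in f1 ++ f2.
Proof.
move=> [_ tf _] ll.
have := tf lin; have := tf lout; rewrite !mem_cat !inE !xpair_eqE.
have {}ll' : lout == lin = false by rewrite eq_sym (negbTE ll).
by case: o {tf} => /=; rewrite ?eqxx ?(negbTE ll) ?ll' /= ?orbT ?orbF => h1 h2;
  split; rewrite ?h1 -?h2.
Qed.

Lemma mem_mid (f1 mid f2 : seq strand) x :
  (x \in f1 ++ mid ++ f2) = (x \in mid) || (x \in f1 ++ f2).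
Proof. by rewrite !mem_cat orbCA. Qed.

Lemma wf_shape n f1 mid f2 r mid' n' m : shape n mid r mid' n' m ->
  wf_front (f1 ++ mid ++ f2) n ->
  wf_front (map r f1 ++ mid' ++ map r f2) n'.
Proof.
case=> [o|o lin lout|s1 s2 b|f]; rewrite ?map_id //.
- move=> wf; have [un tf lt] : wf_front (f1 ++ f2) n := wf.
  have fresh u : (u, n) \notin f1 ++ f2.
    by apply/negP => /lt /=; rewrite ltnn.
  split.
  + rewrite uniq_catCA cat_uniq un andbT /= inE.
    have -> : ((~~ o, n) == (o, n)) = false by case: o.
    apply/hasPn => s sf; rewrite !inE; apply/norP; split;
    by apply: contraTneq sf => ->.
  + move=> l; rewrite !mem_mid tf; congr orb.
    by rewrite !inE !xpair_eqE; case: (o) => //=; rewrite orbF.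
  + move=> s; rewrite mem_mid => /orP[|sf].
      by rewrite !inE => /orP[] /eqP->.
    by apply: ltnW; rewrite ltnS; apply: lt.
- rewrite [[::] ++ _]/= -map_cat => wf; have [un tf lt] := wf.
  have ends := cap_ends wf.
  have unf : uniq (f1 ++ f2).
    by move: un; rewrite uniq_catCA cat_uniq => /and3P[].
  have sub : {subset f1 ++ f2 <= f1 ++ [:: (o, if o then lin else lout);
     (~~ o, if o then lout else lin)] ++ f2}.
    by move=> s; rewrite !mem_cat => /orP[] ->; rewrite ?orbT.
  have tfl l : l != lin -> l != lout ->
      ((true, l) \in f1 ++ f2) = ((false, l) \in f1 ++ f2).
    move=> h1 h2; have := tf l; rewrite !mem_mid !inE !xpair_eqE.
    have [-> ->] : (l == if o then lin else lout) = false /\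
                   (l == if o then lout else lin) = false.
      by case: (o); rewrite (negbTE h1) (negbTE h2).
    by rewrite !andbF.
  have nren u l : l != lin -> (l != lout) ->
     ((u, l) \in map (ren lin lout) (f1 ++ f2)) = ((u, l) \in f1 ++ f2).
    move=> h1 h2; apply/mapP/idP => [[[u' l'] sf]|sf].
      rewrite /ren /=; case: eqP => [_ [_ h]|_ [-> ->]//].
      by rewrite h eqxx in h1.
    by exists (u, l) => //; rewrite /ren /= (negbTE h2).
  split.
  (* The merged arc keeps the initial end of [lin] and receives the final end of [lout]; the
     orientations tell them apart. *)
  + rewrite map_inj_in_uniq // => -[u l] [u' l'] sf sf'; rewrite /ren /=.
    have [a b] := ends _ sf; have [a' b'] := ends _ sf'; rewrite /= in a b a' b'.
    case: eqP => [h|_]; case: eqP => [h'|_]; first by case=> ->; rewrite h h'.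
    * by case=> uu ll; have [t _] := b h; have [f _] := a' (esym ll); rewrite t f in uu.
    * by case=> uu ll; have [t _] := b' h'; have [f _] := a ll; rewrite t f in uu.
    * by case=> -> ->.
  + move=> l; case: (eqVneq l lin) => [->|h1].
      case: (eqVneq lin lout) => [ll|ll].
        have no u : (u, lin) \notin map (ren lin lout) (f1 ++ f2).
          apply/mapP => -[[u' l'] sf]; rewrite /ren /= => -[_ h].
          have [a _] := ends _ sf; have [] := a; last by rewrite ll eqxx.
          by move: h; case: eqP => [-> _ //|_ <-].
        by rewrite !(negbTE (no _)).
      have [i1 i2] := cap_other_end wf ll.
      rewrite (_ : _ \in _ = true); last first.
        by apply/mapP; exists (true, lout) => //; rewrite /ren /= eqxx.
      rewrite (_ : _ \in _ = true) //.
      by apply/mapP; exists (false, lin) => //; rewrite /ren /= (negbTE ll).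
    case: (eqVneq l lout) => [lE|h2]; last by rewrite !nren // tfl.
    have ll : lin != lout by rewrite eq_sym -lE.
    rewrite lE.
    have no u : (u, lout) \notin map (ren lin lout) (f1 ++ f2).
      apply/mapP => -[[u' l'] sf]; rewrite /ren /= => -[_ h].
      by move: h; case: eqP => [_ h|ne h]; [move: ll; rewrite h eqxx | case: ne].
    by rewrite !(negbTE (no _)).
  + move=> s /mapP[[u l] sf ->]; rewrite /ren /=; case: eqP => _; last first.
      exact: (lt _ (sub _ sf)).
    apply: (lt (true, lin)); rewrite !mem_cat !inE.
    by case: (o); rewrite eqxx ?orbT.
- move=> [un tf lt].
  have E : f1 ++ [:: s1; s2] ++ f2 =i f1 ++ [:: s2; s1] ++ f2.
    by move=> s; rewrite !mem_cat !inE (orbC (s == s1)).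
  split; last by move=> s; rewrite -E => /lt.
  + rewrite (perm_uniq (s2 := f1 ++ [:: s1; s2] ++ f2)) //.
    by rewrite perm_cat2l perm_cat2r (perm_catC [:: s2] [:: s1]).
  + by move=> l; rewrite -!E.
Qed.

(** Local form of a step: the piece acts on a block [mid], and the strands beside it are at most
    renamed. *)
Lemma front_stepP fr n pc fr' n' m : wf_front fr n ->
  front_step fr n pc = Some (fr', n', m) ->
  exists f1 mid f2 r mid', [/\ shape n mid r mid' n' m, fr = f1 ++ mid ++ f2,
    fr' = map r f1 ++ mid' ++ map r f2 &
    piece_move pc n mid mid' m].
Proof.
have split2 i : (i.+1 < size fr)%N -> fr = take i fr ++
    [:: nth (true, 0%N) fr i; nth (true, 0%N) fr i.+1] ++ drop i.+2 fr.
  move=> lt; rewrite -{1}(cat_take_drop i fr) (drop_nth (true, 0%N)); last exact: ltnW.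
  by rewrite (drop_nth (true, 0%N)).
move=> _; case: pc => [i o|i|i s|i k] /=.
- case: ifP => // _ [<- <- <-].
  exists (take i fr), [::], (drop i fr), id, [:: (~~ o, n); (o, n)].
  by rewrite !map_id cat_take_drop; split => //; constructor.
- case E1: (nth _ fr i) => [o1 l1]; case E2: (nth _ fr i.+1) => [o2 l2].
  case: ifP => // /andP[/split2 sp]; rewrite E1 E2 in sp => oo.
  have {oo} E : o2 = ~~ o1 by case: o1 o2 oo {E1 E2 sp} => [] [].
  case D: (if o1 then _ else _) => [lin lout] [<- <- <-].
  exists (take i fr), [:: (o1, l1); (o2, l2)], (drop i.+2 fr), (ren lin lout), [::].
  split=> //; last by exists o1, lin, lout.
    have -> : [:: (o1, l1); (o2, l2)] =
      [:: (o1, if o1 then lin else lout); (~~ o1, if o1 then lout else lin)].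
      by rewrite E; case: (o1) D => -[-> ->].
    exact: ShCap.
  by rewrite map_cat.
- case: ifP => // /split2 sp [<- <- <-].
  exists (take i fr), [:: nth (true, 0%N) fr i; nth (true, 0%N) fr i.+1],
    (drop i.+2 fr), id, [:: nth (true, 0%N) fr i.+1; nth (true, 0%N) fr i].
  rewrite !map_id; split => //; first by constructor.
  by exists (nth (true, 0%N) fr i), (nth (true, 0%N) fr i.+1).
- case: ifP => // le [<- <- <-].
  exists (take i fr), (take k (drop i fr)), (drop k (drop i fr)), id, (take k (drop i fr)).
  rewrite !map_id !cat_take_drop; split => //; first by constructor.
  split=> //; rewrite size_takel // size_drop.
  by rewrite leq_subRL // (leq_trans (leq_addr k i)).
Qed.

Section Trace.
Variable tau : A -> R[i].
Hypothesis tau_lin : forall a x y, tau (a *: x + y) = a * tau x + tau y.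
Hypothesis tauC : forall x y, tau (x * y) = tau (y * x).
Hypothesis tau_e : forall x, tau (x * e) = tau x.
Local Notation vmove := (move_values HA tau).
Local Notation pull := (pull HA tau).

Section Shape.
Variables (n : nat) (f1 mid f2 : seq strand) (r : strand -> strand).
Variables (mid' : seq strand) (n' : nat) (m : move).
Hypothesis sh : shape n mid r mid' n' m.
Hypothesis wf : wf_front (f1 ++ mid ++ f2) n.
Let fr := f1 ++ mid ++ f2.
Let fr' := map r f1 ++ mid' ++ map r f2.

Lemma mem_cap (o : bool) lin lout : m = MCap o lin lout ->
  [/\ fr' = map (ren lin lout) (f1 ++ f2), (true, lin) \in fr, (false, lout) \in fr,
     lin != lout -> (false, lin) \in f1 ++ f2 /\ (true, lout) \in f1 ++ f2
   & forall s, s \in fr -> [\/ s.2 = lin, s.2 = lout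
        | [/\ s \in f1 ++ f2, s.2 != lin & s.2 != lout]]].
Proof.
rewrite /fr /fr'; move: wf; case: sh => // o' lin' lout' wf' [_ <- <-]; split.
- by rewrite map_cat.
- by rewrite mem_mid !inE; case: (o'); rewrite !eqxx ?orbT.
- by rewrite mem_mid !inE; case: (o'); rewrite !eqxx ?orbT.
- exact: cap_other_end wf'.
- move=> s; rewrite mem_mid => sf.
  case: (eqVneq s.2 lin') => h1; first by constructor 1.
  case: (eqVneq s.2 lout') => h2; first by constructor 2.
  constructor 3; split=> //; case/orP: sf => //.
  by rewrite !inE => /orP[] /eqP h; move: h1 h2; rewrite h; case: (o'); rewrite eqxx.
Qed.

Lemma mem_cap_ends (o : bool) lin lout s : m = MCap o lin lout ->
  s \in f1 ++ f2 ->
  [/\ s.2 = lin -> s.1 = false /\ lin != lout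
    & s.2 = lout -> s.1 = true /\ lin != lout].
Proof.
by move: wf; case: sh => // o' lin' lout' wf' [_ <- <-]; apply: cap_ends wf'.
Qed.

Lemma mem_put ss : m = MPut ss ->
  [/\ fr =i fr', {subset ss <= fr}, r = id & {subset ss <= mid}].
Proof.
rewrite /fr /fr'; case: sh => // [s1 s2 b|f] [<-]; rewrite !map_id; split=> //.
- by move=> s; rewrite !mem_mid !inE (orbC (s == s1)).
- by move=> s; rewrite mem_mid => h; apply/orP; left; case: b h; rewrite !inE // orbC.
- by move=> s; case: b; rewrite !inE // orbC.
- by move=> s sf; rewrite mem_mid sf.
Qed.

Lemma vmove_ml bs G : multilin fr' G ->
  multilin fr (fun va => (vmove m bs va).1 * G (vmove m bs va).2).
Proof.
move=> GM; have fresh s : s \in fr -> s.2 != n.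
  by case: wf => _ _ lt /lt h; rewrite neq_ltn h.
case Em: m mem_cap => [o n0|o lin lout|ss] capE.
- have [E1 E2 E3 E4] : [/\ mid = [::], r = id, mid' = [:: (~~ o, n); (o, n)] & n0 = n].
    by move: sh; rewrite Em => sh'; inversion sh'.
  have sub s : s \in fr -> s \in fr' by rewrite /fr /fr' !mem_mid E2 !map_id E1 in_nil /= => ->; rewrite orbT.
  rewrite E4 /=; split.
  + move=> va va' vv; congr (1 * _); apply: (ml_ext GM) => s.
    rewrite /fr' mem_mid E2 !map_id E3 => /orP[|sf].
      by rewrite !inE => /orP[] /eqP->; rewrite /= !upd_same.
    have sfr : s \in fr by rewrite /fr mem_mid sf orbT.
    by rewrite !upd_other ?fresh // vv.
  + move=> s va a x y sfr; rewrite !mul1r !(updC _ _ _ (fresh _ sfr)).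
    exact/(ml_lin GM)/sub.
  + move=> s va sfr; rewrite !mul1r !(updC _ _ _ (fresh _ sfr)).
    set w := upd va n _; have -> : va s.2 = w s.2 by rewrite /w upd_other ?fresh.
    exact/(ml_e GM)/sub.
- have [E1 m1 m2 oth spec] := capE _ _ _ erefl.
  have subr s : s \in fr' -> exists2 s', s' \in f1 ++ f2 & s = ren lin lout s'.
    by rewrite E1 => /mapP.
  have sub s : s \in f1 ++ f2 -> s \in fr by rewrite /fr mem_mid => ->; rewrite orbT.
  have spec' s : s \in fr' -> s.2 = lin \/ [/\ s \in f1 ++ f2, s.2 != lin & s.2 != lout].
    move=> /subr[s' sf ->]; rewrite /ren /=.
    have [->|->|[_ h1 h2]] := spec _ (sub _ sf); rewrite ?eqxx ?if_same; [by left..|right].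
    by rewrite (negbTE h2); case: s' sf h1 h2.
  have keep s : s \in f1 ++ f2 -> s.2 != lout -> s \in fr'.
    move=> sf h; rewrite E1; apply/mapP; exists s => //.
    by rewrite /ren (negbTE h); case: (s).
  rewrite /=; set c := if o then _ else _.
  case: eqP => [ll|/eqP ll].
    subst lout.
    (* The closed arc no longer meets the row above, so the value still stored at [lin] is invisible
       to [G]. *)
    have dead s : s \in fr' -> s \in fr /\ s.2 != lin.
      move=> /subr[s' sf ->]; have [_ h] := mem_cap_ends Em sf.
      have {}h : s'.2 != lin by apply/eqP => /h[_]; rewrite eqxx.
      by rewrite /ren (negbTE h) h; case: s' sf {h} => u l /sub.
    have Gdead va x : G (upd va lin x) = G va.
      by apply: (ml_ext GM) => s /dead[_ h]; rewrite upd_other.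
    have spec2 s : s \in fr -> s.2 = lin \/ s \in fr' /\ s.2 != lin.
      by case/spec => [->|->|[sf h _]]; auto.
    split.
    + move=> va va' vv; congr (tau (_ * _) * _); first exact: (vv _ m1).
      by apply: (ml_ext GM) => s /dead[/vv].
    + move=> s va a x y /spec2[->|[sfr h]].
        by rewrite /= !upd_same !Gdead mulrDr -scalerAr tau_lin mulrDl mulrA.
      by rewrite /= !upd_other 1?eq_sym // (ml_lin GM) // mulrDr mulrCA.
    + move=> s va /spec2[->|[sfr h]].
        by rewrite /= upd_same Gdead mulrA tau_e.
      by rewrite /= upd_other 1?eq_sym // (ml_e GM).
  (* The same for [lout], which has been absorbed by [lin]. *)
  have Gdead va x y : G (upd (upd va lout x) lin y) = G (upd va lin y).
    apply: (ml_ext GM) => s /spec'; rewrite /= /upd; case: eqP => [//|h1 [/h1//|[_ _ h2]]].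
    by rewrite (negbTE h2).
  have [o1 o2] := oth ll.
  have lin' : (false, lin) \in fr' by apply: keep.
  split.
  + move=> va va' vv; congr (_ * _).
    have [v1 v2] : va lin = va' lin /\ va lout = va' lout by split; [exact: (vv _ m1)|exact: (vv _ m2)].
    apply: (ml_ext GM) => s /spec'; rewrite /= v1 v2 /upd.
    by case: eqP => [//|h1 [/h1//|[/sub/vv]]].
  + move=> s va a x y /spec[->|->|[sf h1 h2]] /=.
    * rewrite !upd_same !upd_upd !(upd_other _ _ (m := lout)) 1?eq_sym //.
      by rewrite !mulrDr -!scalerAr !mul1r (ml_lin GM va _ _ _ lin').
    * rewrite !upd_same !(upd_other _ _ (m := lin)) // !Gdead.
      by rewrite mulrDl -scalerAl !mul1r (ml_lin GM va _ _ _ lin').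
    * rewrite !upd_other 1?eq_sym // !mul1r !(updC _ _ _ h1).
      exact/(ml_lin GM)/keep.
  + move=> s va /spec[->|->|[sf h1 h2]] /=.
    * rewrite !upd_same !upd_upd !(upd_other _ _ (m := lout)) 1?eq_sym //.
      rewrite !mulrA -[in RHS](ml_e GM _ lin') /= upd_same upd_upd //.
    * rewrite !upd_same !(upd_other _ _ (m := lin)) // !Gdead.
      by rewrite -mulrA eC mulrA -[in RHS](ml_e GM _ lin') /= upd_same upd_upd.
    * rewrite !upd_other 1?eq_sym // !mul1r !(updC _ _ _ h1).
      set w := upd va lin _; have -> : va s.2 = w s.2 by rewrite /w upd_other.
      exact/(ml_e GM)/keep.
- have [E1 E2 _ _] := mem_put Em.
  apply: (@ml_eq_mem fr') => [s|]; first by rewrite E1.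
  apply: (@ml_eqfun _ (fun va => G (puts bs ss va))) => [va|]; first by rewrite mul1r.
  by apply: ml_puts => // s; rewrite -E1; apply: E2.
Qed.

Lemma pull_ml T G : multilin fr' G -> multilin fr (pull T m G).
Proof. by move=> GM; apply: ml_comb => t; apply: vmove_ml. Qed.

(** A bead beside the piece commutes with it. At a maximum the strand may be the far end of a joined
    arc, and then associativity of the merged product is used. *)
Lemma vmove_put bs b s va G : multilin fr' G -> s \in f1 ++ f2 ->
  (vmove m bs (put b s va)).1 * G (vmove m bs (put b s va)).2 =
  (vmove m bs va).1 * G (put b (r s) (vmove m bs va).2).
Proof.
move=> GM sf; have sfr : s \in fr by rewrite /fr mem_mid sf orbT.
have fresh : s.2 != n.
  by case: wf => _ _ lt; have := lt _ sfr; rewrite ltn_neqAle => /andP[].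
case Em: m => [o n0|o lin lout|ss].
- have [E2 E4] : r = id /\ n0 = n.
    by move: sh; rewrite Em => sh'; inversion sh'.
  by rewrite E2 E4 /= /put !upd_other // updC // eq_sym.
- have [E1 m1 m2 oth spec] := mem_cap Em.
  have Er : r = ren lin lout by move: sh; rewrite Em => sh'; inversion sh'.
  have [el eo] := mem_cap_ends Em sf.
  rewrite /=; set c := if o then _ else _.
  case: eqP => [ll|/eqP ll].
    have h1 : s.2 != lin by apply/eqP => /el[_]; rewrite ll eqxx.
    have h2 : s.2 != lout by rewrite -ll.
    rewrite /= {1}/put_bead upd_other 1?eq_sym //; congr (_ * G (put _ _ _)).
    by rewrite Er /ren (negbTE h2); case: (s).
  congr (_ * _); rewrite /= Er; apply: (ml_ext GM) => x; rewrite E1 => /mapP[x' xf ->].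
  case: (eqVneq s.2 lout) => h2.
    have [s1 _] := eo h2; rewrite /put_bead /ren h2 s1 eqxx /= upd_same.
    rewrite (upd_other _ _ (m := lin)) // /upd eqxx.
    case: ifP => [_|_]; first by rewrite -mulrA.
    case: (eqVneq x'.2 lout) => [_|h]; last by rewrite (negbTE h).
    by rewrite (negbTE ll).
  case: (eqVneq s.2 lin) => h1.
    have [s1 _] := el h1; rewrite /put_bead /ren h1 s1 (negbTE ll) /=.
    rewrite /upd eqxx; rewrite eq_sym in ll; rewrite (negbTE ll).
    by set y := if x'.2 == _ then _ else _; case: (y == lin); rewrite ?mulrA.
  have -> : ren lin lout s = s by rewrite /ren (negbTE h2); case: (s).
  rewrite /put_bead !(upd_other _ _ (m := lin)) 1?eq_sym // (upd_other _ _ (m := lout)) 1?eq_sym //.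
  by rewrite updC // (upd_other _ _ (m := s.2)).
- have [_ _ Er sm] := mem_put Em; rewrite Er /= ; congr (_ * G _).
  have: s \notin ss.
    apply: contraL sf => /sm sm'; case: wf => un _ _; move: un.
    rewrite uniq_catCA cat_uniq => /and3P[_ /hasPn H _].
    by apply: contraL sm' => /H.
  elim: ss bs va {Em sm} => [|x ss IH] bs va //=; rewrite inE negb_or => /andP[sx sss].
  by rewrite -IH // putC // eq_sym.
Qed.

Lemma pull_put T b s va G : multilin fr' G -> s \in f1 ++ f2 ->
  pull T m G (put b s va) = pull T m (fun v => G (put b (r s) v)) va.
Proof. by move=> GM sf; apply: eq_bigr => t _; rewrite vmove_put. Qed.

Lemma r_inj : {in f1 ++ f2 &, injective r} /\ {subset map r (f1 ++ f2) <= fr'}.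
Proof.
have [un _ _] := wf_shape sh wf; split; last first.
  by move=> s; rewrite map_cat /fr' mem_mid => ->; rewrite orbT.
apply: uniq_map_inj; move: un.
by rewrite uniq_catCA cat_uniq -map_cat => /and3P[].
Qed.

Lemma act_pull T f x G va : uniq f -> {subset f <= f1 ++ f2} -> multilin fr' G ->
  act HA idfun f x (pull T m G) va = pull T m (act HA idfun (map r f) x G) va.
Proof.
elim: f x va => [|s f IH] x va /=.
  by move=> _ _ GM; rewrite /pull mulr_sumr; apply: eq_bigr => t _; rewrite mulrCA; congr (_ * _); rewrite mulrCA.
move=> /andP[sf uf] sub GM.
have sub' : {subset f <= f1 ++ f2} by move=> y yf; rewrite sub // inE yf orbT.
under eq_bigr do rewrite IH //.
transitivity (\sum_(u <- comul HA x) pull T m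
   (fun v => act HA idfun (map r f) u.2 G (put (idfun u.1) (r s) v)) va).
  apply: eq_bigr => u _; apply: pull_put; last by rewrite sub ?mem_head.
  apply: ml_act => //.
    by move=> y /mapP[y' yf ->]; apply: r_inj.2; apply: map_f; apply: sub'.
  rewrite map_inj_in_uniq // => y z yf zf; apply: r_inj.1; exact: sub'.
rewrite /pull exchange_big /=; apply: eq_bigr => t _.
by rewrite -!mulr_sumr.
Qed.
End Shape.

Section Natural.
Variables (k x : A).
Hypothesis comul_k : tensor_eq (comul HA k) [:: (k, k)].
Hypothesis comul_x : tensor_eq (comul HA x) [:: (x, k); (1, x)].
Variable T : piece -> seq (R[i] * seq A).

(** The beads of each kind of piece intertwine the coproduct of [z]. Only extrema oriented from left
    to right are listed, since for the others this is the antipode axiom. At a crossing the strands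
    change places, which exchanges the coproduct and its opposite; the first argument of [F] belongs
    to the over-strand. *)
Record commutes_with_beads (g gV : A) (La : A) (z : A) : Prop := CommBeads {
  comm_cup : \sum_(u <- comul HA z) u.2 * gV * S u.1 = counit HA z *: gV;
  comm_cap : \sum_(u <- comul HA z) S u.2 * g * u.1 = counit HA z *: g;
  comm_dot : z * La = La * z;
  comm_over : forall i F, bilin F ->
    \sum_(u <- comul HA z) \sum_(t <- T (Cross i true))
      t.1 * F (head 1 t.2 * u.1) (head 1 (behead t.2) * u.2) =
    \sum_(u <- comul HA z) \sum_(t <- T (Cross i true))
      t.1 * F (u.2 * head 1 t.2) (u.1 * head 1 (behead t.2));
  comm_under : forall i F, bilin F ->
    \sum_(u <- comul HA z) \sum_(t <- T (Cross i false))
      t.1 * F (head 1 t.2 * u.2) (head 1 (behead t.2) * u.1) =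
    \sum_(u <- comul HA z) \sum_(t <- T (Cross i false))
      t.1 * F (u.1 * head 1 t.2) (u.2 * head 1 (behead t.2)) }.

Variables (g gV La : A).
Hypothesis T_cup : forall i o, T (Cup i o) = [:: (1, [:: gV])].
Hypothesis T_cap : forall i, T (Cap i) = [:: (1, [:: g])].
Hypothesis T_dot : forall i l, T (Dotted i l) = iter_comul HA l La.

Local Notation act := (act HA idfun).

Lemma act_two fr s1 s2 z G va : s1 \in fr -> s2 \in fr -> s1 != s2 ->
  multilin fr G ->
  act [:: s1; s2] z G va =
  \sum_(u <- comul HA z) G (put u.2 s2 (put u.1 s1 va)).
Proof.
move=> s1fr s2fr s12 GM; rewrite [LHS]/=; apply: eq_bigr => u _.
exact: (act_single HA idfun _ _ s2fr GM).
Qed.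

Lemma bilin_two fr s1 s2 G va : s1 \in fr -> s2 \in fr ->
  multilin fr G -> bilin (fun a b => G (put b s2 (put a s1 va))).
Proof.
move=> s1fr s2fr GM; split=> a y z w; last exact: (ml_put_lin GM).
exact: (ml_put_lin (ml_put w GM s2fr)).
Qed.

Lemma ml_upd_sum fr s G va (I : Type) (r : seq I) (F : I -> A) :
  s \in fr -> multilin fr G ->
  G (upd va s.2 (\sum_(i <- r) F i)) = \sum_(i <- r) G (upd va s.2 (F i)).
Proof.
move=> sfr GM; apply: (big_morph (fun y => G (upd va s.2 y))).
  by move=> y z; have := ml_lin GM va 1 y z sfr; rewrite scale1r mul1r.
by have := ml_lin GM va (-1) 0 0 sfr; rewrite scaler0 addr0 mulN1r addNr.
Qed.

Lemma ml_updZ fr s G va a y : s \in fr -> multilin fr G ->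
  G (upd va s.2 (a *: y)) = a * G (upd va s.2 y).
Proof.
move=> sfr GM; have := ml_lin GM va a y 0 sfr; rewrite addr0 => ->.
have := ml_lin GM va (-1) 0 0 sfr; rewrite scaler0 addr0 mulN1r addNr => ->.
by rewrite addr0.
Qed.

Lemma tau_sum (I : Type) (r : seq I) (F : I -> A) :
  tau (\sum_(i <- r) F i) = \sum_(i <- r) tau (F i).
Proof.
apply: (big_morph tau).
  by move=> y z; have := tau_lin 1 y z; rewrite scale1r mul1r.
by have := tau_lin (-1) 0 0; rewrite scaler0 addr0 mulN1r addNr.
Qed.

Lemma tauZ a y : tau (a *: y) = a * tau y.
Proof.
have := tau_lin a y 0; rewrite addr0 => ->.
by have := tau_lin (-1) 0 0; rewrite scaler0 addr0 mulN1r addNr => ->; rewrite addr0.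
Qed.

Lemma pull_mid z fr n pc f1 mid f2 r mid' n' m G va :
  commutes_with_beads g gV La z -> wf_front fr n ->
  shape n mid r mid' n' m -> fr = f1 ++ mid ++ f2 ->
  piece_move pc n mid mid' m -> multilin (map r f1 ++ mid' ++ map r f2) G ->
  act mid z (pull (T pc) m G) va = pull (T pc) m (act mid' z G) va.
Proof.
move=> [ccup ccap cdot cover cunder] + sh; set fr' := _ ++ _ ++ map _ _.
move=> + frE; rewrite frE => wf pcE GM.
have PM := pull_ml sh wf (T pc) GM.
have wf' := wf_shape sh wf; have [un' _ _] := wf'; have [un _ _] := wf.
have sub' s : s \in mid' -> s \in fr' by rewrite /fr' mem_mid => ->.
have sub s : s \in mid -> s \in f1 ++ mid ++ f2 by rewrite mem_mid => ->.
case: pc pcE PM => [i o|i|i b|i l] pcE PM.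
- have [E1 E2 E3] : [/\ mid = [::], r = id & mid' = [:: (~~ o, n); (o, n)]].
    by move: sh; rewrite pcE => sh'; inversion sh'.
  have nfr u : (u, n) \in fr' by apply: sub'; rewrite E3 !inE !xpair_eqE eqxx; case: (o) (u) => [] [].
  pose c := if o then gV else 1.
  have pE H : pull (T (Cup i o)) m H va = H (upd va n c).
    by rewrite /pull T_cup big_seq1 pcE /= !mul1r.
  rewrite E1 E3 /= !pE -/(act [:: (~~ o, n); (o, n)] z G _).
  rewrite (act_two _ _ _ _ _ GM) ?nfr //; last by case: (o).
  rewrite -(ml_updZ (s := (true, n)) _ _ _ _ GM) //.
  (* For the minimum without a bead this is the antipode axiom. *)
  have -> : counit HA z *: c = \sum_(u <- comul HA z)
      (if o then u.2 * gV * S u.1 else u.1 * S u.2).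
    by rewrite /c; case: (o); rewrite ?ccup // antipoder.
  rewrite (ml_upd_sum _ _ _ (nfr true) GM); apply: eq_bigr => u _.
  rewrite /put_bead /= !upd_same !upd_upd /c; congr (G (upd va n _)).
  by case: (o); rewrite /= ?mulrA ?mul1r ?mulr1.
- case: pcE => o [lin [lout mE]].
  have [E1 m1 m2 oth spec] := mem_cap sh wf mE.
  pose s1 : strand := (o, if o then lin else lout).
  pose s2 : strand := (~~ o, if o then lout else lin).
  have [midE mid'E] : mid = [:: s1; s2] /\ mid' = [::].
    by move: sh; rewrite mE => sh'; inversion sh'.
  pose c := if o then g else 1.
  pose h (u : A * A) := if o then S u.2 * g * u.1 else S u.1 * u.2.
  have hE : \sum_(u <- comul HA z) h u = counit HA z *: c.
    by rewrite /h /c; case: (o); rewrite ?ccap // antipodel.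
  have pE H v : pull (T (Cap i)) m H v =
      if lin == lout then tau (c * v lin) * H v
      else H (upd v lin (v lout * (c * v lin))).
    rewrite /pull T_cap big_seq1 mE /= -/c.
    by case: eqP; rewrite !mul1r.
  have lastE s : s \in fr' -> exists2 s', s' \in f1 ++ f2 & s = ren lin lout s'.
    by rewrite -/fr' in E1; rewrite E1 => /mapP.
  have s12 : s1 != s2 by rewrite /s1 /s2; case: (o).
  rewrite midE mid'E (act_two _ _ _ _ _ PM) ?sub // ?midE ?inE ?eqxx ?orbT //.
  rewrite pE /=; under eq_bigr do rewrite pE.
  case: eqP => [ll|/eqP ll].
    subst lout.
    have dead v y : G (upd v lin y) = G v.
      apply: (ml_ext GM) => _ /lastE[s sf ->]; have [el _] := mem_cap_ends sh wf mE sf.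
      have {el} h1 : s.2 != lin by apply/eqP => /el[_]; rewrite eqxx.
      by rewrite /ren (negbTE h1) /= upd_other.
    (* Both ends lie on the arc being closed; cyclicity of [tau] brings their beads together around
       the maximum. *)
    transitivity (\sum_(u <- comul HA z) tau (h u * va lin) * G va).
      apply: eq_bigr => u _; rewrite /put_bead /s1 /s2 /= !if_same !upd_same !dead; congr (_ * _).
      by rewrite /h /c; case: (o); rewrite /= ?mul1r mulrA tauC !mulrA.
    by rewrite -mulr_suml -tau_sum -mulr_suml hE -scalerAl tauZ -mulrA mulrCA.
  have [o1 o2] := oth ll.
  have lin' : (false, lin) \in fr'.
    by rewrite /fr' E1; apply/mapP; exists (false, lin) => //; rewrite /ren /= (negbTE ll).
  have dead v y y' : G (upd (upd v lout y) lin y') = G (upd v lin y').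
    apply: (ml_ext GM) => _ /lastE[s sf ->]; rewrite /ren /=.
    by rewrite /upd; case: (eqVneq s.2 lout) => [|h1]; rewrite ?eqxx ?(negbTE h1).
  rewrite -(ml_updZ (s := (false, lin)) _ _ _ lin' GM) /=.
  rewrite scalerAr scalerAl -hE mulr_suml mulr_sumr (ml_upd_sum (s := (false, lin)) _ _ _ lin' GM) /=.
  have ll' : lout != lin by rewrite eq_sym.
  apply: eq_bigr => u _; rewrite /put_bead /s1 /s2 /h /c; case: (o); rewrite /=.
    rewrite (upd_other _ _ (m := lin)) // upd_same (upd_other _ _ ll') //.
    by rewrite upd_same dead upd_upd !mulrA.
  rewrite !upd_same (upd_other _ _ ll') upd_same upd_upd dead (upd_other _ _ ll).
  by rewrite mul1r !mulrA.
- have [s1 [s2 [midE mid'E mE]]] := pcE.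
  have s12 : s1 != s2.
    by move: un; rewrite midE uniq_catCA cat_uniq /= inE andbT => /andP[].
  have [i1 i2] : s1 \in fr' /\ s2 \in fr' by rewrite !sub' // mid'E !inE eqxx ?orbT.
  have [j1 j2] : s1 \in f1 ++ mid ++ f2 /\ s2 \in f1 ++ mid ++ f2 by rewrite !sub // midE !inE eqxx ?orbT.
  pose F a b := G (put b s2 (put a s1 va)).
  have Fb : bilin F := bilin_two _ i1 i2 GM.
  have Fb' : bilin (fun a b => F b a) by case: Fb.
  rewrite midE mid'E (act_two _ _ _ _ _ PM) //.
  transitivity (\sum_(u <- comul HA z) \sum_(t <- T (Cross i b))
     t.1 * (if b then F (head 1 t.2 * u.1) (head 1 (behead t.2) * u.2)
            else F (head 1 (behead t.2) * u.1) (head 1 t.2 * u.2))).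
    apply: eq_bigr => u _; apply: eq_bigr => t _; rewrite mE /= mul1r /F; congr (_ * _).
    case: (b); rewrite /=.
      by rewrite (putC _ _ _ s12) put_put put_put.
    by rewrite put_put (putC _ _ _ s12) put_put.
  transitivity (\sum_(u <- comul HA z) \sum_(t <- T (Cross i b))
     t.1 * (if b then F (u.2 * head 1 t.2) (u.1 * head 1 (behead t.2))
            else F (u.2 * head 1 (behead t.2)) (u.1 * head 1 t.2))).
    by case: (b); [exact: cover | exact: (cunder i _ Fb')].
  rewrite exchange_big; apply: eq_bigr => t _; rewrite mE.
  rewrite -[(vmove _ _ _).1]/1 -[(vmove _ _ _).2]/(puts _ _ _) mul1r.
  rewrite (act_two _ _ _ _ _ GM) 1?eq_sym // mulr_sumr; apply: eq_bigr => u _.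
  rewrite /F; case: (b); rewrite /=.
    by rewrite put_put (putC _ _ _ s12) put_put.
  by rewrite (putC _ _ _ s12) put_put (putC _ _ _ s12) put_put.
- have [mE sE E1] := pcE; have [_ _ E2 _] := mem_put f1 f2 sh mE.
  have fE : fr' = f1 ++ mid ++ f2 by rewrite /fr' E1 E2 !map_id.
  have um : uniq mid by move: un; rewrite !cat_uniq => /and3P[_ _ /and3P[]].
  have pE H v : multilin fr' H -> pull (T (Dotted i l)) m H v = act mid La H v.
    rewrite fE => HM; rewrite -(act_iter_comul _ _ sub HM) /pull T_dot sE mE.
    by apply: eq_bigr => t _; rewrite /= mul1r.
  rewrite E1 pE; last by apply: ml_act => //; rewrite fE.
  rewrite (act_ext _ _ _ _ (G' := act mid La G)) => [|v]; last by rewrite pE.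
  rewrite fE in GM; rewrite !(act_mul HA idfun _ _ _ sub um GM).
  by rewrite cdot.
Qed.

Hypothesis comm_k : commutes_with_beads g gV La k.
Hypothesis comm_x : commutes_with_beads g gV La x.

Section Step.
Variables (fr : seq strand) (n : nat) (pc : piece) (fr' : seq strand) (n' : nat).
Variable (m : move).
Hypothesis wf : wf_front fr n.
Hypothesis st : front_step fr n pc = Some (fr', n', m).

Lemma front_step_wf : wf_front fr' n'.
Proof.
have [f1 [mid [f2 [r [mid' [sh E E' _]]]]]] := front_stepP wf st.
by rewrite E'; apply: (wf_shape sh); rewrite -E.
Qed.

Lemma front_step_ml T' G : multilin fr' G -> multilin fr (pull T' m G).
Proof.
have [f1 [mid [f2 [r [mid' [sh E E' _]]]]]] := front_stepP wf st.
by rewrite E E' => GM; apply: pull_ml sh _ _ _ GM; rewrite -E.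
Qed.

(** Beside the piece every element passes freely. On the block of the piece itself the coproducts of
    [k] and [x] leave only [1], [k] or [x], for which the beads are known to commute. *)
Lemma pull_natural z G va : z = k \/ z = x -> multilin fr' G ->
  act fr z (pull (T pc) m G) va = pull (T pc) m (act fr' z G) va.
Proof.
have [f1 [mid [f2 [r [mid' [sh E E' pcE]]]]]] := front_stepP wf st.
have wf1 := wf; rewrite E in wf1.
have wf2 := wf_shape sh wf1.
have [un _ _] := wf1; have [un' _ _] := wf2.
have [u1 um u2] : [/\ uniq f1, uniq mid & uniq f2].
  by move: un; rewrite !cat_uniq => /and3P[-> _ /and3P[-> _ ->]].
have [u1' um' u2'] : [/\ uniq (map r f1), uniq mid' & uniq (map r f2)].
  by move: un'; rewrite !cat_uniq => /and3P[-> _ /and3P[-> _ ->]].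
have umf : uniq (mid ++ f2) by move: un; rewrite cat_uniq => /and3P[].
have umf' : uniq (mid' ++ map r f2) by move: un'; rewrite cat_uniq => /and3P[].
have s1 : {subset f1 <= f1 ++ f2} by move=> s h; rewrite mem_cat h.
have s2 : {subset f2 <= f1 ++ f2} by move=> s h; rewrite mem_cat h orbT.
have s12 : {subset f1 ++ f2 <= fr} by move=> s h; rewrite E mem_mid h orbT.
have smf : {subset mid ++ f2 <= fr} by move=> s h; rewrite E mem_cat h orbT.
have smf' : {subset mid' ++ map r f2 <= fr'} by move=> s h; rewrite E' mem_cat h orbT.
have sm' : {subset mid' <= fr'} by move=> s sm; rewrite E' mem_mid sm.
have s2' : {subset map r f2 <= fr'} by move=> s h; rewrite smf' // mem_cat h orbT.
have sub : {subset f1 ++ mid ++ f2 <= fr} by rewrite E.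
have sub' : {subset map r f1 ++ mid' ++ map r f2 <= fr'} by rewrite E'.
move=> zE GM; have GM' := GM; rewrite E' in GM'.
have P1 y H : multilin fr' H ->
    act f1 y (pull (T pc) m H) = pull (T pc) m (act (map r f1) y H).
  by rewrite E' => HM; apply/funext => v; rewrite (act_pull sh wf1).
have P2 y H : multilin fr' H ->
    act f2 y (pull (T pc) m H) = pull (T pc) m (act (map r f2) y H).
  by rewrite E' => HM; apply/funext => v; rewrite (act_pull sh wf1).
have Pm y H : y = k \/ y = x -> multilin fr' H ->
    act mid y (pull (T pc) m H) = pull (T pc) m (act mid' y H).
  rewrite E' => yE HM; apply/funext => v; apply: pull_mid sh E pcE HM => //.
  by case: yE => ->.
have PM := front_step_ml (T pc) GM.
have M2 y : multilin fr' (act (map r f2) y G) by apply: ml_act.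
have Mm y y' : multilin fr' (act mid' y (act (map r f2) y' G)) by apply: ml_act.
rewrite {1}E {1}E'; case: zE => ->.
  rewrite (act_cat_grouplike idfun comul_k _ sub) //.
  rewrite (_ : act (mid ++ f2) k _ = pull (T pc) m (act mid' k (act (map r f2) k G))).
    rewrite P1 //; congr (pull _ _ _ va); apply/funext => v.
    rewrite (act_cat_grouplike idfun comul_k _ sub') //; apply: act_ext => v'.
    by rewrite (act_cat_grouplike idfun comul_k _ smf').
  apply/funext => v; rewrite (act_cat_grouplike idfun comul_k _ smf) //.
  by rewrite P2 // Pm //; left.
rewrite (act_cat_skew idfun comul_x _ sub) // (act_cat_skew idfun comul_x _ smf) //.
rewrite (_ : act (mid ++ f2) k _ = pull (T pc) m (act mid' k (act (map r f2) k G))); last first.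
  apply/funext => v; rewrite (act_cat_grouplike idfun comul_k _ smf) //.
  by rewrite P2 // Pm //; left.
rewrite P1 // !P2 // Pm //; last by right.
rewrite /pull -!big_split /=; apply: eq_bigr => t _.
rewrite -!mulrDr; congr (_ * (_ * _)).
rewrite (act_cat_skew idfun comul_x _ sub') // (act_cat_skew idfun comul_x _ smf') //.
congr (_ + _); apply: act_ext => v.
by rewrite (act_cat_grouplike idfun comul_k _ smf').
Qed.

End Step.

Lemma evaluate_ml w fr n : wf_front fr n ->
  multilin fr (evaluate HA tau T w fr n).
Proof.
elim: w fr n => [|pc w IH] fr n wf /=.
  split=> // s va a y z; first by case: fr {wf} => //= s' fr _; rewrite mulr0 addr0.
case st: (front_step fr n pc) => [[[fr' n'] m]|].
  exact/(front_step_ml wf st)/IH/(front_step_wf wf st).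
by split=> // s va a y z _; rewrite mulr0 addr0.
Qed.

(** At the top of the diagram the row is empty and the action is the counit; naturality carries this
    down piece by piece. *)
Lemma evaluate_inv w fr n z va : z = k \/ z = x -> wf_front fr n ->
  act fr z (evaluate HA tau T w fr n) va =
  counit HA z * evaluate HA tau T w fr n va.
Proof.
have act_zero f y v : act f y (fun=> 0) v = 0.
  rewrite -[RHS](mul0r (act f y (fun=> 0) v)) -act_scale.
  by apply: act_ext => ?; rewrite mul0r.
move=> zE; elim: w fr n va => [|pc w IH] fr n va wf.
  by case: fr wf => [|s fr] wf //; rewrite [evaluate _ _ _ _ _ _]/= mulr0 act_zero.
rewrite /=; case st: (front_step fr n pc) => [[[fr' n'] m]|]; last first.
  by rewrite mulr0 act_zero.
have wf' := front_step_wf wf st.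
rewrite (pull_natural wf st) //; last exact: evaluate_ml.
rewrite /pull mulr_sumr; apply: eq_bigr => t _.
by rewrite IH // !mulrA; congr (_ * _); rewrite mulrC mulrA.
Qed.

End Natural.

Lemma actC f f' x y G va : (forall s, s \in f -> s \notin f') ->
  act HA idfun f x (act HA idfun f' y G) va =
  act HA idfun f' y (act HA idfun f x G) va.
Proof.
elim: f x va => [|s f IH] x va dis /=.
  by rewrite act_scale.
rewrite act_sum1; apply: eq_bigr => u _.
rewrite -act_put ?dis ?mem_head // IH // => z zf.
by rewrite dis // inE zf orbT.
Qed.

(** * Removing a summand of the cointegral *)

Section Invariant.
Variables k x : A.
Hypothesis comul_k : tensor_eq (comul HA k) [:: (k, k)].
Hypothesis comul_x : tensor_eq (comul HA x) [:: (x, k); (1, x)].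
Hypothesis counit_k : counit HA k = 1.
Hypothesis counit_x : counit HA x = 0.
Local Notation act := (act HA idfun).

(* What the part of a diagram below a front looks like to the part above. *)
Record invariant (fr : seq strand) (Th : ((nat -> A) -> R[i]) -> R[i]) : Prop :=
  Invariant {
    inv_lin : forall a G H,
      Th (fun v => a * G v + H v) = a * Th G + Th H;
    inv_act : forall z G, z = k \/ z = x -> multilin fr G ->
      Th (act fr z G) = counit HA z * Th G }.

Section Vanish.
Variables (f1 f2 f3 : seq strand) (Th : ((nat -> A) -> R[i]) -> R[i]).
Variable G : (nat -> A) -> R[i].
Let fr := f1 ++ f2 ++ f3.
Hypothesis uf : uniq fr.
Hypothesis Thi : invariant fr Th.
Hypothesis GM : multilin fr G.
Hypothesis Gx : forall va, act fr x G va = 0.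

(** The labels [u], [v], [w] are spread over the strands left of a circle, through it and right of
    it. *)
Let B u v w := Th (act f1 u (act f2 v (act f3 w G))).

Let s1 : {subset f1 <= fr}. Proof. by move=> s h; rewrite mem_cat h. Qed.
Let s2 : {subset f2 <= fr}. Proof. by move=> s h; rewrite !mem_cat h orbT. Qed.
Let s3 : {subset f3 <= fr}. Proof. by move=> s h; rewrite !mem_cat h !orbT. Qed.
Let s23 : {subset f2 ++ f3 <= fr}. Proof. by move=> s h; rewrite mem_cat h orbT. Qed.
Let u1 : uniq f1. Proof. by move: uf; rewrite /fr cat_uniq => /and3P[]. Qed.
Let u23 : uniq (f2 ++ f3). Proof. by move: uf; rewrite /fr cat_uniq => /and3P[]. Qed.
Let u2 : uniq f2. Proof. by move: u23; rewrite cat_uniq => /and3P[]. Qed.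
Let u3 : uniq f3. Proof. by move: u23; rewrite cat_uniq => /and3P[]. Qed.

Let d12 s : s \in f1 -> s \notin f2.
Proof.
move: uf; rewrite /fr cat_uniq => /and3P[_ /hasPn H _].
by apply: contraL => sf; apply: H; rewrite mem_cat sf.
Qed.
Let d13 s : s \in f1 -> s \notin f3.
Proof.
move: uf; rewrite /fr cat_uniq => /and3P[_ /hasPn H _].
by apply: contraL => sf; apply: H; rewrite mem_cat sf orbT.
Qed.
Let d23 s : s \in f2 -> s \notin f3.
Proof.
move: u23; rewrite cat_uniq => /and3P[_ /hasPn H _].
by apply: contraL => sf; apply: H.
Qed.

Let Mx f y H : {subset f <= fr} -> uniq f -> multilin fr H -> multilin fr (act f y H).
Proof. exact: ml_act. Qed.

Lemma inv_linl u v w u' a : B (a *: u + u') v w = a * B u v w + B u' v w.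
Proof.
rewrite /B -(inv_lin Thi); congr Th; apply/funext => va.
by apply: (act_linl HA idfun _ s1); rewrite //; do ?apply: Mx.
Qed.

Lemma inv_linm u v w v' a : B u (a *: v + v') w = a * B u v w + B u v' w.
Proof.
rewrite /B -(inv_lin Thi); congr Th; apply/funext => va.
rewrite -act_lin_fun; apply: act_ext => va'.
by apply: (act_linl HA idfun _ s2); rewrite //; do ?apply: Mx.
Qed.

Lemma actC12 a b H : act f1 a (act f2 b H) = act f2 b (act f1 a H).
Proof. by apply/funext => va; apply: actC. Qed.
Lemma actC13 a b H : act f1 a (act f3 b H) = act f3 b (act f1 a H).
Proof. by apply/funext => va; apply: actC. Qed.
Lemma actC23 a b H : act f2 a (act f3 b H) = act f3 b (act f2 a H).
Proof. by apply/funext => va; apply: actC. Qed.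

Lemma act3_skew H : multilin fr H ->
  act fr x H = fun va => 1 * act f1 x (act f2 k (act f3 k H)) va +
    (1 * act f2 x (act f3 k H) va + act f3 x H va).
Proof.
move=> HM; apply/funext => va; rewrite !mul1r.
rewrite (act_cat_skew idfun comul_x (fr := fr)) //.
rewrite (act_cat_skew idfun comul_x (fr := fr)) //; congr (_ + _).
apply: act_ext => v.
by rewrite (act_cat_grouplike idfun comul_k (fr := fr)).
Qed.

Lemma act3_grouplike H : multilin fr H ->
  act fr k H = act f1 k (act f2 k (act f3 k H)).
Proof.
move=> HM; apply/funext => va.
rewrite (act_cat_grouplike idfun comul_k (fr := fr)) //.
apply: act_ext => v.
by rewrite (act_cat_grouplike idfun comul_k (fr := fr)).
Qed.

Lemma act_mulE f y z H : {subset f <= fr} -> uniq f -> multilin fr H ->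
  act f y (act f z H) = act f (z * y) H.
Proof. by move=> sf uff HM; apply/funext => va; apply: (act_mul HA idfun _ _ _ sf uff HM). Qed.

(** With [a] and [b] inserted at some height, [x] gives zero both when absorbed by the part above
    and, its counit being 0, when absorbed by the part below. In the difference of the two
    expansions the terms with [x] on the right block cancel. *)
Lemma inv_commutator a b :
  B (x * a) (k * b) k - B (a * x) (b * k) k + B a (x * b - b * x) k = 0.
Proof.
have M3 y : multilin fr (act f3 y G) by exact: Mx.
have M2 y z : multilin fr (act f2 y (act f3 z G)) by exact: Mx.
have Mab : multilin fr (act f1 a (act f2 b G)) by do 2?apply: Mx.
have up : B (x * a) (k * b) k + (B a (x * b) k + B a b x) = 0.
  have -> : 0 = Th (act f1 a (act f2 b (act fr x G))).
    have -> : act fr x G = fun=> 0 by apply/funext.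
    have Th0 : Th (fun=> 0) = 0.
      rewrite -[RHS](addNr (Th (fun=> 0))) -mulN1r -(inv_lin Thi).
      by congr Th; apply/funext => v; rewrite mulr0 addr0.
    rewrite -Th0; congr Th; apply/funext => v.
    have Z f y w : act f y (fun=> 0) w = 0.
      rewrite -[RHS](mul0r (act f y (fun=> 0) w)) -act_scale.
      by apply: act_ext => ?; rewrite mul0r.
    rewrite -[LHS](Z f1 a v); apply: act_ext => w.
    by rewrite -[LHS](Z f2 b w); apply: act_ext.
  rewrite act3_skew //.
  rewrite (_ : act f2 b _ = fun va => 1 * act f2 b (act f1 x (act f2 k (act f3 k G))) va
     + (1 * act f2 b (act f2 x (act f3 k G)) va + act f2 b (act f3 x G) va)); last first.
    by apply/funext => v; rewrite !act_lin_fun.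
  rewrite (_ : act f1 a _ = fun va => 1 * act f1 a (act f2 b (act f1 x (act f2 k (act f3 k G)))) va
     + (1 * act f1 a (act f2 b (act f2 x (act f3 k G))) va + act f1 a (act f2 b (act f3 x G)) va)); last first.
    by apply/funext => v; rewrite !act_lin_fun.
  rewrite !(inv_lin Thi) !mul1r /B; congr (_ + (_ + _)).
    by rewrite -actC12 !act_mulE //; apply: Mx.
  by rewrite (act_mulE _ _ s2).
have down : B (a * x) (b * k) k + (B a (b * x) k + B a b x) = 0.
  have -> : 0 = Th (act fr x (act f1 a (act f2 b G))).
    by rewrite (inv_act Thi) ?counit_x ?mul0r //; right.
  rewrite act3_skew // !(inv_lin Thi) !mul1r /B; congr (Th _ + (Th _ + Th _)).
  - by rewrite -!actC13 -!actC23 -actC12 !act_mulE //; apply: Mx.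
  - by rewrite -!actC13 -!actC23 -actC12 !act_mulE.
  - by rewrite -!actC13 -!actC23.
have := inv_linm a (b * x) k (x * b) (-1); rewrite scaleN1r addrC => ->.
rewrite -[RHS](subrr 0) -{1}up -down.
move: (B (x * a) _ _) (B (a * x) _ _) (B a (b * x) _) (B a (x * b) _) (B a b x).
by move=> c1 c2 c3 c4 c5; ring.
Qed.

(* Descending induction on [n]: sliding [x] around shows that each member of
   the chain [z 0, z 1, ...] vanishes once the next one does, and the scalar
   in the relation for the last one is 0. *)
Lemma inv_vanish (N : nat) (qq : R[i]) (c mu : nat -> R[i]) (z : nat -> A) (y : A) :
  k * x = qq *: (x * k) ->
  (forall n, k * z n = c n *: (z n * k)) ->
  x * z 0%N - z 0%N * x = y -> y * k = y ->
  (forall n, (n < N)%N -> x * z n.+1 - z n.+1 * x = mu n *: (z n * k)) ->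
  (forall n, (n < N)%N -> mu n != 0) -> c N = qq ->
  Th (act f2 y G) = 0.
Proof.
move=> kx kz xz0 yk xz mu0 cN.
have B0m u w : B u 0 w = 0.
  by have := inv_linm u 0 w 0 (-1); rewrite scaler0 addr0 mulN1r addNr.
have B0l v w : B 0 v w = 0.
  by have := inv_linl 0 v w 0 (-1); rewrite scaler0 addr0 mulN1r addNr.
have BZm u v w a : B u (a *: v) w = a * B u v w.
  by have := inv_linm u v w 0 a; rewrite B0m !addr0.
have BZl u v w a : B (a *: u) v w = a * B u v w.
  by have := inv_linl u v w 0 a; rewrite B0l !addr0.
(* This is [inv_commutator] for [a = x ^+ n * k] and [b = z n]: the weights of [x] and [z n] make
   its first two terms multiples of the same value. *)
have step n : (c n - qq) * B (x ^+ n.+1 * k) (z n * k) k +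
     B (x ^+ n * k) (x * z n - z n * x) k = 0.
  have := inv_commutator (x ^+ n * k) (z n).
  rewrite kz -(mulrA _ k) kx -scalerAr !mulrA -exprS -exprSr BZm BZl => <-.
  by rewrite mulrBl.
have Q n : (n <= N)%N -> B (x ^+ (N - n) * k) (x * z (N - n)%N - z (N - n)%N * x) k = 0.
  elim: n => [|n IH] le.
    by have := step N; rewrite subn0 cN subrr mul0r add0r.
  have := IH (ltnW le); rewrite (_ : N - n = (N - n.+1).+1)%N; last first.
    by rewrite subnSK.
  have lt : (N - n.+1 < N)%N by rewrite ltn_subrL (leq_ltn_trans _ le).
  rewrite xz //.
  rewrite BZm => /eqP; rewrite mulf_eq0 (negbTE (mu0 _ lt)) /= => /eqP P.
  by have := step (N - n.+1)%N; rewrite P mulr0 add0r.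
have := Q N (leqnn _); rewrite subnn expr0 mul1r xz0 => <-.
(* As [y * k = y], the labels [k], [y], [k] amount to [k] on the whole row followed by [y] alone,
   and the part below absorbs [k]. *)
rewrite /B -{2}yk -(act_mulE _ _ s2 u2) //; last exact: Mx.
rewrite actC23 -act3_grouplike; last by do ?apply: Mx.
by rewrite (inv_act Thi) ?counit_k ?mul1r //; [left | apply: Mx].
Qed.

End Vanish.

Section Replace.
Variables (T T' : piece -> seq (R[i] * seq A)) (g gV La La' y : A).
Hypothesis T_cup : forall i o, T (Cup i o) = [:: (1, [:: gV])].
Hypothesis T_cap : forall i, T (Cap i) = [:: (1, [:: g])].
Hypothesis T_dot : forall i l, T (Dotted i l) = iter_comul HA l La.
Hypothesis T'_dot : forall i l, T' (Dotted i l) = iter_comul HA l La'.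
Hypothesis TT' : forall pc, is_dot pc = false -> T' pc = T pc.
Hypothesis comm_k : commutes_with_beads T g gV La k.
Hypothesis comm_x : commutes_with_beads T g gV La x.
Hypothesis comm'_k : k * La' = La' * k.
Hypothesis comm'_x : x * La' = La' * x.
Hypothesis LaE : La = La' + y.
Hypothesis van : forall f1 f2 f3 Th G, uniq (f1 ++ f2 ++ f3) ->
  invariant (f1 ++ f2 ++ f3) Th -> multilin (f1 ++ f2 ++ f3) G ->
  (forall va, act (f1 ++ f2 ++ f3) x G va = 0) -> Th (act f2 y G) = 0.

Let T'_cup i o : T' (Cup i o) = [:: (1, [:: gV])]. Proof. by rewrite TT'. Qed.
Let T'_cap i : T' (Cap i) = [:: (1, [:: g])]. Proof. by rewrite TT'. Qed.

Lemma comm_replace z : commutes_with_beads T g gV La z ->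
  z * La' = La' * z -> commutes_with_beads T' g gV La' z.
Proof. by case=> h1 h2 h3 h4 h5 h; split=> // i F Fb; rewrite TT' //; [apply: h4|apply: h5]. Qed.

Lemma inv_step fr n pc fr' n' m Th : wf_front fr n ->
  front_step fr n pc = Some (fr', n', m) -> invariant fr Th ->
  invariant fr' (fun G => Th (pull (T pc) m G)).
Proof.
move=> wf st Thi; split.
  move=> a G H; rewrite -(inv_lin Thi); congr Th; apply/funext => v.
  rewrite /pull mulr_sumr -big_split /=; apply: eq_bigr => t _.
  by rewrite mulrDr mulrDr; congr (_ + _); rewrite !mulrA; congr (_ * _);
     rewrite mulrC !mulrA.
move=> z G zE GM; rewrite -(inv_act Thi) //; last exact: (front_step_ml wf st).
congr Th; apply/funext => v; symmetry.
exact: (pull_natural comul_k comul_x T_cup T_cap T_dot comm_k comm_x wf st).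
Qed.

(** The induction changes the topmost circles first: when a circle is treated, everything below
    still carries [La] and everything above already carries [La']. Invariance from below thus rests
    on the commutation of [La] with [k] and [x], vanishing from above on that of [La']. *)
Lemma evaluate_replace w fr n Th : wf_front fr n -> invariant fr Th ->
  Th (evaluate HA tau T w fr n) = Th (evaluate HA tau T' w fr n).
Proof.
elim: w fr n Th => [|pc w IH] fr n Th wf Thi //=.
case st: (front_step fr n pc) => [[[fr' n'] m]|] //.
have wf' := front_step_wf wf st.
transitivity (Th (pull (T pc) m (evaluate HA tau T' w fr' n'))).
  exact: (IH _ _ _ wf' (inv_step wf st Thi)).
set G := evaluate _ _ _ _ _ _.
have GM : multilin fr' G by apply: evaluate_ml.
case dot: (is_dot pc); last by rewrite TT'.
have [f1 [mid [f2 [r [mid' [sh E E' pcE]]]]]] := front_stepP wf st.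
case: pc dot st pcE => // i l _ st [mE sE m'E].
have [_ _ rE _] := mem_put f1 f2 sh mE.
have {}E' : fr' = f1 ++ mid ++ f2 by rewrite E' rE m'E !map_id.
have ff : fr' = fr by rewrite E' E.
have [un _ _] := wf; rewrite E in un.
have um : uniq mid by move: un; rewrite !cat_uniq => /and3P[_ _ /and3P[]].
have sub : {subset mid <= fr'} by move=> s h; rewrite E' mem_mid h.
have pE L : pull (iter_comul HA l L) m G = act mid L G.
  apply/funext => v; rewrite -(act_iter_comul _ _ sub GM) /pull sE mE.
  by apply: eq_bigr => t _; rewrite /= mul1r.
rewrite T_dot T'_dot !pE LaE.
have -> : act mid (La' + y) G = fun v => 1 * act mid y G v + act mid La' G v.
  apply/funext => v; rewrite (actD HA idfun _ _ _ sub um GM) mul1r.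
  exact: addrC.
rewrite (inv_lin Thi) (van (f1 := f1) (f3 := f2)) ?mulr0 ?add0r //; rewrite -?E' ?ff //.
  by rewrite -ff.
move=> va; rewrite -ff.
have C z : commutes_with_beads T g gV La z -> z * La' = La' * z -> commutes_with_beads T' g gV La' z := @comm_replace z.
by rewrite (evaluate_inv comul_k comul_x T'_cup T'_cap T'_dot (C _ comm_k comm'_k) (C _ comm_x comm'_x)) ?counit_x ?mul0r //; right.
Qed.

End Replace.

End Invariant.

(** * Change of algebra *)

Section CompareAlgebras.
Variables (B : algType R[i]) (HB : hopf_structure B) (psi : {lrmorphism B -> A}).
Hypothesis psiS : forall b, psi (antipode HB b) * e = S (psi b) * e.

Lemma act_cons2 (C : algType R[i]) (HC : hopf_structure C)
    (phi : {lrmorphism C -> A}) fr x a b c d s f G va :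
  tensor_eq (comul HC x) [:: (a, b); (c, d)] ->
  {subset s :: f <= fr} -> uniq (s :: f) -> multilin fr G ->
  act HC phi (s :: f) x G va =
  act HC phi f b G (put (phi a) s va) + act HC phi f d G (put (phi c) s va).
Proof.
move=> co sub usf GM /=.
rewrite (tensor_eqP co (act_bilin_cons HC phi va sub usf GM)).
by rewrite big_cons big_seq1.
Qed.

Lemma act_grouplike_id fr c f G va : tensor_eq (comul HA c) [:: (c, c)] ->
  counit HA c = 1 -> c * e = e ->
  {subset f <= fr} -> uniq f -> multilin fr G -> act HA idfun f c G va = G va.
Proof.
move=> co c1 ce; elim: f va => [|s f IH] va sub; first by rewrite /= c1 mul1r.
move=> usf GM; have [_ uf] := andP usf.
rewrite (act_cons_grouplike idfun co _ sub) // IH //; last first.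
  by move=> z zf; rewrite sub // inE zf orbT.
rewrite (ml_put_mod GM _ (c := 1)) ?put_1 ?mul1r //.
by rewrite sub ?mem_head.
Qed.

Section ActE.
Variable c : A.
Hypothesis co : tensor_eq (comul HA c) [:: (c, c)].
Hypothesis c1 : counit HA c = 1.
Hypothesis ce : c * e = e.
Hypothesis eE : e = 2^-1 *: (1 + c).

(** [e] need not be group-like, but it is the average of 1 and the group-like [c], and [c] acts
    trivially on functionals that ignore [e] because [c * e = e]. *)
Lemma act_mod_e fr x x' f G va : x * e = x' * e ->
  {subset f <= fr} -> uniq f -> multilin fr G ->
  act HA idfun f x G va = act HA idfun f x' G va.
Proof.
move=> xx sub uf GM.
have ae y : act HA idfun f (y * e) G va = act HA idfun f y G va.
  have MG := ml_act HA idfun y sub uf GM.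
  rewrite -(act_mul HA idfun _ _ _ sub uf GM) eE (actZ HA idfun _ _ _ sub uf MG).
  rewrite (actD HA idfun _ _ _ sub uf MG) (act_one HA idfun _ sub uf MG).
  rewrite (act_grouplike_id _ co c1 ce sub uf MG).
  by rewrite mulrC mulrDl -splitr.
by rewrite -(ae x) xx ae.
Qed.

Section ActPsi.
Variables (E F K KV : A) (bE bF bK bKV : B).
Hypotheses (EE : psi bE * e = E * e) (FF : psi bF * e = F * e).
Hypotheses (KK : psi bK * e = K * e) (KKV : psi bKV * e = KV * e).
Hypothesis coE : tensor_eq (comul HA E) [:: (E, K); (1, E)].
Hypothesis coF : tensor_eq (comul HA F) [:: (F, 1); (KV, F)].
Hypothesis coK : tensor_eq (comul HA K) [:: (K, K)].
Hypothesis cobE : tensor_eq (comul HB bE) [:: (bE, bK); (1, bE)].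
Hypothesis cobF : tensor_eq (comul HB bF) [:: (bF, 1); (bKV, bF)].
Hypothesis cobK : tensor_eq (comul HB bK) [:: (bK, bK)].
Hypotheses (cE : counit HA E = 0) (cF : counit HA F = 0) (cK : counit HA K = 1).
Hypotheses (cbE : counit HB bE = 0) (cbF : counit HB bF = 0) (cbK : counit HB bK = 1).
Hypothesis gen : forall P : B -> Prop, P bE -> P bF -> P bK -> P 1 ->
  (forall a x y, P x -> P y -> P (a *: x + y)) ->
  (forall x y, P x -> P y -> P (x * y)) -> forall x, P x.

(** Compatibility of [psi] with the coproducts is available only modulo [e], and only on generators.
    The action being multiplicative, this is enough for all elements. *)
Lemma act_psi fr f x G va : {subset f <= fr} -> uniq f -> multilin fr G ->
  act HB psi f x G va = act HA idfun f (psi x) G va.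
Proof.
move=> sub uf GM0; move: x va G GM0.
have tails s f' : {subset s :: f' <= fr} -> uniq (s :: f') ->
    [/\ s \in fr, {subset f' <= fr} & uniq f'].
  by move=> h /andP[_ ?]; split=> // [|z zf]; rewrite h // inE ?eqxx // zf orbT.
have hK f' : {subset f' <= fr} -> uniq f' -> forall G va, multilin fr G ->
    act HB psi f' bK G va = act HA idfun f' K G va.
  elim: f' => [|s f' IH] sb us G va GM; first by rewrite /= cK cbK.
  have [sfr sb' us'] := tails _ _ sb us.
  rewrite (act_cons_grouplike psi cobK _ sb) // (act_cons_grouplike idfun coK _ sb) //.
  rewrite IH //; apply: (ml_put_mod (ml_act HA idfun K sb' us' GM)) => //.
have hE f' : {subset f' <= fr} -> uniq f' -> forall G va, multilin fr G ->
    act HB psi f' bE G va = act HA idfun f' E G va.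
  elim: f' => [|s f' IH] sb us G va GM; first by rewrite /= cE cbE.
  have [sfr sb' us'] := tails _ _ sb us.
  rewrite (act_cons2 psi _ cobE sb) // (act_cons2 idfun _ coE sb) //.
  rewrite IH // hK // rmorph1; congr (_ + _).
  exact: (ml_put_mod (ml_act HA idfun K sb' us' GM)).
have hF f' : {subset f' <= fr} -> uniq f' -> forall G va, multilin fr G ->
    act HB psi f' bF G va = act HA idfun f' F G va.
  elim: f' => [|s f' IH] sb us G va GM; first by rewrite /= cF cbF.
  have [sfr sb' us'] := tails _ _ sb us.
  rewrite (act_cons2 psi _ cobF sb) // (act_cons2 idfun _ coF sb) //.
  rewrite IH // (act_one HB psi _ sb' us' GM) (act_one HA idfun _ sb' us' GM).
  congr (_ + _); first exact: (ml_put_mod GM).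
  exact: (ml_put_mod (ml_act HA idfun F sb' us' GM)).
apply: gen => [va G GM|va G GM|va G GM|va G GM|a x y Px Py va G GM|x y Px Py va G GM].
- by rewrite hE //; apply: (act_mod_e _ _ sub).
- by rewrite hF //; apply: (act_mod_e _ _ sub).
- by rewrite hK //; apply: (act_mod_e _ _ sub).
- by rewrite rmorph1 (act_one HB psi _ sub uf GM) (act_one HA idfun _ sub uf GM).
- rewrite linearP (act_linl HB psi _ sub uf GM) (act_linl HA idfun _ sub uf GM).
  by rewrite Px // Py.
rewrite rmorphM -(act_mul HB psi _ _ _ sub uf GM) -(act_mul HA idfun _ _ _ sub uf GM).
rewrite Py; last exact: (ml_act HB psi).
by apply: act_ext => v; rewrite Px.
Qed.

End ActPsi.
End ActE.

Variables (tauB : B -> R[i]) (T : piece -> seq (R[i] * seq A)).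
Variables (TB : piece -> seq (R[i] * seq B)).
Hypothesis tauBE : forall x, tauB x = tau (psi x).

Lemma put_psi fr b s (va : nat -> B) G : multilin fr G ->
  G (fun m => psi (put_bead HB b s va m)) = G (put (psi b) s (fun m => psi (va m))).
Proof.
move=> GM; apply: (ml_mod GM) => s' s'fr; rewrite /put_bead /upd.
case: eqP => // _; case: s.1; first by rewrite rmorphM.
by rewrite rmorphM -mulrA psiS mulrA.
Qed.

Lemma puts_psi fr bs ss (va : nat -> B) G : {subset ss <= fr} -> multilin fr G ->
  G (fun m => psi (put_beads HB bs ss va m)) =
  G (puts (map psi bs) ss (fun m => psi (va m))).
Proof.
move=> + GM; elim: ss bs va => [|s ss IH] bs va sub //=.
have sub' : {subset ss <= fr} by move=> z zf; rewrite sub // inE zf orbT.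
rewrite IH // behead_map (put_psi _ _ _ (ml_puts (map psi (behead bs)) sub' GM)).
by congr (G (puts _ _ (put _ _ _))); case: bs => //=; rewrite rmorph1.
Qed.

Lemma vmove_psi fr fr' n m mid r mid' n' f1 f2 bs va G :
  shape n mid r mid' n' m -> wf_front fr n ->
  fr = f1 ++ mid ++ f2 -> fr' = map r f1 ++ mid' ++ map r f2 ->
  multilin fr' G ->
  (move_values HB tauB m bs va).1 *
    G (fun l => psi ((move_values HB tauB m bs va).2 l)) =
  (vmove m (map psi bs) (fun l => psi (va l))).1 *
    G (vmove m (map psi bs) (fun l => psi (va l))).2.
Proof.
move=> sh wf E E' GM.
have hd : psi (head 1 bs) = head 1 (map psi bs) by case: bs => //=; rewrite rmorph1.
case Em: m => [o l|o lin lout|ss] /=.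
- congr (1 * G _); apply/funext => j; rewrite /upd; case: eqP => // _.
  by case: o {Em}; rewrite /= ?rmorph1 ?hd.
- case: eqP => _ /=.
    rewrite tauBE rmorphM; congr (tau (_ * _) * _).
    by case: o {Em}; rewrite /= ?rmorph1 ?hd.
  congr (1 * G _); apply/funext => j; rewrite /upd; case: eqP => // _.
  by rewrite !rmorphM; case: o {Em}; rewrite /= ?rmorph1 ?hd.
- have [E1 E2 _ _] := mem_put f1 f2 sh Em; congr (1 * _).
  by apply: puts_psi GM => s /E2; rewrite E1 E'.
Qed.

Variables (g gV La : A) (bg bgV bLa : B).
Hypothesis T_cup : forall i o, T (Cup i o) = [:: (1, [:: gV])].
Hypothesis T_cap : forall i, T (Cap i) = [:: (1, [:: g])].
Hypothesis T_dot : forall i l, T (Dotted i l) = iter_comul HA l La.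
Hypothesis TB_cup : forall i o, TB (Cup i o) = [:: (1, [:: bgV])].
Hypothesis TB_cap : forall i, TB (Cap i) = [:: (1, [:: bg])].
Hypothesis TB_dot : forall i l, TB (Dotted i l) = iter_comul HB l bLa.
Hypothesis gVE : psi bgV * e = gV * e.
Hypothesis gE : psi bg * e = g * e.
Hypothesis crossE : forall i s F, bilin F ->
  (forall a b, F (a * e) b = F a b) -> (forall a b, F a (b * e) = F a b) ->
  \sum_(t <- T (Cross i s)) t.1 * F (head 1 t.2) (head 1 (behead t.2)) =
  \sum_(t <- TB (Cross i s)) t.1 * F (psi (head 1 t.2)) (psi (head 1 (behead t.2))).
Hypothesis dotE : forall fr f G va, {subset f <= fr} -> uniq f -> multilin fr G ->
  act HB psi f bLa G va = act HA idfun f La G va.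

Lemma pull_psi fr n pc fr' n' m va G : wf_front fr n ->
  front_step fr n pc = Some (fr', n', m) -> multilin fr' G ->
  \sum_(t <- TB pc) t.1 * ((vmove m (map psi t.2) va).1 *
                             G (vmove m (map psi t.2) va).2) =
  pull (T pc) m G va.
Proof.
move=> wf st GM; have [f1 [mid [f2 [r [mid' [sh E E' pcE]]]]]] := front_stepP wf st.
have wf' := front_step_wf wf st; have wf1 := wf; rewrite E in wf1.
case: pc st pcE => [i o|i|i b|i l] st pcE.
- rewrite TB_cup /pull T_cup !big_seq1 pcE /=; congr (_ * (_ * _)).
  have mid'E : mid' = [:: (~~ o, n); (o, n)].
    by move: sh; rewrite pcE => sh'; inversion sh'.
  apply: (ml_mod GM) => s _; rewrite /upd; case: eqP => // _.
  by case: o {st pcE mid'E} => //=; rewrite gVE.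
- case: pcE => o [lin [lout mE]]; rewrite TB_cap /pull T_cap !big_seq1 mE /=.
  case: eqP => _ /=; congr (_ * (_ * _)).
    rewrite -tau_e -[in RHS]tau_e -!mulrA -!eC !mulrA; case: o {mE}; rewrite //=.
    by rewrite gE.
  apply: (ml_mod GM) => s _; rewrite /upd; case: eqP => // _.
  case: o {mE} => //=; rewrite -!mulrA -!eC; congr (_ * _); rewrite !mulrA.
  by rewrite gE.
- have [s1 [s2 [midE mid'E mE]]] := pcE.
  have [i1 i2] : s1 \in fr' /\ s2 \in fr' by rewrite E' mid'E !mem_mid !inE !eqxx ?orbT.
  pose F a c := G (puts [:: a; c] (if b then [:: s1; s2] else [:: s2; s1]) va).
  have s12 : s1 != s2.
    have [un _ _] := wf1; move: un.
    by rewrite midE uniq_catCA cat_uniq /= inE andbT => /andP[].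
  pose H a c := G (put c s2 (put a s1 va)).
  have Hb : bilin H := bilin_two _ i1 i2 GM.
  have He a c : H (a * e) c = H a c /\ H a (c * e) = H a c.
    split; last exact: (ml_put_e GM).
    exact: (ml_put_e (ml_put c GM i2)).
  have FE a c : F a c = if b then H a c else H c a.
    by rewrite /F; case: (b) => //=; rewrite putC.
  have Fb : bilin F.
    by case: Hb => h1 h2; split=> z a c w; rewrite !FE; case: (b); rewrite ?h1 ?h2.
  have Fe a c : F (a * e) c = F a c /\ F a (c * e) = F a c.
    by rewrite !FE; case: (b); rewrite ?(He _ _).1 ?(He _ _).2.
  transitivity (\sum_(t <- TB (Cross i b)) t.1 * F (psi (head 1 t.2)) (psi (head 1 (behead t.2)))).
    apply: eq_bigr => t _; rewrite mE /= mul1r /F; congr (_ * _).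
    by case: t.2 => [|t1 [|t2 ts]] /=; rewrite ?rmorph1; case: (b).
  rewrite -crossE //; [|by move=> a c; case: (Fe a c)..].
  apply: eq_bigr => t _; rewrite mE /= mul1r /F; congr (_ * _).
  by case: (b).
- have [mE sE E1] := pcE; have [_ _ E2 _] := mem_put f1 f2 sh mE.
  have [un _ _] := wf1.
  have um : uniq mid by move: un; rewrite !cat_uniq => /and3P[_ _ /and3P[]].
  have sub : {subset mid <= fr'} by move=> s h; rewrite E' E1 mem_mid h.
  rewrite /pull TB_dot T_dot -sE mE.
  transitivity (act HB psi mid bLa G va).
    rewrite -(act_iter_comul_map HB psi _ _ sub GM).
    by apply: eq_bigr => t _; rewrite /= mul1r.
  rewrite (dotE _ sub um GM) -(act_iter_comul _ _ sub GM).
  by apply: eq_bigr => t _; rewrite /= mul1r.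
Qed.

Lemma evaluate_psi w fr n va : wf_front fr n ->
  evaluate HB tauB TB w fr n va = evaluate HA tau T w fr n (fun l => psi (va l)).
Proof.
elim: w fr n va => [|pc w IH] fr n va wf //=.
case st: (front_step fr n pc) => [[[fr' n'] m]|] //.
have wf' := front_step_wf wf st.
have [f1 [mid [f2 [r [mid' [sh E E' _]]]]]] := front_stepP wf st.
have GM : multilin fr' (evaluate HA tau T w fr' n') by apply: evaluate_ml.
rewrite -(pull_psi _ wf st) //; apply: eq_bigr => t _; congr (_ * _).
by rewrite IH // (vmove_psi _ _ sh wf E E' GM).
Qed.

End CompareAlgebras.
End Trace.
End Beads.

(** * The bead invariant as an evaluation *)

Section BeadInvariant.
Variables (R : realType) (A : algType R[i]) (X : bead_data A).
Local Notation HA := (bd_hopf X).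
Variable tau : A -> R[i].
Hypothesis tauC : forall x y, tau (x * y) = tau (y * x).

Definition path_product (sg : seq (seq A)) (s : seq place) : A :=
  foldl (fun y x => bead_at X sg x * y) 1 s.

Definition arc_value (sg : seq (seq A)) (ar : seq (seq place)) (l : nat) : A :=
  path_product sg (nth [::] ar l).

(** Places refer only to pieces already read, so choosing tensors for later pieces does not alter
    the values. *)
Definition placed_before (e : nat) (ar : seq (seq place)) : bool :=
  all (all (fun x => pl_piece x < e)%N) ar.

Lemma path_product_cat sg s1 s2 :
  path_product sg (s1 ++ s2) = path_product sg s2 * path_product sg s1.
Proof.
rewrite /path_product foldl_cat; move: (foldl _ 1 s1) => y.
elim/last_ind: s2 => [|s x IH]; first by rewrite /= mul1r.
by rewrite !foldl_rcons IH mulrA.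
Qed.

(** The base point disappears because [tau] is a trace. *)
Lemma path_product_rot sg b s :
  tau (path_product sg (rot b s)) = tau (path_product sg s).
Proof. by rewrite /rot path_product_cat tauC -path_product_cat cat_take_drop. Qed.

Lemma path_product1 sg x : path_product sg [:: x] = bead_at X sg x.
Proof. by rewrite /path_product /= mulr1. Qed.

Lemma path_product_later e sg bs s : size sg = e ->
  all (fun x => pl_piece x < e)%N s ->
  path_product (rcons sg bs) s = path_product sg s.
Proof.
move=> sz; rewrite /path_product; elim: s (1 : A) => [|x s IH] y //= /andP[lt al].
by rewrite IH // /bead_at nth_rcons sz lt.
Qed.

Lemma arc_value_later e sg bs ar : size sg = e -> placed_before e ar ->
  arc_value (rcons sg bs) ar = arc_value sg ar.
Proof.
move=> sz al; apply/funext => l; rewrite /arc_value.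
case: (ltnP l (size ar)) => h; last by rewrite nth_default.
by rewrite (path_product_later _ sz) //; exact: (all_nthP [::] al).
Qed.

Lemma arc_value_set sg ar l s :
  arc_value sg (set_nth [::] ar l s) = upd (arc_value sg ar) l (path_product sg s).
Proof.
apply/funext => j; rewrite /arc_value nth_set_nth /= /upd.
by case: ifP.
Qed.

Lemma arc_value_put sg e m ar xs :
  arc_value sg (put_places e m ar xs) =
  put_beads HA (drop m (nth [::] sg e)) xs (arc_value sg ar).
Proof.
elim: xs m ar => [|[u l] xs IH] m ar //=.
rewrite IH /=; set bs := nth [::] sg e.
have -> : behead (drop m bs) = drop m.+1 bs by rewrite -drop1 drop_drop add1n.
congr (put_beads _ _ _ _); rewrite arc_value_set /put_bead /=; congr (upd _ _ _).
have hd : head 1 (drop m bs) = nth 1 bs m by rewrite -nth0 nth_drop addn0.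
case: u; first by rewrite -cats1 path_product_cat path_product1 /bead_at /= hd.
by rewrite -cat1s path_product_cat path_product1 /bead_at /= hd.
Qed.

Lemma size_put_places e m ar xs : (forall x, x \in xs -> (x.2 < size ar)%N) ->
  size (put_places e m ar xs) = size ar.
Proof.
elim: xs m ar => [|[u l] xs IH] m ar lt //=.
have sz : forall s, size (set_nth [::] ar l s) = size ar.
  by move=> s; rewrite size_set_nth; apply/maxn_idPr; apply: (lt (u, l)); rewrite mem_head.
by rewrite IH ?sz // => x xs'; rewrite ?sz; apply: lt; rewrite inE xs' orbT.
Qed.

Lemma placed_set e ar l s : placed_before e ar ->
  all (fun x => pl_piece x < e)%N s -> placed_before e (set_nth [::] ar l s).
Proof.
move=> al als; apply/(all_nthP [::]) => i _; rewrite nth_set_nth /=.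
case: eqP => // _; case: (ltnP i (size ar)) => h; last by rewrite nth_default.
exact: (all_nthP [::] al).
Qed.

Lemma placed_nth e ar l : placed_before e ar ->
  all (fun x => pl_piece x < e)%N (nth [::] ar l).
Proof.
move=> al; case: (ltnP l (size ar)) => h; last by rewrite nth_default.
exact: (all_nthP [::] al).
Qed.

Lemma placed_put e m ar xs : placed_before e.+1 ar ->
  placed_before e.+1 (put_places e m ar xs).
Proof.
elim: xs m ar => [|[u l] xs IH] m ar al //=; apply: IH; apply: placed_set => //.
by case: u; rewrite ?all_rcons /= ltnSn /=; apply: placed_nth.
Qed.

Lemma placed_leq e ar : placed_before e ar -> placed_before e.+1 ar.
Proof. by apply: sub_all => s; apply: sub_all => x /ltnW; rewrite ltnS. Qed.

(** [sg] holds the tensors chosen for the [e] pieces already read and [bs] the one for the current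
    piece; extending the lists of places has the effect of [move_values] on the products along
    them. *)
Lemma scan_pieceP e fr ar cl pc st : wf_front fr (size ar) ->
  placed_before e ar -> placed_before e cl ->
  scan_piece e (Scan fr ar cl) pc = Some st ->
  exists m, [/\ front_step fr (size ar) pc = Some (front st, size (arcs st), m),
    placed_before e.+1 (arcs st), placed_before e.+1 (loops st)
    & forall sg bs, size sg = e ->
      let mv := move_values HA tau m bs (arc_value sg ar) in
      arc_value (rcons sg bs) (arcs st) = mv.2 /\
      \prod_(s <- loops st) tau (path_product (rcons sg bs) s) =
      \prod_(s <- cl) tau (path_product sg s) * mv.1].
Proof.
move=> wf par pcl.
have par' := placed_leq par; have pcl' := placed_leq pcl.
have same sg bs : size sg = e ->
    \prod_(s <- cl) tau (path_product (rcons sg bs) s) =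
    \prod_(s <- cl) tau (path_product sg s).
  move=> sz; elim: cl pcl {pcl'} => [|s cl IH]; rewrite ?big_nil //= => /andP[ps pcl].
  by rewrite !big_cons (path_product_later _ sz) // IH.
have bead0 sg bs : size sg = e ->
    path_product (rcons sg bs) [:: Place e 0 true] = head 1 bs.
  by move=> sz; rewrite path_product1 /bead_at /= nth_rcons sz ltnn eqxx nth0.
have [_ _ lt] := wf.
have strandlt i : (i < size fr)%N -> ((nth (true, 0%N) fr i).2 < size ar)%N.
  by move=> h; apply: lt; rewrite mem_nth.
case: pc => [i o|i|i b|i k].
- rewrite /=; case: ifP => // le [<-] /=.
  exists (MCup o (size ar)); rewrite size_rcons; split=> //.
    rewrite /placed_before all_rcons -/(placed_before _ _) par' andbT.
    by case: (o); rewrite //= ltnSn.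
  move=> sg bs sz /=; rewrite mulr1 same //; split=> //.
  apply/funext => l; rewrite /upd /arc_value nth_rcons.
  case: (ltngtP l (size ar)) => h.
  + by rewrite -/(arc_value _ _ _) (arc_value_later _ sz).
  + by rewrite nth_default // ltnW.
  + by case: o; rewrite ?bead0.
- rewrite /=; case E1: (nth _ fr i) => [o1 l1]; case E2: (nth _ fr i.+1) => [o2 l2].
  case: ifP => // /andP[isz oo].
  case D: (if o1 then _ else _) => [lin lout].
  have lt1 : (l1 < size ar)%N by have := strandlt i (ltnW isz); rewrite E1.
  have lt2 : (l2 < size ar)%N by have := strandlt i.+1 isz; rewrite E2.
  have [lin_lt lout_lt] : (lin < size ar)%N /\ (lout < size ar)%N.
    by move: D; case: (o1) => -[<- <-].
  set s := nth [::] ar lin ++ _.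
  have ps : all (fun x => pl_piece x < e.+1)%N s.
    by rewrite all_cat placed_nth //; case: (o1); rewrite //= ltnSn.
  have sE sg bs : size sg = e -> path_product (rcons sg bs) s =
      (if o1 then head 1 bs else 1) * arc_value sg ar lin.
    move=> sz; rewrite path_product_cat -/(arc_value _ _ _) (arc_value_later _ sz) //.
    by case: (o1); rewrite ?bead0.
  case: eqP => ll.
    move=> [<-] /=; exists (MCap o1 lin lout); split=> //.
    (* [scan_piece] does not rename when a component closes; with [lin = lout] the renaming of
       [front_step] is the identity. *)
    + rewrite ll; congr (Some (_, _, _)); rewrite -[RHS]map_id.
      by apply: eq_map => -[u l]; rewrite /ren /=; case: eqP => [->|].
    + by rewrite /placed_before all_rcons ps.
    + move=> sg bs sz; rewrite /= ll eqxx -ll /=.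
      by rewrite (arc_value_later _ sz) // big_rcons /= same // sE.
  move=> [<-] /=; exists (MCap o1 lin lout); split=> //.
  + by rewrite size_set_nth; congr (Some (_, _, _)); apply/esym/maxn_idPr.
  + by apply: placed_set => //; rewrite all_cat ps placed_nth.
  + move=> sg bs sz; rewrite /=; move/eqP/negbTE: ll => -> /=; rewrite mulr1 same //.
    rewrite arc_value_set path_product_cat sE // -/(arc_value _ _ _).
    by rewrite (arc_value_later _ sz).
- rewrite /=; case: ifP => // isz [<-] /=; set xs := if b then _ else _.
  exists (MPut xs); have xlt x : x \in xs -> (x.2 < size ar)%N.
    by rewrite /xs; case: (b); rewrite !inE => /orP[] /eqP->; apply: strandlt => //; apply: ltnW.
  split; rewrite ?size_put_places //; first exact: placed_put.
  move=> sg bs sz /=; rewrite mulr1 same // arc_value_put nth_rcons sz ltnn eqxx drop0.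
  by rewrite (arc_value_later _ sz).
- rewrite /=; case: ifP => // isz [<-] /=; set xs := take k _.
  exists (MPut xs); have xlt x : x \in xs -> (x.2 < size ar)%N.
    by move=> /mem_take /mem_drop; apply: lt.
  split; rewrite ?size_put_places //; first exact: placed_put.
  move=> sg bs sz /=; rewrite mulr1 same // arc_value_put nth_rcons sz ltnn eqxx drop0.
  by rewrite (arc_value_later _ sz).
Qed.

(** Distributivity: the states of the remaining pieces are summed one piece at a time, with the
    traces of the components already closed factored out. *)
Lemma scan_evaluate w e st st' sg : size sg = e ->
  wf_front (front st) (size (arcs st)) ->
  placed_before e (arcs st) -> placed_before e (loops st) ->
  scan_from e st w = Some st' -> nilp (front st') ->
  \sum_(t <- bead_states X w)
     t.1 * \prod_(s <- loops st') tau (path_product (sg ++ t.2) s) =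
  \prod_(s <- loops st) tau (path_product sg s) *
  evaluate HA tau (piece_beads X) w (front st) (size (arcs st))
    (arc_value sg (arcs st)).
Proof.
elim: w e st sg => [|pc w IH] e st sg sz wf par pcl /=.
  by move=> [<-] ->; rewrite big_seq1 /= cats0 mul1r mulr1.
case: st wf par pcl => fr ar cl wf par pcl.
case sp: (scan_piece _ _ _) => [st1|] //= sf nil'.
have [m [st1E par1 pcl1 mvE]] := scan_pieceP wf par pcl sp.
rewrite /= in st1E *; rewrite st1E /pull mulr_sumr big_allpairs_dep /=.
have wf1 : wf_front (front st1) (size (arcs st1)) := front_step_wf wf st1E.
apply: eq_bigr => t _.
transitivity (t.1 * \sum_(u <- bead_states X w)
   u.1 * \prod_(s <- loops st') tau (path_product (rcons sg t.2 ++ u.2) s)).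
  by rewrite mulr_sumr; apply: eq_bigr => u _; rewrite mulrA cat_rcons.
rewrite (IH e.+1 st1) ?size_rcons ?sz //.
have [-> ->] := mvE sg t.2 sz.
by rewrite !mulrA; congr (_ * _ * _); rewrite mulrC.
Qed.

Lemma bead_invariant_evaluate (D : kirby) base :
  @bead_invariant R A X D base (fun _ => tau) =
  evaluate HA tau (piece_beads X) D [::] 0 (fun=> 1).
Proof.
rewrite /bead_invariant /components; move: base; rewrite /components.
have := pieces_closed D; rewrite /scan_word.
case sc: (scan_from _ _ _) => [st|] // nil' base.
have wf : wf_front [::] 0 by split.
have := @scan_evaluate D 0 (Scan [::] [::] [::]) st [::] erefl wf isT isT sc nil'.
rewrite big_nil mul1r /= (_ : arc_value _ _ = fun=> 1) => [<-|]; last first.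
  by apply/funext => l; rewrite /arc_value nth_nil.
apply: eq_bigr => t _; congr (_ * _).
rewrite [RHS](big_nth [::]) big_mkord; apply: eq_bigr => j _.
exact: path_product_rot.
Qed.

End BeadInvariant.

(** * Algebras given by generators and relations *)

Section Generated.
Variables (R : realType) (A : algType R[i]) (x y z : A).

Definition subalg_closed_prop (P : A -> Prop) : Prop :=
  [/\ P 1, forall a u v, P u -> P v -> P (a *: u + v)
    & forall u v, P u -> P v -> P (u * v)].

(** The subalgebra generated by the three elements, as an intersection, so that membership is itself
    an induction principle. *)
Definition generated : {pred A} := fun w =>
  `[< forall P : A -> Prop, subalg_closed_prop P -> P x -> P y -> P z -> P w >].

Lemma generated_closed : GRing.subalg_closed generated.
Proof.
split.
- by apply/asboolP => P [].
- move=> a u v /asboolP hu /asboolP hv; apply/asboolP => P cl Px Py Pz.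
  by have [_ lin _] := cl; apply: lin; [apply: hu | apply: hv].
- move=> u v /asboolP hu /asboolP hv; apply/asboolP => P cl Px Py Pz.
  by have [_ _ mul] := cl; apply: mul; [apply: hu | apply: hv].
Qed.

HB.instance Definition _ :=
  GRing.isSubalgClosed.Build R[i] A generated generated_closed.

Record generated_alg := GeneratedAlg {
  gen_val : A; gen_valP : gen_val \in generated }.

HB.instance Definition _ := [isSub for gen_val].
HB.instance Definition _ := [Choice of generated_alg by <:].
HB.instance Definition _ := [SubChoice_isSubAlgebra of generated_alg by <:].

Definition generated_incl : generated_alg -> A := val.

HB.instance Definition _ := GRing.Linear.copy generated_incl
  (val : generated_alg -> A).
HB.instance Definition _ := GRing.RMorphism.copy generated_incl
  (val : generated_alg -> A).

Lemma generated_x : x \in generated. Proof. exact/asboolP. Qed.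
Lemma generated_y : y \in generated. Proof. exact/asboolP. Qed.
Lemma generated_z : z \in generated. Proof. exact/asboolP. Qed.

End Generated.

(* The inclusion of the generated subalgebra has a section by the universal
   property, so it is onto. *)
Lemma presented_ind (R : realType)
    (rels : forall B : algType R[i], B -> B -> B -> Prop) (A : algType R[i])
    (x y z : A) (P : A -> Prop) :
  (forall (B C : algType R[i]) (f : {lrmorphism B -> C}) (a b c : B),
     injective f -> rels C (f a) (f b) (f c) -> rels B a b c) ->
  presented rels x y z ->
  P x -> P y -> P z -> P 1 ->
  (forall a u v, P u -> P v -> P (a *: u + v)) ->
  (forall u v, P u -> P v -> P (u * v)) -> forall w, P w.
Proof.
move=> refl [r ex uniq_morph] Px Py Pz P1 Pl Pm w.
pose G : algType R[i] := generated_alg x y z.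
pose gx : G := GeneratedAlg (generated_x x y z).
pose gy : G := GeneratedAlg (generated_y x y z).
pose gz : G := GeneratedAlg (generated_z x y z).
pose i : {lrmorphism G -> A} := @generated_incl R A x y z.
have rG : rels G gx gy gz by apply: (refl G A i) => //; exact: val_inj.
have [f [fx fy fz]] := ex _ _ _ _ rG.
have E : (i \o f : A -> A) =1 idfun.
  by apply: (uniq_morph A (i \o f) idfun); rewrite /= ?fx ?fy ?fz.
rewrite -[w]/(idfun w) -E /=; have /asboolP := gen_valP (f w); apply => //.
Qed.

(** * Computations in quantum sl2 *)

Section QuantumSl2.
Variables (C : fieldType) (A : algType C) (q : C).
Hypothesis q0 : q != 0.
Hypothesis d0 : q - q^-1 != 0.
Local Notation d := (q - q^-1).
Local Notation br n := (q ^+ n - q ^- n).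
Variables (E F K KV : A).
Hypotheses (KKV : K * KV = 1) (KVK : KV * K = 1).
Hypothesis KE : K * E = q ^+ 2 *: (E * K).
Hypothesis KF : K * F = q ^- 2 *: (F * K).
Hypothesis EF : E * F - F * E = d^-1 *: (K - KV).

Let qq1 : q * q - 1 != 0.
Proof. by rewrite -[1](mulfV q0) -mulrBr mulf_neq0. Qed.

Let EFE : E * F = F * E + d^-1 *: (K - KV).
Proof. by rewrite -EF addrC subrK. Qed.

Lemma sl2_KVE : KV * E = q ^- 2 *: (E * KV).
Proof.
have H : KV * (K * E) * KV = E * KV by rewrite mulrA KVK mul1r.
rewrite -H KE -scalerAr -scalerAl -!mulrA KKV mulr1 scalerA.
by rewrite mulVf ?expf_neq0 // scale1r.
Qed.

Lemma sl2_KVF : KV * F = q ^+ 2 *: (F * KV).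
Proof.
have H : KV * (K * F) * KV = F * KV by rewrite mulrA KVK mul1r.
rewrite -H KF -scalerAr -scalerAl -!mulrA KKV mulr1 scalerA.
by rewrite mulfV ?expf_neq0 // scale1r.
Qed.

Lemma scal_commX (x y : A) (a : C) n : x * y = a *: (y * x) ->
  x * y ^+ n = a ^+ n *: (y ^+ n * x).
Proof.
move=> xy; elim: n => [|n IH]; first by rewrite !expr0 mulr1 mul1r scale1r.
rewrite [LHS](_ : _ = (x * y ^+ n) * y); last by rewrite exprSr mulrA.
rewrite IH -scalerAl -(mulrA _ x) xy -scalerAr scalerA -exprSr.
by rewrite mulrA -exprSr.
Qed.

Lemma sl2_EFn n : E * F ^+ n.+1 = F ^+ n.+1 * E +
  F ^+ n * ((br n.+1 / d / d) *: (q ^- n *: K - q ^+ n *: KV)).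
Proof.
elim: n => [|n IH].
  rewrite !expr1 !expr0 mul1r invr1 !scale1r EFE; congr (_ + _ *: _).
  by field; rewrite q0 qq1.
have -> : E * F ^+ n.+2 = E * F ^+ n.+1 * F by rewrite exprSr mulrA.
rewrite IH mulrDl -(mulrA _ E) EFE mulrDr mulrA -exprSr -addrA; congr (_ + _).
set c := br n.+1 / d / d; set c' := br n.+2 / d / d.
rewrite -(mulrA (F ^+ n)) -(scalerAl c) (mulrBl _ (q ^- n *: K)).
rewrite -(scalerAl (q ^- n)) -(scalerAl (q ^+ n)) KF sl2_KVF.
rewrite -!scalerAr !mulrBr -!scalerAr !(mulrA _ F) -!exprSr !scalerBr !scalerA.
rewrite addrACA -opprD -!scalerDl.
have x0 : q ^+ n != 0 by rewrite expf_neq0.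
rewrite /c /c' !exprS; move: (q ^+ n) x0 => x x0.
congr (_ *: _ - _ *: _).
  by field; rewrite ?q0 ?x0 ?qq1.
by field; rewrite ?q0 ?x0 ?qq1.
Qed.

Definition casimir : A := F * E + (d ^- 2) *: (q *: K + q^-1 *: KV).

Lemma casimir_FE : F * E = casimir - d ^- 2 *: (q *: K + q^-1 *: KV).
Proof. by rewrite /casimir addrK. Qed.

Lemma casimir_EF : E * F = casimir - d ^- 2 *: (q^-1 *: K + q *: KV).
Proof.
rewrite /casimir EFE -addrA; congr (_ + _).
rewrite scalerBr !scalerDr !scalerA opprD addrACA -!scaleNr -!scalerDl.
by congr (_ *: _ + _ *: _); field; rewrite ?q0 ?qq1.
Qed.

Lemma scale2l (a b c : C) (x y z : A) :
  a *: (b *: x + c *: y) * z = (a * b) *: (x * z) + (a * c) *: (y * z).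
Proof. by rewrite scalerDr !scalerA mulrDl -!scalerAl. Qed.

Lemma scale2r (a b c : C) (x y z : A) :
  z * (a *: (b *: x + c *: y)) = (a * b) *: (z * x) + (a * c) *: (z * y).
Proof. by rewrite scalerDr !scalerA mulrDr -!scalerAr. Qed.

Lemma lin2 (a b a' b' : C) (x y : A) : a = a' -> b = b' ->
  a *: x + b *: y = a' *: x + b' *: y.
Proof. by move=> -> ->. Qed.

Lemma add_lin2 (a b a' b' : C) (x y : A) :
  (a *: x + b *: y) + (a' *: x + b' *: y) = (a + a') *: x + (b + b') *: y.
Proof. by rewrite addrACA -!scalerDl. Qed.

Lemma scale_sub (a : C) (x y : A) : a *: (x - y) = a *: (1 *: x + (-1) *: y).
Proof. by rewrite scale1r scaleN1r. Qed.

Lemma casimirE : casimir * E = E * casimir.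
Proof.
rewrite /casimir mulrDl mulrDr mulrA EFE [in RHS]mulrDl -addrA; congr (_ + _).
rewrite scale_sub !scale2l scale2r KE sl2_KVE !scalerA add_lin2.
by apply: lin2; field; rewrite ?q0 ?qq1.
Qed.

Lemma casimirF : casimir * F = F * casimir.
Proof.
rewrite /casimir mulrDl mulrDr -mulrA EFE [in LHS]mulrDr -addrA; congr (_ + _).
rewrite scale_sub scale2l !scale2r KF sl2_KVF !scalerA add_lin2.
by apply: lin2; field; rewrite ?q0 ?qq1.
Qed.

Lemma casimirK : casimir * K = K * casimir.
Proof.
rewrite /casimir mulrDl mulrDr scale2l scale2r KKV KVK; congr (_ + _).
by rewrite mulrA KF -scalerAl -!mulrA KE -scalerAr scalerA mulVf ?expf_neq0 // scale1r.
Qed.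

Lemma comm_exp (x y : A) n : x * y = y * x -> x * y ^+ n = y ^+ n * x.
Proof.
by move=> xy; have := @scal_commX x y 1 n; rewrite expr1n !scale1r; apply.
Qed.

(* Both sides are the same product of shifted Casimir elements, as the weights
   met on the way up from 1 are inverse to those met on the way down. *)
Lemma sl2_FE_EF n o : K * o = o -> KV * o = o ->
  F ^+ n * E ^+ n * o = E ^+ n * F ^+ n * o.
Proof.
elim: n o => [|n IH] o Ko KVo; first by rewrite !expr0.
(* Cartan part of [F * E] at weight [q ^+ (2n)] and of [E * F] at weight [q ^- (2n)]; the two
   coincide. *)
pose ph := d ^- 2 * (q ^+ n.*2.+1 + q ^- n.*2.+1).
pose o' := casimir * o - ph *: o.
have KX y a : K * y = a *: (y * K) -> K * (y ^+ n * o) = a ^+ n *: (y ^+ n * o).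
  by move=> h; rewrite mulrA (scal_commX _ h) -scalerAl -mulrA Ko.
have KVX y a : KV * y = a *: (y * KV) -> KV * (y ^+ n * o) = a ^+ n *: (y ^+ n * o).
  by move=> h; rewrite mulrA (scal_commX _ h) -scalerAl -mulrA KVo.
have x0 : q ^+ n != 0 by rewrite expf_neq0.
have e2 : q ^+ n.*2.+1 = q ^+ n * q ^+ n * q by rewrite exprSr -addnn exprD.
have p2 : (q ^+ 2) ^+ n = q ^+ n * q ^+ n by rewrite -exprM mulnC exprM expr2.
have p2V : (q ^- 2) ^+ n = (q ^+ n * q ^+ n)^-1 by rewrite exprVn p2.
have Fside : F ^+ n.+1 * E ^+ n.+1 * o = F ^+ n * E ^+ n * o'.
  rewrite exprSr exprS -!mulrA (mulrA F) casimir_FE mulrBl.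
  rewrite [casimir * (_ * _)]mulrA (comm_exp _ casimirE) scale2l.
  rewrite (KX _ _ KE) (KVX _ _ sl2_KVE) !scalerA -scalerDl p2 p2V.
  rewrite /o' !mulrBr -!mulrA -!scalerAr; congr (_ - _ *: _).
  by rewrite /ph e2; field; rewrite ?q0 ?qq1 ?x0.
have Eside : E ^+ n.+1 * F ^+ n.+1 * o = E ^+ n * F ^+ n * o'.
  rewrite exprSr (exprS F) -!mulrA (mulrA E) casimir_EF mulrBl.
  rewrite [casimir * (_ * _)]mulrA (comm_exp _ casimirF) scale2l.
  rewrite (KX _ _ KF) (KVX _ _ sl2_KVF) !scalerA -scalerDl p2 p2V.
  rewrite /o' !mulrBr -!mulrA -!scalerAr; congr (_ - _ *: _).
  by rewrite /ph e2; field; rewrite ?q0 ?qq1 ?x0.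
rewrite Fside Eside IH // /o' mulrBr -scalerAr ?Ko ?KVo // mulrA.
  by rewrite -casimirK -mulrA Ko.
have -> : KV * casimir = casimir * KV.
  rewrite -[LHS]mulr1 -KKV mulrA -(mulrA KV) casimirK mulrA KVK mul1r //.
by rewrite -mulrA KVo.
Qed.

(** [a^-1] is the coefficient for which the terms in [z * KV] cancel and only [z * K] remains. *)
Lemma comm_step z a w : a != 0 -> K * z = a *: (z * K) ->
  KV * z = a^-1 *: (z * KV) -> E * z - z * E = w ->
  E * (F * z - a^-1 *: (z * F)) - (F * z - a^-1 *: (z * F)) * E =
  (d^-1 * (a - a^-1)) *: (z * K) + (F * w - a^-1 *: (w * F)).
Proof.
move=> a0 Kz KVz <-.
have FE : F * E = E * F - d^-1 *: (K - KV) by rewrite -EF opprB addrC subrK.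
have -> : F * (E * z - z * E) - a^-1 *: ((E * z - z * E) * F) =
   (F * E * z - F * z * E) - (a^-1 *: (E * z * F) - a^-1 *: (z * E * F)).
  by rewrite mulrBr mulrBl scalerBr !mulrA.
have -> : E * (F * z - a^-1 *: (z * F)) - (F * z - a^-1 *: (z * F)) * E =
   (E * F * z - a^-1 *: (E * z * F)) - (F * z * E - a^-1 *: (z * F * E)).
  by rewrite mulrBr mulrBl -scalerAr -scalerAl !mulrA.
have -> : E * F * z = F * E * z + d^-1 *: ((a *: (z * K)) - a^-1 *: (z * KV)).
  by rewrite EFE mulrDl -scalerAl mulrBl Kz KVz.
have -> : a^-1 *: (z * F * E) = a^-1 *: (z * E * F) -
    (a^-1 / d) *: (z * K - z * KV).
  by rewrite -!mulrA FE mulrBr -scalerAr mulrBr scalerBr scalerA.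
rewrite !scalerBr !scalerA mulrBr scalerBl.
have := addrC; move: (F * E * z) (F * z * E) (z * E * F) (E * z * F) => u1 u2 u3 u4 _.
have -> : a^-1 / d = d^-1 / a by rewrite mulrC.
move: (_ *: (z * K)) (_ *: (z * KV)) (_ *: (z * K)) (_ *: u4) (_ *: u3) => v1 v2 v3 v4 v5.
rewrite !(opprB, opprD, opprK) !addrA.
by rewrite [LHS](ACl (2*7*1*8*5*4*6*3))/= addrK.
Qed.

(** Closed form of [- d^-1] times the sum of [br 2], [br 4], ..., [br (2n+2)], the scalars that
    [comm_step] contributes along the chain. *)
Definition chain_scalar (n : nat) : C := - (br n.+1 * br n.+2) * d ^- 2.

(** The coefficient is the inverse of the weight of [chain z n'], as [comm_step] requires: [z] has
    weight [q ^- 2] and each [F] contributes another [q ^- 2]. *)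
Fixpoint chain (z : A) (n : nat) : A :=
  if n is n'.+1
  then F * chain z n' - q ^+ (2 * n'.+1) *: (chain z n' * F) else z.

Lemma chain_weight z n : K * z = q ^- 2 *: (z * K) ->
  K * chain z n = q ^- (2 * n.+1) *: (chain z n * K).
Proof.
move=> Kz; elim: n => [|n IH] //=; set w := chain z n in IH *.
have Fw : K * (F * w) = q ^- (2 * n.+2) *: (F * w * K).
  rewrite mulrA KF -scalerAl -(mulrA F K) IH -scalerAr scalerA mulrA; congr (_ *: _).
  by rewrite -invfM -exprD [in RHS]mulnS.
have wF : K * (w * F) = q ^- (2 * n.+2) *: (w * F * K).
  rewrite mulrA IH -scalerAl -(mulrA w K) KF -scalerAr scalerA mulrA; congr (_ *: _).
  by rewrite -invfM -exprD [in RHS]mulnS addnC.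
by rewrite mulrBr mulrBl scalerBr Fw -scalerAr wF -scalerAl !scalerA mulrC.
Qed.

(** [F] kills [y] on both sides, so the first commutator is a multiple of [z * K] alone. Afterwards
    the twisted commutator of [F] with [chain z n * K] is [chain z n.+1 * K], which only adds to the
    scalar. *)
Lemma chain_comm z y n : K * z = q ^- 2 *: (z * K) -> E * z - z * E = y ->
  F * y = 0 -> y * F = 0 ->
  E * chain z n.+1 - chain z n.+1 * E = chain_scalar n *: (chain z n * K).
Proof.
move=> Kz zy Fy yF.
have wtV m : KV * chain z m = q ^+ (2 * m.+1) *: (chain z m * KV).
  have H : KV * (K * chain z m) * KV = chain z m * KV by rewrite mulrA KVK mul1r.
  rewrite -H (chain_weight _ Kz) -scalerAr -scalerAl -!mulrA KKV mulr1 scalerA.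
  by rewrite mulfV ?expf_neq0 // scale1r.
have step m w : E * chain z m - chain z m * E = w ->
    E * chain z m.+1 - chain z m.+1 * E =
    (d^-1 * (q ^- (2 * m.+1) - q ^+ (2 * m.+1))) *: (chain z m * K) +
    (F * w - q ^+ (2 * m.+1) *: (w * F)).
  move=> mw; have := @comm_step (chain z m) (q ^- (2 * m.+1)) w _ (chain_weight _ Kz).
  by rewrite invrK; apply=> //; rewrite invr_neq0 ?expf_neq0.
elim: n => [|n IH].
  rewrite (step 0%N _ zy) Fy yF scaler0 subrr addr0; congr (_ *: _).
  by rewrite /chain_scalar muln1 expr1; field; rewrite ?q0 ?qq1.
rewrite (step _ _ IH) -scalerAr -scalerAl scalerA mulrA.
set w := chain z n; set w' := chain z n.+1.
have -> : w * K * F = q ^- 2 *: (w * F * K) by rewrite -mulrA KF -scalerAr mulrA.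
rewrite scalerA.
have -> : q ^+ (2 * n.+2) * chain_scalar n / q ^+ 2 = chain_scalar n * q ^+ (2 * n.+1).
  rewrite [in LHS](_ : 2 * n.+2 = 2 + 2 * n.+1)%N ?mulnS // exprD.
  by move: (q ^+ (2 * n.+1)) (chain_scalar n) => u v; field; rewrite q0.
rewrite -(scalerA (chain_scalar n)) -scalerBr (_ : F * w * K - _ = w' * K); last first.
  by rewrite /w' /= mulrBl -scalerAl.
rewrite -scalerDl; congr (_ *: _); rewrite /chain_scalar.
have x0 : q ^+ n != 0 by rewrite expf_neq0.
have -> : q ^+ (2 * n.+2) = q ^+ n * q ^+ n * q ^+ 4.
  by rewrite -!exprD; congr (_ ^+ _); lia.
rewrite !exprS !expr0; move: (q ^+ n) x0 => x x0.
by field; rewrite ?q0 ?x0 ?qq1.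
Qed.

End QuantumSl2.

(** * Quantum sl2 at a root of unity: the cointegral and its primitive *)

Section RootOfUnity.
Variables (C : fieldType) (A : algType C) (q : C) (m : nat).
Local Notation p := m.+2.
Hypothesis q0 : q != 0.
Hypothesis d0 : q - q^-1 != 0.
Hypothesis qp : q ^+ p = -1.
Local Notation d := (q - q^-1).
Local Notation br n := (q ^+ n - q ^- n).
Variables (E F L : A).
Local Notation LV := (L ^+ (4 * p).-1).
Local Notation K := (L ^+ 2).
Local Notation KV := (LV ^+ 2).
Hypothesis Lp : L ^+ (4 * p) = 1.
Hypothesis Ep : E ^+ p = 0.
Hypothesis Fp : F ^+ p = 0.
Hypothesis LE : L * E = q *: (E * L).
Hypothesis LF : L * F = q^-1 *: (F * L).
Hypothesis EF : E * F - F * E = d^-1 *: (K - KV).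

Lemma LLV : L * LV = 1.
Proof. by rewrite -exprS prednK. Qed.

Lemma LVL : LV * L = 1.
Proof. by rewrite -exprSr prednK. Qed.

Lemma root_KKV : K * KV = 1.
Proof. by rewrite !expr2 -mulrA (mulrA L LV) LLV mul1r LLV. Qed.

Lemma root_KVK : KV * K = 1.
Proof. by rewrite !expr2 -mulrA (mulrA LV L) LVL mul1r LVL. Qed.

Lemma commX_scal (x : A) (a : C) n : L * x = a *: (x * L) ->
  L ^+ n * x = a ^+ n *: (x * L ^+ n).
Proof.
move=> Lx; elim: n => [|n IH]; first by rewrite !expr0 mul1r mulr1 scale1r.
have -> : L ^+ n.+1 * x = L * (L ^+ n * x) by rewrite exprS mulrA.
rewrite IH -scalerAr (mulrA L) Lx -scalerAl scalerA -exprSr.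
by rewrite -mulrA -exprS.
Qed.

Lemma root_KE : K * E = q ^+ 2 *: (E * K).
Proof. exact: commX_scal. Qed.

Lemma root_KF : K * F = q ^- 2 *: (F * K).
Proof. by rewrite (commX_scal _ LF) exprVn. Qed.

Local Notation root_EFn := (sl2_EFn q0 d0 root_KKV root_KVK root_KF EF).

(** The relations behind [sl2_EFn] are symmetric under exchanging [E] with [F] and [K] with [KV]. *)
Lemma root_FEn n : F * E ^+ n.+1 = E ^+ n.+1 * F +
  E ^+ n * ((br n.+1 / d / d) *: (q ^- n *: KV - q ^+ n *: K)).
Proof.
apply: (sl2_EFn q0 d0 root_KVK root_KKV).
  exact: (sl2_KVE q0 root_KKV root_KVK root_KE).
by rewrite -opprB EF -scalerN opprB.
Qed.

Lemma q2p : q ^+ (2 * p) = 1.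
Proof. by rewrite mulnC exprM qp expr2 mulrNN mulr1. Qed.

(* Up to a scalar, the projector on the eigenspace [L = q ^ j]. *)
Definition weight_proj (j : nat) : A := \sum_(a < 4 * p) (q ^- j) ^+ a *: L ^+ a.
Local Notation O := weight_proj.

Lemma weight_proj_period j : O (j + 2 * p) = O j.
Proof. by rewrite /O exprD q2p mulr1. Qed.

Lemma weight_projC j : L * O j = O j * L.
Proof.
rewrite mulr_sumr mulr_suml; apply: eq_bigr => a _.
by rewrite -scalerAr -scalerAl -exprS -exprSr.
Qed.

Lemma weight_projL j : L * O j = q ^+ j *: O j.
Proof.
pose f a := (q ^- j) ^+ a *: L ^+ a.
have f4 : f (4 * p)%N = f 0%N.
  have e4 : (j * (4 * p) = 2 * p * (2 * j))%N by rewrite mulnCA mulnACA (mulnC p).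
  by rewrite /f Lp !expr0 exprVn -exprM e4 exprM q2p expr1n invr1.
have fS a : L * f a = q ^+ j *: f a.+1.
  rewrite /f -scalerAr -exprS scalerA (exprS (q ^- j)) mulrA mulfV ?expf_neq0 // mul1r //.
have -> : O j = \sum_(0 <= a < 4 * p) f a by rewrite big_mkord.
have -> : L * (\sum_(0 <= a < 4 * p) f a) = q ^+ j *: \sum_(0 <= a < 4 * p) f a.+1.
  by rewrite mulr_sumr scaler_sumr; apply: eq_bigr => a _; rewrite fS.
congr (_ *: _).
have := @big_nat_recl A 0 +%R (4 * p) 0 f isT.
have := @big_nat_recr A 0 +%R (4 * p) 0 f isT.
by rewrite f4 => -> /(congr1 (+%R^~ (- f 0%N))); rewrite addrK addrAC subrr add0r.
Qed.

Lemma weight_projE j : E * O j = O j.+1 * E.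
Proof.
rewrite mulr_sumr mulr_suml; apply: eq_bigr => a _.
rewrite -scalerAr -scalerAl.
have -> : L ^+ a * E = q ^+ a *: (E * L ^+ a).
  exact: commX_scal.
rewrite scalerA; congr (_ *: _).
by rewrite -exprMn exprS invfM mulrAC mulVf ?mul1r.
Qed.

Lemma weight_projF j : F * O j.+1 = O j * F.
Proof.
rewrite mulr_sumr mulr_suml; apply: eq_bigr => a _.
rewrite -scalerAr -scalerAl.
have -> : L ^+ a * F = (q^-1) ^+ a *: (F * L ^+ a).
  exact: commX_scal.
by rewrite scalerA exprS invfM exprMn mulrC.
Qed.

Lemma weight_projK j : K * O j = q ^+ (2 * j) *: O j.
Proof. by rewrite expr2 -mulrA weight_projL -scalerAr weight_projL scalerA -exprD addnn mul2n. Qed.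

Lemma weight_projKV j : KV * O j = q ^- (2 * j) *: O j.
Proof.
have H : KV * (K * O j) = O j by rewrite mulrA root_KVK mul1r.
by rewrite -[in RHS]H weight_projK -scalerAr scalerA mulVf ?expf_neq0 ?scale1r.
Qed.

Lemma weight_projKC j : O j * K = K * O j.
Proof. by rewrite expr2 mulrA -weight_projC -mulrA -weight_projC mulrA. Qed.

Lemma weight_projEn j n : E ^+ n * O j = O (j + n) * E ^+ n.
Proof.
elim: n => [|n IH]; first by rewrite addn0 !expr0 mul1r mulr1.
by rewrite exprS -mulrA IH mulrA weight_projE -mulrA addnS.
Qed.

(* The balance [q ^- m * x - q ^+ m / x] of [sl2_EFn] vanishes at the weights
   [x = q ^+ 2] and [x = q ^- 2] next to the trivial one. *)
Lemma balance (y : A) (s : C) : K * y = q ^- 2 *: y -> KV * y = q ^+ 2 *: y ->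
  (s *: (q ^- m *: K - q ^+ m *: KV)) * y = 0.
Proof.
move=> Ky KVy; rewrite -scalerAl mulrBl -!scalerAl Ky KVy !scalerA -scalerBl.
have -> : q ^- m / q ^+ 2 - q ^+ m * q ^+ 2 = 0.
  by rewrite -invfM -exprD addn2 qp invrN invr1 subrr.
by rewrite scale0r scaler0.
Qed.

Lemma balance' (y : A) (s : C) : K * y = q ^+ 2 *: y -> KV * y = q ^- 2 *: y ->
  (s *: (q ^- m *: KV - q ^+ m *: K)) * y = 0.
Proof.
move=> Ky KVy; rewrite -scalerAl mulrBl -!scalerAl Ky KVy !scalerA -scalerBl.
have -> : q ^- m / q ^+ 2 - q ^+ m * q ^+ 2 = 0.
  by rewrite -invfM -exprD addn2 qp invrN invr1 subrr.
by rewrite scale0r scaler0.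
Qed.

(** Up to a scalar [top 0] is the cointegral, and [top p] is the same sum with alternating signs, as
    [q ^+ p = -1]. *)
Definition top (j : nat) : A := E ^+ m.+1 * F ^+ m.+1 * O j.

Lemma E_top j : E * top j = 0.
Proof. by rewrite /top !mulrA -exprS Ep !mul0r. Qed.

Lemma top_F j : top j * F = 0.
Proof.
rewrite /top -mulrA -weight_projF mulrA -(mulrA (E ^+ m.+1)) -exprSr Fp.
by rewrite mulr0 mul0r.
Qed.

(** [j'] is [j - 1] modulo [2 * p], kept a natural number; [balance] applies at this neighbouring
    weight. *)
Lemma weight_next j : q ^+ (2 * j) = 1 ->
  exists j', [/\ O j = O j'.+1, K * O j' = q ^- 2 *: O j' &
    KV * O j' = q ^+ 2 *: O j'].
Proof.
move=> qj; exists (j + (2 * p).-1)%N; rewrite weight_projK weight_projKV -addnS prednK //.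
have e : q ^+ (2 * (j + (2 * p).-1)) = q ^- 2.
  rewrite -[RHS]mulr1; apply: (mulfI (x := q ^+ 2)); rewrite ?expf_neq0 //.
  rewrite mulrA mulfV ?expf_neq0 // mul1r -exprD.
  have -> : (2 + 2 * (j + (2 * p).-1) = 2 * j + 2 * p * 2)%N.
    by rewrite -mulnS -addnS prednK // mulnDr (mulnC 2 (2 * p)).
  by rewrite exprD qj exprM q2p expr1n mulr1.
by rewrite e invrK; split=> //; rewrite weight_proj_period.
Qed.

(** Moving [E] to the left past the projector and [F ^+ m.+1] produces [E ^+ p = 0] and a Cartan
    bracket killed by [balance]. *)
Lemma top_E j : q ^+ (2 * j) = 1 -> top j * E = 0.
Proof.
move=> /weight_next[j' [Oj KO KVO]]; rewrite /top Oj -mulrA -weight_projE.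
have FE : F ^+ m.+1 * E = E * F ^+ m.+1 - F ^+ m *
    ((br m.+1 / d / d) *: (q ^- m *: K - q ^+ m *: KV)).
  by rewrite root_EFn addrK.
rewrite mulrA -(mulrA (E ^+ m.+1)) FE mulrBr mulrA -exprSr Ep mul0r sub0r.
by rewrite mulNr -!(mulrA _ _ (O j')) balance // !mulr0 oppr0.
Qed.

Lemma weight_Fn n j : q ^+ (2 * j) = 1 ->
  K * (F ^+ n * O j) = q ^- (2 * n) *: (F ^+ n * O j) /\
  KV * (F ^+ n * O j) = q ^+ (2 * n) *: (F ^+ n * O j).
Proof.
move=> qj; split.
  rewrite mulrA (scal_commX n root_KF) -scalerAl -mulrA weight_projK qj scale1r.
  by rewrite exprVn -exprM.
rewrite mulrA (scal_commX n (sl2_KVF q0 root_KKV root_KVK root_KF)).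
by rewrite -scalerAl -mulrA weight_projKV qj invr1 scale1r -exprM.
Qed.

Lemma q_shift : q ^+ (2 * m.+1) = q ^- 2.
Proof.
apply: (mulfI (x := q ^+ 2)); first by rewrite expf_neq0.
by rewrite mulfV ?expf_neq0 // -exprD -mulnS q2p.
Qed.

Lemma F_top j : q ^+ (2 * j) = 1 -> F * top j = 0.
Proof.
move=> qj; have [KO KVO] := weight_Fn m.+1 qj.
rewrite /top -mulrA mulrA root_FEn mulrDl -(mulrA _ F) (mulrA F) -exprS Fp.
rewrite mul0r mulr0 add0r -(mulrA (E ^+ m)).
by rewrite balance' ?mulr0 // ?KO ?KVO q_shift ?invrK.
Qed.

Lemma top_L j : L * top j = top j * L.
Proof.
have LEn := scal_commX m.+1 LE; have LFn := scal_commX m.+1 LF.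
rewrite /top !mulrA LEn -!scalerAl -(mulrA _ L) LFn -scalerAr -scalerAl scalerA.
by rewrite -exprMn mulfV // expr1n scale1r -!mulrA weight_projC.
Qed.

Lemma top_K j : q ^+ (2 * j) = 1 -> top j * K = top j.
Proof. by move=> qj; rewrite /top -mulrA weight_projKC weight_projK qj scale1r. Qed.

(** The sum of [E ^+ a * w * E ^+ b] over [a + b = n - 1]; its commutator with [E] telescopes. *)
Fixpoint ladder (w : A) (n : nat) : A :=
  if n is n'.+1 then E * ladder w n' + w * E ^+ n' else 0.

Lemma ladder_comm w n : E * ladder w n - ladder w n * E = E ^+ n * w - w * E ^+ n.
Proof.
elim: n => [|n IH] /=; first by rewrite mulr0 mul0r !expr0 mul1r mulr1 !subrr.
rewrite mulrDl mulrDr -!mulrA -exprSr opprD addrACA -mulrBr IH mulrBr !mulrA.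
by rewrite -exprS addrA subrK.
Qed.

Lemma ladder_weight w n a : K * w = a *: (w * K) ->
  K * ladder w n.+1 = (a * q ^+ (2 * n)) *: (ladder w n.+1 * K).
Proof.
move=> Kw; elim: n => [|n IH].
  by rewrite /= mulr0 add0r expr0 !mulr1.
have -> : ladder w n.+2 = E * ladder w n.+1 + w * E ^+ n.+1 by [].
rewrite mulrDr mulrDl scalerDr; congr (_ + _).
  rewrite mulrA root_KE -scalerAl -(mulrA E K) IH -scalerAr scalerA (mulrA E).
  by congr (_ *: _); rewrite mulrCA -exprD mulnS.
rewrite mulrA Kw -scalerAl -(mulrA w K) (scal_commX n.+1 root_KE) -scalerAr scalerA (mulrA w).
by rewrite -exprM.
Qed.

(** The commutator of [E] with the ladder is [top 0 - F ^+ m.+1 * E ^+ m.+1 * O p.+1], the projector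
    [O 0] having moved across [E ^+ m.+1]. The second summand corrects the last term: [E] passes
    [F ^+ m.+1] from the left by [balance], and from the right it gives a product of weight zero,
    which [sl2_FE_EF] turns into [top p]. *)
Definition top_primitive : A :=
  ladder (F ^+ m.+1 * O 0) m.+1 + F ^+ m.+1 * E ^+ m * O p.+1.

Lemma top_primitive_comm :
  E * top_primitive - top_primitive * E = top 0 - top p.
Proof.
have qp1 : q ^+ (2 * p.+1) = q ^+ 2 by rewrite mulnS exprD q2p mulr1.
have wE : F ^+ m.+1 * O 0 * E ^+ m.+1 = F ^+ m.+1 * E ^+ m.+1 * O p.+1.
  by rewrite -[O 0]weight_proj_period -!mulrA weight_projEn; congr (_ * (O _ * _)); lia.
have EY : E * (F ^+ m.+1 * E ^+ m * O p.+1) = F ^+ m.+1 * E ^+ m.+1 * O p.+1.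
  have KY : K * (E ^+ m * O p.+1) = q ^- 2 *: (E ^+ m * O p.+1).
    rewrite mulrA (scal_commX m root_KE) -scalerAl -mulrA weight_projK -scalerAr scalerA.
    by rewrite qp1 -exprM -exprD -q_shift mulnS addnC.
  have KVY : KV * (E ^+ m * O p.+1) = q ^+ 2 *: (E ^+ m * O p.+1).
    have H : KV * (K * (E ^+ m * O p.+1)) = E ^+ m * O p.+1.
      by rewrite mulrA root_KVK mul1r.
    by rewrite -[in RHS]H KY -scalerAr scalerA mulfV ?scale1r // expf_neq0.
  rewrite -mulrA mulrA root_EFn mulrDl -(mulrA (F ^+ m)) balance // mulr0 addr0.
  by rewrite -!mulrA (mulrA E) -exprS.
have YE : F ^+ m.+1 * E ^+ m * O p.+1 * E = top p.
  rewrite -mulrA -weight_projE mulrA -(mulrA _ _ E) -exprSr /top.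
  apply: (sl2_FE_EF q0 d0 root_KKV root_KVK root_KE root_KF EF).
    by rewrite weight_projK q2p scale1r.
  by rewrite weight_projKV q2p invr1 scale1r.
rewrite /top_primitive mulrDr mulrDl opprD addrACA ladder_comm EY YE wE.
by rewrite addrA subrK /top !mulrA.
Qed.

Lemma top_primitive_weight :
  K * top_primitive = q ^- 2 *: (top_primitive * K).
Proof.
have Kw : K * (F ^+ m.+1 * O 0) = q ^+ 2 *: (F ^+ m.+1 * O 0 * K).
  rewrite mulrA (scal_commX m.+1 root_KF) -scalerAl -(mulrA _ K) -weight_projKC mulrA.
  by rewrite exprVn -exprM q_shift invrK.
rewrite /top_primitive mulrDr mulrDl scalerDr; congr (_ + _).
  rewrite (ladder_weight _ Kw); congr (_ *: _).
  by rewrite -exprD -mulnS q_shift.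
rewrite !mulrA (scal_commX m.+1 root_KF) -!scalerAl -(mulrA _ K) (scal_commX m root_KE).
rewrite -scalerAr -!scalerAl scalerA -!mulrA weight_projKC; congr (_ *: _);
  last by rewrite expr2 -!mulrA.
rewrite exprVn -!exprM mulnS exprD invfM -mulrA mulVf ?mulr1 //.
by rewrite expf_neq0.
Qed.

End RootOfUnity.

(** * The roots of unity *)

Section Roots.
Variable R : realType.

Lemma cexp_iD (x y : R) : cexp_i (x + y) = cexp_i x * cexp_i y.
Proof.
rewrite /cexp_i cosD sinD; apply/eqP; rewrite eq_complex /=.
by rewrite eqxx /= addrC.
Qed.

Lemma cexp_iMn (x : R) n : cexp_i (x *+ n) = cexp_i x ^+ n.
Proof.
elim: n => [|n IH]; first by rewrite mulr0n /cexp_i cos0 sin0.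
by rewrite mulrS cexp_iD IH exprS.
Qed.

Lemma cexp_i_pi : cexp_i (pi : R) = -1.
Proof.
by rewrite /cexp_i cospi sinpi; apply/eqP; rewrite eq_complex /= oppr0 !eqxx.
Qed.

Variable p : nat.
Hypothesis p_gt1 : (1 < p)%N.
Local Notation q := (q_root R p).
Local Notation t := (t_root R p).

Let p0 : (p%:R : R) != 0. Proof. by rewrite pnatr_eq0; case: p p_gt1. Qed.

Lemma q_rootXp : q ^+ p = -1.
Proof. by rewrite /q_root -cexp_iMn -(mulr_natr (pi / _)) divfK // cexp_i_pi. Qed.

Lemma q_root_neq0 : q != 0.
Proof.
apply/eqP => q0; have := q_rootXp; rewrite q0 expr0n; case: p p_gt1 => //= n _.
by move/eqP; rewrite eq_sym oppr_eq0 oner_eq0.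
Qed.

Lemma t_root2 : t ^+ 2 = q.
Proof.
rewrite /t_root /q_root -cexp_iMn; congr cexp_i.
rewrite -(mulr_natr (pi / _)) natrM; field.
by rewrite p0.
Qed.

Lemma t_rootX2p : t ^+ (2 * p) = -1.
Proof. by rewrite exprM t_root2 q_rootXp. Qed.

(** The brace is [2 i sin (n pi / p)], with the angle strictly between 0 and [pi]; its vanishing
    would give [q ^+ (2n) = 1], whose real part forces the sine to be 0. *)
Lemma qbrace_neq0 n : (0 < n < p)%N -> q ^+ n - q ^- n != 0.
Proof.
move=> /andP[n0 np]; have q0 : q ^+ n != 0 by rewrite expf_neq0 // q_root_neq0.
apply/eqP => h; have : q ^+ n * q ^+ n = 1.
  by apply/eqP; rewrite -(mulfV q0) -subr_eq0 -mulrBr h mulr0.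
rewrite -exprD addnn -mul2n /q_root -cexp_iMn.
pose x : R := pi / p%:R *+ n.
have sx : 0 < sin x.
  apply: sin_gt0_pi; rewrite /x -(mulr_natr (pi / _)).
  apply/andP; split.
    by rewrite mulr_gt0 ?ltr0n // divr_gt0 ?pi_gt0 // ltr0n (ltn_trans _ np).
  rewrite -mulrA gtr_pMr ?pi_gt0 // mulrC ltr_pdivrMr ?mul1r ?ltr_nat //.
  by rewrite ltr0n (ltn_trans n0).
rewrite (_ : _ *+ (2 * n) = x *+ 2); last by rewrite /x -mulrnA mulnC.
rewrite cexp_iMn expr2 /cexp_i => /eqP; rewrite eq_complex /= => /andP[/eqP h1 _].
have := cos2Dsin2 x; rewrite -h1 => h2.
have : sin x ^+ 2 = 0 by move: h2; rewrite !expr2 => ?; lra.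
by move/eqP; rewrite expf_eq0 /= (gt_eqF sx).
Qed.

Lemma q_subV_neq0 : q - q^-1 != 0.
Proof. by have := @qbrace_neq0 1; rewrite !expr1; apply. Qed.

End Roots.

(** * Spanning monomials *)

Section Span.
Variables (C : fieldType) (A : algType C) (E F L : A) (a b c : C) (i j : nat).
Hypothesis LE : L * E = a *: (E * L).
Hypothesis LF : L * F = b *: (F * L).
Hypothesis EF : E * F - F * E = c *: (L ^+ i - L ^+ j).

(** Exponents are unbounded: the argument rests on the commutation relations alone and serves both
    algebras. *)
Definition monomial_span (x : A) : Prop :=
  forall Q : A -> Prop, (forall u v w, Q (E ^+ u * F ^+ v * L ^+ w)) ->
    (forall k y z, Q y -> Q z -> Q (k *: y + z)) -> Q x.

Local Notation Span := monomial_span.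

Lemma span_lin k y z : Span y -> Span z -> Span (k *: y + z).
Proof. by move=> hy hz Q Qm Ql; apply: Ql (hy Q Qm Ql) (hz Q Qm Ql). Qed.

Lemma span_mul_of x : (forall u v w, Span (x * (E ^+ u * F ^+ v * L ^+ w))) ->
  forall y, Span y -> Span (x * y).
Proof.
move=> xm y hy; apply: (hy (fun y => Span (x * y))) => // k z z' hz hz'.
by rewrite mulrDr -scalerAr; apply: span_lin.
Qed.

Lemma span_monomial u v w : Span (E ^+ u * F ^+ v * L ^+ w).
Proof. by move=> Q. Qed.

Lemma span0 : Span 0.
Proof.
have h := span_lin (-1) (span_monomial 0 0 0) (span_monomial 0 0 0).
by move: h; rewrite scaleN1r addNr.
Qed.

Lemma span_scale k y : Span y -> Span (k *: y).
Proof. by move=> hy; rewrite -[_ *: _]addr0; apply: span_lin => //; apply: span0. Qed.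

Lemma span_E y : Span y -> Span (E * y).
Proof.
by apply: span_mul_of => u v w; rewrite !mulrA -exprS; apply: span_monomial.
Qed.

Lemma span_L y : Span y -> Span (L * y).
Proof.
apply: span_mul_of => u v w.
rewrite !mulrA (scal_commX u LE) -!scalerAl -(mulrA _ L) (scal_commX v LF).
rewrite -scalerAr -!scalerAl mulrA -(mulrA _ L) -exprS.
by do 2!apply: span_scale; apply: span_monomial.
Qed.

Lemma span_Ln n y : Span y -> Span (L ^+ n * y).
Proof.
elim: n => [|n IH] hy; first by rewrite mul1r.
by rewrite exprS -mulrA; apply: span_L; apply: IH.
Qed.

Lemma span_F y : Span y -> Span (F * y).
Proof.
apply: span_mul_of => u v w; elim: u => [|u IH].
  by rewrite expr0 mul1r mulrA -exprS -[_ * _]mul1r mulrA -(expr0 E); apply: span_monomial.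
have FE : F * E = E * F - c *: (L ^+ i - L ^+ j).
  by rewrite -EF opprB addrC subrK.
rewrite exprS -!mulrA (mulrA F) FE mulrBl -!mulrA -scalerAl mulrBl.
rewrite -scaleNr addrC; apply: span_lin.
  rewrite addrC -scaleN1r; apply: span_lin; apply: span_Ln; rewrite mulrA; exact: span_monomial.
by apply: span_E; rewrite (mulrA (E ^+ u)).
Qed.

End Span.

(** The span contains 1 and is stable under left multiplication by the generators, hence by
    everything. *)
Lemma presented_span (R : realType)
    (rels : forall B : algType R[i], B -> B -> B -> Prop) (A : algType R[i])
    (E F L : A) (a b c : R[i]) (i j : nat) :
  (forall (B C : algType R[i]) (f : {lrmorphism B -> C}) (x y z : B),
     injective f -> rels C (f x) (f y) (f z) -> rels B x y z) ->
  presented rels E F L ->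
  L * E = a *: (E * L) -> L * F = b *: (F * L) ->
  E * F - F * E = c *: (L ^+ i - L ^+ j) -> forall x, monomial_span E F L x.
Proof.
move=> refl pres LE LF EF x; rewrite -[x]mulr1.
have h1 : monomial_span E F L 1.
  by have := @span_monomial _ A E F L 0 0 0; rewrite !expr0 !mul1r.
move: (1 : A) h1; move: x.
apply: (presented_ind (P := fun x => forall y, monomial_span E F L y -> monomial_span E F L (x * y)) refl pres).
- exact: span_E.
- exact: (span_F LE LF EF).
- exact: (span_L LE LF).
- by move=> y; rewrite mul1r.
- by move=> k u v hu hv y hy; rewrite mulrDl -scalerAl; apply: span_lin; [apply: hu | apply: hv].
- by move=> u v hu hv y hy; rewrite -mulrA; apply: hu; apply: hv.
Qed.

Section Relations.
Variables (R : realType) (p : nat).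

Lemma tilde_rels_inj (B C : algType R[i]) (f : {lrmorphism B -> C}) (x y z : B) :
  injective f -> tilde_rels p (f x) (f y) (f z) -> tilde_rels p x y z.
Proof.
move=> finj [[h1 h2] h3 h4 h5 h6]; split; first split.
- by apply: finj; rewrite rmorphXn h1 rmorph0.
- by apply: finj; rewrite rmorphXn h2 rmorph0.
- by apply: finj; rewrite rmorphXn h3 rmorph1.
- by apply: finj; rewrite !rmorphM /= linearZ /= -h4 /tinv rmorphXn.
- by apply: finj; rewrite !rmorphM /= linearZ /= -h5 /tinv rmorphXn.
- by apply: finj; rewrite rmorphB !rmorphM /= linearZ /= h6 rmorphB /tinv !rmorphXn.
Qed.

Lemma bar_rels_inj (B C : algType R[i]) (f : {lrmorphism B -> C}) (x y z : B) :
  injective f -> bar_rels p (f x) (f y) (f z) -> bar_rels p x y z.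
Proof.
move=> finj [[h1 h2] h3 h4 h5 h6]; split; first split.
- by apply: finj; rewrite rmorphXn h1 rmorph0.
- by apply: finj; rewrite rmorphXn h2 rmorph0.
- by apply: finj; rewrite rmorphXn h3 rmorph1.
- by apply: finj; rewrite !rmorphM /= linearZ /= -h4 /binv rmorphXn.
- by apply: finj; rewrite !rmorphM /= linearZ /= -h5 /binv rmorphXn.
- by apply: finj; rewrite rmorphB !rmorphM /= linearZ /= h6 rmorphB /binv !rmorphXn.
Qed.

End Relations.

(** * The trace on the ribbon extension *)

Section TildeU.
Variables (R : realType) (m : nat).
Local Notation p := m.+2.
Variable U : Utilde R p.
Local Notation q := (q_root R p).
Local Notation d := (q - q^-1).
Local Notation E := (tE U).
Local Notation F := (tF U).
Local Notation L := (tK U).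
Local Notation LV := (L ^+ (4 * p).-1).
Local Notation K := (L ^+ 2).
Local Notation KV := (LV ^+ 2).
Let q0 : q != 0 := q_root_neq0 R (isT : (1 < p)%N).
Let d0 : d != 0 := q_subV_neq0 R (isT : (1 < p)%N).
Let qp : q ^+ p = -1 := q_rootXp R (isT : (1 < p)%N).

Lemma tilde_relE : [/\ E ^+ p = 0 /\ F ^+ p = 0, L ^+ (4 * p) = 1,
  L * E = q *: (E * L), L * F = q^-1 *: (F * L)
  & E * F - F * E = d^-1 *: (K - KV)].
Proof.
have [[[h1 h2] h3 h4 h5 h6] _ _] := tU_presented U; split=> //.
- by rewrite scalerAl -h4 -(mulrA (L * E)) /tinv (LVL h3) mulr1.
- by rewrite scalerAl -h5 -(mulrA (L * F)) /tinv (LVL h3) mulr1.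
Qed.

Let Ep : E ^+ p = 0. Proof. by have [[]] := tilde_relE. Qed.
Let Fp : F ^+ p = 0. Proof. by have [[]] := tilde_relE. Qed.
Let Lp : L ^+ (4 * p) = 1. Proof. by have [] := tilde_relE. Qed.
Let LE : L * E = q *: (E * L). Proof. by have [] := tilde_relE. Qed.
Let LF : L * F = q^-1 *: (F * L). Proof. by have [] := tilde_relE. Qed.
Let EF : E * F - F * E = d^-1 *: (K - KV). Proof. by have [] := tilde_relE. Qed.

Lemma tilde_ind (Q : U -> Prop) : (forall u v w, Q (E ^+ u * F ^+ v * L ^+ w)) ->
  (forall k y z, Q y -> Q z -> Q (k *: y + z)) -> forall x, Q x.
Proof.
move=> Qm Ql x.
have EF' : E * F - F * E = d^-1 *: (L ^+ 2 - L ^+ ((4 * p).-1 * 2)).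
  by rewrite EF -exprM.
exact: (presented_span (@tilde_rels_inj R p) (tU_presented U) LE LF EF').
Qed.

Lemma tilde_gen (Q : U -> Prop) : Q E -> Q F -> Q L -> Q 1 ->
  (forall k y z, Q y -> Q z -> Q (k *: y + z)) ->
  (forall y z, Q y -> Q z -> Q (y * z)) -> forall x, Q x.
Proof. exact: (presented_ind (@tilde_rels_inj R p) (tU_presented U)). Qed.

Definition tilde_e : U := 2^-1 *: (1 + K ^+ p).
Local Notation e := tilde_e.

Let KpE : K ^+ p = L ^+ (2 * p). Proof. by rewrite -exprM. Qed.

Lemma tilde_Kp2 : K ^+ p * K ^+ p = 1.
Proof. by rewrite KpE -exprD -Lp; congr (_ ^+ _); lia. Qed.

Lemma tilde_KpC x : K ^+ p * x = x * K ^+ p.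
Proof.
have q2 : q ^+ (2 * p) = 1 := q2p qp.
apply: (tilde_gen (Q := fun x => K ^+ p * x = x * K ^+ p)) => //.
- by rewrite KpE (commX_scal _ LE) q2 scale1r.
- by rewrite KpE (commX_scal _ LF) exprVn q2 invr1 scale1r.
- by rewrite KpE -exprS -exprSr.
- by rewrite mul1r mulr1.
- by move=> k y z hy hz; rewrite mulrDl mulrDr hz -scalerAl -scalerAr hy.
- by move=> y z hy hz; rewrite mulrA hy -mulrA hz mulrA.
Qed.

Lemma tilde_eC x : e * x = x * e.
Proof. by rewrite /e -scalerAl -scalerAr mulrDl mulrDr tilde_KpC mul1r mulr1. Qed.

Lemma tilde_Kpe : K ^+ p * e = e.
Proof. by rewrite /e -scalerAr mulrDr mulr1 tilde_Kp2 addrC. Qed.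

Lemma tilde_ee : e * e = e.
Proof.
rewrite {1}/e -scalerAl mulrDl mul1r tilde_Kpe -mulr2n -(scaler_nat 2 e) scalerA.
by rewrite mulVf ?scale1r // pnatr_eq0.
Qed.

Local Notation H := (tU_hopf U).
Local Notation S := (antipode H).

Lemma tilde_SL : S L = LV. Proof. by have [_ _ []] := tU_hopfE U. Qed.

Lemma antipodeX (x : U) n : S (x ^+ n) = S x ^+ n.
Proof.
elim: n => [|n IH]; first by rewrite !expr0 antipode1.
by rewrite exprSr antipodeM IH exprS.
Qed.

Lemma tilde_Se : S e = e.
Proof.
rewrite /e linearZ /= linearD /= antipode1 KpE antipodeX tilde_SL -KpE.
congr (_ *: (1 + _)).
have LVp : LV ^+ (2 * p) * L ^+ (2 * p) = 1.
  elim: (2 * p)%N => [|n IH]; first by rewrite !expr0 mulr1.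
  by rewrite exprSr exprS -mulrA (mulrA LV) (LVL Lp) mul1r.
by rewrite -[LHS]mulr1 -tilde_Kp2 mulrA KpE LVp mul1r.
Qed.

Definition tilde_tr (x : U) : R[i] := tlambda U (x * KV ^+ p.+1).

Lemma tilde_tr_lin a x y : tilde_tr (a *: x + y) = a * tilde_tr x + tilde_tr y.
Proof. by rewrite /tilde_tr mulrDl -scalerAl linearP. Qed.

Lemma tilde_tr0 : tilde_tr 0 = 0.
Proof. by rewrite /tilde_tr mul0r linear0. Qed.

Lemma tilde_trZ a x : tilde_tr (a *: x) = a * tilde_tr x.
Proof. by rewrite /tilde_tr -scalerAl linearZ. Qed.

Lemma tilde_trD x y : tilde_tr (x + y) = tilde_tr x + tilde_tr y.
Proof. by rewrite /tilde_tr mulrDl linearD. Qed.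

Lemma tilde_trB x y : tilde_tr (x - y) = tilde_tr x - tilde_tr y.
Proof. by rewrite tilde_trD -scaleN1r tilde_trZ mulN1r. Qed.

Lemma L_modn n : L ^+ n = L ^+ (n %% (4 * p)).
Proof. by rewrite {1}(divn_eq n (4 * p)) exprD mulnC exprM Lp expr1n mul1r. Qed.

(** The inverse pivot is [L] to the power [-(2p + 2)], so the exponent [2p - 2] selected by the
    integral becomes a multiple of [4p]. *)
Lemma tilde_tr_mon a b c : (a < p)%N -> (b < p)%N ->
  tilde_tr (E ^+ a * F ^+ b * L ^+ c) =
  int_coef p (2 * p)%:R * [&& a == p.-1, b == p.-1 & (4 * p %| c)%N]%:R.
Proof.
move=> ap bp; rewrite /tilde_tr -!exprM -mulrA -exprD L_modn tlambdaE ?ltn_pmod //.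
congr (_ * (_ && (_ && _))%:R).
set k := (c + _)%N; have kE : (k + (2 * p + 2) = c + 4 * p * (2 * p.+1))%N by rewrite /k; lia.
have small : (2 * p - 2 < 4 * p)%N by lia.
have -> : (k %% (4 * p) == 2 * p - 2)%N = (k == 2 * p - 2 %[mod 4 * p]).
  by rewrite (modn_small small).
rewrite -(eqn_modDr (2 * p + 2)) kE.
have -> : (2 * p - 2 + (2 * p + 2) = 4 * p)%N by lia.
by rewrite modnn addnC mulnC modnMDl.
Qed.

Lemma tilde_tr_eq0 a b c : (a < p)%N -> (b < p)%N -> (a != p.-1) || (b != p.-1) ->
  tilde_tr (E ^+ a * F ^+ b * L ^+ c) = 0.
Proof.
move=> ap bp ab; rewrite tilde_tr_mon // andbA.
by move: ab; rewrite -negb_and => /negbTE ->; rewrite mulr0.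
Qed.

(** A nonzero trace forces [4p] to divide [c] and [a = b = p - 1]. Vanishing for [a != b] is stated
    as absorbing an arbitrary scalar [k], which is how commutation factors are discarded. *)
Lemma tilde_tr_weight a b c k : (a < p)%N -> (b < p)%N ->
  q ^+ c * tilde_tr (E ^+ a * F ^+ b * L ^+ c) =
  tilde_tr (E ^+ a * F ^+ b * L ^+ c) /\
  (a != b -> k * tilde_tr (E ^+ a * F ^+ b * L ^+ c) =
  tilde_tr (E ^+ a * F ^+ b * L ^+ c)).
Proof.
move=> ap bp; split.
  rewrite tilde_tr_mon //; case: andP => [[_ /andP[_ /dvdnP[j ->]]]|_]; last by rewrite !mulr0.
  have -> : (j * (4 * p) = 2 * p * (2 * j))%N by lia.
  by rewrite exprM (q2p qp) expr1n mul1r.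
move=> ab; rewrite tilde_tr_eq0 ?mulr0 // -negb_and; apply: contraNN ab.
by move=> /andP[/eqP-> /eqP->].
Qed.

Lemma E_bound a : (p <= a)%N -> E ^+ a = 0.
Proof. by move=> /subnKC <-; rewrite exprD Ep mul0r. Qed.

Lemma F_bound a : (p <= a)%N -> F ^+ a = 0.
Proof. by move=> /subnKC <-; rewrite exprD Fp mul0r. Qed.

Lemma tilde_mono_ind (Q : U -> Prop) :
  (forall u v w, (u < p)%N -> (v < p)%N -> Q (E ^+ u * F ^+ v * L ^+ w)) ->
  (forall k y z, Q y -> Q z -> Q (k *: y + z)) -> forall x, Q x.
Proof.
move=> Qm Ql; have Q0 : Q 0.
  by have := Ql (-1) _ _ (Qm 0 0 0 isT isT) (Qm 0 0 0 isT isT); rewrite scaleN1r addNr.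
apply: tilde_ind => // u v w; case: (ltnP u p) => up; last by rewrite E_bound ?mul0r.
by case: (ltnP v p) => vp; [exact: Qm | rewrite F_bound // mulr0 mul0r].
Qed.

Lemma LnF n v : L ^+ n * F ^+ v = (q ^- v) ^+ n *: (F ^+ v * L ^+ n).
Proof. by apply: commX_scal; rewrite (scal_commX v LF) exprVn. Qed.

Lemma tilde_trE y : tilde_tr (E * y) = tilde_tr (y * E).
Proof.
apply: (tilde_mono_ind (Q := fun y => tilde_tr (E * y) = tilde_tr (y * E))) => [a b c ap bp|k y1 y2 h1 h2]; last first.
  by rewrite mulrDl mulrDr -scalerAl -scalerAr !tilde_tr_lin h1 h2.
have -> : E ^+ a * F ^+ b * L ^+ c * E = q ^+ c *: (E ^+ a * (F ^+ b * E) * L ^+ c).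
  rewrite -(mulrA _ (L ^+ c)) (commX_scal c LE) -scalerAr; congr (_ *: _).
  by rewrite !mulrA.
rewrite tilde_trZ; case: b bp => [|b] bp.
  rewrite expr0 !(mul1r, mulr1) !mulrA -exprS -exprSr.
  case: (ltnP a.+1 p) => ap'; last by rewrite E_bound // !mul0r tilde_tr0 mulr0.
  by have [h _] := @tilde_tr_weight a.+1 0 c 1 ap' isT; move: h; rewrite expr0 mulr1 => ->.
rewrite [F ^+ b.+1 * E](_ : _ = E * F ^+ b.+1 - F ^+ b *
    ((q ^+ b.+1 - q ^- b.+1) / d / d *: (q ^- b *: K - q ^+ b *: KV))); last first.
  by rewrite (sl2_EFn q0 d0 (root_KKV Lp) (root_KVK Lp) (root_KF LF) EF) addrK.
have bp' : (b < p)%N by apply: ltnW.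
(* The Cartan correction has [F] to a power below [p - 1], where the trace vanishes. *)
have bne j : tilde_tr (E ^+ a * F ^+ b * L ^+ j) = 0.
  by apply: tilde_tr_eq0 => //; rewrite orbC neq_ltn -ltnS bp.
rewrite mulrBr mulrBl tilde_trB.
rewrite [X in _ * (_ - X)](_ : _ = 0) ?subr0; last first.
  move: (_ / d / d) => s.
  rewrite -!scalerAr -scalerAl tilde_trZ mulrBr mulrBr mulrBl tilde_trB.
  have zK n : tilde_tr (E ^+ a * (F ^+ b * L ^+ n) * L ^+ c) = 0.
    by rewrite (mulrA (E ^+ a)) -(mulrA _ (L ^+ n)) -exprD bne.
  by rewrite -!scalerAr -!scalerAl !tilde_trZ zK -exprM zK !mulr0 subr0 mulr0.
rewrite !mulrA -exprS -exprSr.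
case: (ltnP a.+1 p) => ap'; last by rewrite E_bound // !mul0r tilde_tr0 mulr0.
by have [h _] := @tilde_tr_weight a.+1 b.+1 c 1 ap' bp; move: h => ->.
Qed.

Lemma tilde_trF y : tilde_tr (F * y) = tilde_tr (y * F).
Proof.
apply: (tilde_mono_ind (Q := fun y => tilde_tr (F * y) = tilde_tr (y * F))) => [a b c ap bp|k y1 y2 h1 h2]; last first.
  by rewrite mulrDl mulrDr -scalerAl -scalerAr !tilde_tr_lin h1 h2.
have -> : E ^+ a * F ^+ b * L ^+ c * F = (q^-1) ^+ c *: (E ^+ a * F ^+ b.+1 * L ^+ c).
  rewrite -(mulrA _ (L ^+ c)) (commX_scal c LF) -scalerAr; congr (_ *: _).
  by rewrite [in RHS]exprSr !mulrA.
rewrite tilde_trZ.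
have key : tilde_tr (E ^+ a * F ^+ b.+1 * L ^+ c) =
    q^-1 ^+ c * tilde_tr (E ^+ a * F ^+ b.+1 * L ^+ c).
  case: (ltnP b.+1 p) => bp'; last by rewrite F_bound // mulr0 mul0r tilde_tr0 mulr0.
  have [h _] := @tilde_tr_weight a b.+1 c 1 ap bp'.
  by rewrite -{2}h mulrA -exprMn mulVf // expr1n mul1r.
rewrite -key {key}; case: a ap => [|a] ap.
  by rewrite expr0 !mul1r mulrA -exprS.
rewrite !mulrA (root_FEn q0 d0 Lp LE EF).
rewrite (mulrDl _ _ (F ^+ b)) (mulrDl _ _ (L ^+ c)) tilde_trD -(mulrA _ F) -exprS.
rewrite [X in _ + X](_ : _ = 0) ?addr0 //.
have ane j : tilde_tr (E ^+ a * F ^+ b * L ^+ j) = 0.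
  by apply: tilde_tr_eq0 => //; [exact: ltnW | rewrite neq_ltn -ltnS ap].
move: (_ / d / d) => s.
rewrite -scalerAr -!scalerAl tilde_trZ mulrBr mulrBl mulrBl tilde_trB.
have zK n : tilde_tr (E ^+ a * L ^+ n * F ^+ b * L ^+ c) = 0.
  rewrite -(mulrA (E ^+ a)) LnF -scalerAr -scalerAl tilde_trZ (mulrA (E ^+ a)).
  by rewrite -(mulrA _ (L ^+ n)) -exprD ane mulr0.
by rewrite -!scalerAr -!scalerAl !tilde_trZ zK -exprM zK !mulr0 subr0 mulr0.
Qed.

Lemma tilde_trL y : tilde_tr (L * y) = tilde_tr (y * L).
Proof.
apply: (tilde_mono_ind (Q := fun y => tilde_tr (L * y) = tilde_tr (y * L))) => [a b c ap bp|k y1 y2 h1 h2]; last first.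
  by rewrite mulrDl mulrDr -scalerAl -scalerAr !tilde_tr_lin h1 h2.
have -> : L * (E ^+ a * F ^+ b * L ^+ c) =
    (q ^+ a * q^-1 ^+ b) *: (E ^+ a * F ^+ b * L ^+ c.+1).
  rewrite !mulrA (scal_commX a LE) -!scalerAl -(mulrA _ L (F ^+ b)) (scal_commX b LF).
  by rewrite -scalerAr -!scalerAl scalerA mulrA -(mulrA _ L) -exprS.
rewrite -(mulrA _ (L ^+ c)) -exprSr tilde_trZ.
have [_ h] := @tilde_tr_weight a b c.+1 (q ^+ a * q^-1 ^+ b) ap bp.
case: (eqVneq a b) h => [-> _|ab]; last by apply.
by rewrite -exprMn mulfV // expr1n mul1r.
Qed.

(** The elements that commute with everything under the trace form a subalgebra, so the generators
    suffice. *)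
Lemma tilde_trC x y : tilde_tr (x * y) = tilde_tr (y * x).
Proof.
move: x y; apply: (tilde_gen (Q := fun x => forall y, tilde_tr (x * y) = tilde_tr (y * x))).
- exact: tilde_trE.
- exact: tilde_trF.
- exact: tilde_trL.
- by move=> y; rewrite mul1r mulr1.
- by move=> k x y hx hy z; rewrite mulrDl mulrDr -scalerAl -scalerAr !tilde_tr_lin hx hy.
- by move=> x y hx hy z; rewrite -mulrA hx -mulrA hy mulrA.
Qed.

Definition tilde_tau (x : U) : R[i] := tilde_tr (x * e).

Lemma tilde_tau_lin a x y :
  tilde_tau (a *: x + y) = a * tilde_tau x + tilde_tau y.
Proof. by rewrite /tilde_tau mulrDl -scalerAl tilde_tr_lin. Qed.

Lemma tilde_tauC x y : tilde_tau (x * y) = tilde_tau (y * x).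
Proof. by rewrite /tilde_tau -mulrA tilde_trC -!mulrA tilde_eC. Qed.

Lemma tilde_tau_e x : tilde_tau (x * e) = tilde_tau x.
Proof. by rewrite /tilde_tau -mulrA tilde_ee. Qed.

Lemma tilde_tauE (x : U) : tlambda U (x * tU_idem U 0 * tU_pivV U) = tilde_tau x.
Proof. by rewrite /tU_idem eqxx /tU_pivV /tinv. Qed.

End TildeU.

Section TensorMod.
Variables (R : realType) (A : algType R[i]).

Lemma tensor_eq_lmodP (V : lmodType R[i]) (s t : seq (A * A)) (f : A -> A -> V) :
  tensor_eq s t -> (forall z, linear (f ^~ z)) -> (forall z, linear (f z)) ->
  \sum_(u <- s) f u.1 u.2 = \sum_(u <- t) f u.1 u.2.
Proof.
move=> st fl fr.
have fb : bilinear_for (GRing.Scale.Law.clone _ _ *:%R _)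
   (GRing.Scale.Law.clone _ _ *:%R _) f by [].
pose B := bilinear_isBilinear.Build _ _ _ _ _ _ _ fb.
pose G : {bilinear A -> A -> V} := HB.pack f B.
exact: (st _ G).
Qed.

Lemma grouplike_mul (H : hopf_structure A) (x y : A) :
  tensor_eq (comul H x) [:: (x, x)] -> tensor_eq (comul H y) [:: (y, y)] ->
  tensor_eq (comul H (x * y)) [:: (x * y, x * y)].
Proof.
move=> hx hy V f; rewrite (comulM H x y) big_allpairs_dep /=.
have fl z a u v : f (a *: u + v) z = a *: f u z + f v z by rewrite linearPl.
have fr z a u v : f z (a *: u + v) = a *: f z u + f z v by rewrite linearPr.
transitivity (\sum_(u <- comul H x) f (u.1 * y) (u.2 * y)).
  apply: eq_bigr => u _.
  rewrite (@tensor_eq_lmodP _ _ _ (fun v w => f (u.1 * v) (u.2 * w)) hy) ?big_seq1 //.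
    by move=> z a v w; rewrite mulrDr -scalerAr fl.
  by move=> z a v w; rewrite mulrDr -scalerAr fr.
rewrite (@tensor_eq_lmodP _ _ _ (fun v w => f (v * y) (w * y)) hx) ?big_seq1 //.
  by move=> z a v w; rewrite mulrDl -scalerAl fl.
by move=> z a v w; rewrite mulrDl -scalerAl fr.
Qed.

Lemma grouplikeX (H : hopf_structure A) (x : A) n :
  tensor_eq (comul H x) [:: (x, x)] ->
  tensor_eq (comul H (x ^+ n)) [:: (x ^+ n, x ^+ n)].
Proof.
move=> hx; elim: n => [|n IH]; first by rewrite !expr0; exact: comul1.
by rewrite !exprS; apply: grouplike_mul.
Qed.

End TensorMod.

(** * Comparison with the small quantum group *)

Section SmallQuantumGroup.
Variables (R : realType) (m : nat).
Local Notation p := m.+2.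
Variables (U : Utilde R p) (B : Ubar R p).
Local Notation q := (q_root R p).
Local Notation d := (q - q^-1).
Local Notation E := (tE U).
Local Notation F := (tF U).
Local Notation L := (tK U).
Local Notation LV := (L ^+ (4 * p).-1).
Local Notation K := (L ^+ 2).
Local Notation KV := (LV ^+ 2).
Local Notation e := (tilde_e U).
Local Notation bE := (bE B).
Local Notation bF := (bF B).
Local Notation bK := (bK B).
Local Notation bKV := (bK ^+ p.-1).
Local Notation H := (tU_hopf U).
Local Notation HB := (bU_hopf B).
Local Notation S := (antipode H).
Let q0 : q != 0 := q_root_neq0 R (isT : (1 < p)%N).
Let Ep : E ^+ p = 0. Proof. by have [[]] := tilde_relE U. Qed.
Let Fp : F ^+ p = 0. Proof. by have [[]] := tilde_relE U. Qed.
Let Lp : L ^+ (4 * p) = 1. Proof. by have [] := tilde_relE U. Qed.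
Let LE : L * E = q *: (E * L). Proof. by have [] := tilde_relE U. Qed.
Let LF : L * F = q^-1 *: (F * L). Proof. by have [] := tilde_relE U. Qed.
Let EF : E * F - F * E = d^-1 *: (K - KV). Proof. by have [] := tilde_relE U. Qed.

Lemma tilde_hopfE :
  [/\ [/\ tensor_eq (comul H E) [:: (E, K); (1, E)],
          tensor_eq (comul H F) [:: (F, 1); (KV, F)],
          tensor_eq (comul H L) [:: (L, L)]
        & tensor_eq (comul H K) [:: (K, K)]],
      [/\ counit H E = 0, counit H F = 0, counit H L = 1 & counit H K = 1]
    & [/\ S E = - (E * KV), S F = - (K * F), S L = LV & S K = KV]].
Proof.
have [[h1 h2 h3] [h4 h5 h6] [h7 h8 h9]] := tU_hopfE U.
split; split=> //; first exact: grouplikeX.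
  by rewrite rmorphXn /= h6 expr1n.
by rewrite antipodeX h9.
Qed.

Lemma bar_relE : [/\ bE ^+ p = 0 /\ bF ^+ p = 0, bK ^+ p = 1,
  bK * bE = q ^+ 2 *: (bE * bK), bK * bF = q ^- 2 *: (bF * bK)
  & bE * bF - bF * bE = d^-1 *: (bK - bKV)].
Proof.
have [[[h1 h2] h3 h4 h5 h6] _ _] := bU_presented B; split=> //.
- by rewrite scalerAl -h4 -(mulrA (bK * bE)) /binv -exprSr h3 mulr1.
- by rewrite scalerAl -h5 -(mulrA (bK * bF)) /binv -exprSr h3 mulr1.
Qed.

Lemma bar_gen (Q : B -> Prop) : Q bE -> Q bF -> Q bK -> Q 1 ->
  (forall k y z, Q y -> Q z -> Q (k *: y + z)) ->
  (forall y z, Q y -> Q z -> Q (y * z)) -> forall x, Q x.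
Proof. exact: (presented_ind (@bar_rels_inj R p) (bU_presented B)). Qed.

Lemma bar_ind (Q : B -> Prop) : (forall u v w, (u < p)%N -> (v < p)%N -> (w < p)%N ->
    Q (bE ^+ u * bF ^+ v * bK ^+ w)) ->
  (forall k y z, Q y -> Q z -> Q (k *: y + z)) -> forall x, Q x.
Proof.
move=> Qm Ql x; have [[Ep' Fp'] Kp' KE' KF' EF'] := bar_relE.
have Q0 : Q 0.
  have h := Qm 0%N 0%N 0%N isT isT isT.
  by have := Ql (-1) _ _ h h; rewrite scaleN1r addNr.
have EF1 : bE * bF - bF * bE = d^-1 *: (bK ^+ 1 - bK ^+ p.-1) by rewrite expr1.
apply: (presented_span (@bar_rels_inj R p) (bU_presented B) KE' KF' EF1) => // u v w.
case: (ltnP u p) => [up|/subnKC <-]; last by rewrite exprD Ep' !mul0r.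
case: (ltnP v p) => [vp|/subnKC <-]; last by rewrite (exprD bF) Fp' mul0r mulr0 mul0r.
rewrite (divn_eq w p) exprD mulnC exprM Kp' expr1n mul1r.
by apply: Qm => //; apply: ltn_pmod.
Qed.

Let Kpe : K ^+ p * e = e := tilde_Kpe U.
Let eC (x : U) : e * x = x * e := tilde_eC x.
Let ee : e * e = e := tilde_ee U.

Lemma KVe : KV * e = K ^+ p.-1 * e.
Proof.
by rewrite -[in LHS]Kpe mulrA (exprS K m.+1) (mulrA KV) (root_KVK Lp) mul1r.
Qed.

(** A unital morphism needs an image of [bK] whose [p]-th power is 1 rather than [e], hence the
    summand [1 - e]; [K * e] and [1 - e] multiply blockwise, and [K ^+ p * e = e]. *)
Lemma bar_rels_tilde : bar_rels p (E * e) (F * e) (K * e + (1 - e)).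
Proof.
have e1 : e * (1 - e) = 0 by rewrite mulrBr mulr1 ee subrr.
have powe (x : U) n : (x * e) ^+ n.+1 = x ^+ n.+1 * e.
  elim: n => [|n IH]; first by rewrite !expr1.
  by rewrite exprSr IH -(mulrA (x ^+ n.+1)) eC -(mulrA x) ee mulrA -exprSr.
have e2 : (1 - e) * e = 0 by rewrite mulrBl mul1r ee subrr.
have e3 : (1 - e) * (1 - e) = 1 - e by rewrite mulrBr mulr1 e2 subr0.
have cross (x y : U) : (x * e + (1 - e)) * (y * e + (1 - e)) = x * y * e + (1 - e).
  move: (1 - e) e1 e2 e3 => f ef fe ff.
  rewrite mulrDr !mulrDl ff -(mulrA x) -(mulrA x) ef mulr0 add0r.
  by rewrite -eC (mulrA f) fe mul0r addr0 (mulrA e) ee eC mulrA.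
have bk n : (K * e + (1 - e)) ^+ n.+1 = K ^+ n.+1 * e + (1 - e).
  by elim: n => [|n IH]; rewrite ?expr1 // exprSr IH cross -exprSr.
have bke (y : U) n : (K * e + (1 - e)) ^+ n.+1 * (y * e) = K ^+ n.+1 * y * e.
  rewrite bk mulrDl (_ : (1 - e) * (y * e) = 0) ?addr0; last first.
    by rewrite -eC mulrA e2 mul0r.
  by rewrite -(mulrA (K ^+ n.+1)) eC -(mulrA y) ee mulrA.
have ebk (y : U) n : y * e * (K * e + (1 - e)) ^+ n.+1 = y * K ^+ n.+1 * e.
  by rewrite bk mulrDr -(mulrA y) -(mulrA y) e1 mulr0 addr0 eC -(mulrA (K ^+ n.+1)) ee mulrA.
split; first split.
- by rewrite powe Ep mul0r.
- by rewrite powe Fp mul0r.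
- by rewrite bk Kpe addrC subrK.
- have := bke E 0; rewrite !expr1 => ->.
  by rewrite /binv ebk (root_KE LE) -!scalerAl -(mulrA E) -exprS -(mulrA E) Kpe.
- have := bke F 0; rewrite !expr1 => ->.
  by rewrite /binv ebk (root_KF LF) -!scalerAl -(mulrA F) -exprS -(mulrA F) Kpe.
rewrite /binv bk opprD addrACA subrr addr0 -KVe -mulrBl scalerAl -EF mulrBl.
by rewrite -(mulrA E) -(mulrA F) eC (eC (E * e)) -(mulrA F) -(mulrA E) ee !mulrA.
Qed.

Section Psi.
Variable psi : {lrmorphism B -> U}.
Hypothesis psiE : psi bE = E * e.
Hypothesis psiF : psi bF = F * e.
Hypothesis psiK : psi bK = K * e + (1 - e).

Lemma mod_mul (a a' b b' : U) : a * e = a' * e -> b * e = b' * e ->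
  a * b * e = a' * b' * e.
Proof. by move=> ha hb; rewrite -mulrA hb -(eC b') mulrA ha -mulrA eC mulrA. Qed.

Lemma mod_exp (a a' : U) n : a * e = a' * e -> a ^+ n * e = a' ^+ n * e.
Proof.
by move=> h; elim: n => [|n IH] //; rewrite !exprS; apply: mod_mul.
Qed.

Lemma psiEe : psi bE * e = E * e. Proof. by rewrite psiE -mulrA ee. Qed.
Lemma psiFe : psi bF * e = F * e. Proof. by rewrite psiF -mulrA ee. Qed.
Lemma psiKe : psi bK * e = K * e.
Proof. by rewrite psiK mulrDl -mulrA ee mulrBl mul1r ee subrr addr0. Qed.
Lemma psiKVe : psi (binv p bK) * e = KV * e.
Proof. by rewrite /binv rmorphXn /= (mod_exp _ psiKe) KVe. Qed.

(** Since it fixes [e], the antipode respects congruence modulo [e], and the generators are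
    enough. *)
Lemma psiS b : psi (antipode HB b) * e = S (psi b) * e.
Proof.
have [_ _ [hE hF hK]] := bU_hopfE B; have [_ _ [sE sF _ sK]] := tilde_hopfE.
have Se : S e = e := tilde_Se U.
have S0 (x : U) : x * e = 0 -> S x * e = 0.
  by move=> h; rewrite -Se -antipodeM eC h linear0.
have Smod (x y : U) : x * e = y * e -> S x * e = S y * e.
  move=> h; apply/eqP; rewrite -subr_eq0 -mulrBl -linearB /=.
  by rewrite S0 // mulrBl h subrr.
apply: (bar_gen (Q := fun b => psi (antipode HB b) * e = S (psi b) * e)).
- rewrite hE (Smod _ _ psiEe) sE linearN rmorphM /= !mulNr; congr (- _).
  exact: mod_mul psiEe psiKVe.
- rewrite hF (Smod _ _ psiFe) sF linearN rmorphM /= !mulNr; congr (- _).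
  exact: mod_mul psiKe psiFe.
- by rewrite hK (Smod _ _ psiKe) sK psiKVe.
- by rewrite antipode1 !rmorph1 antipode1.
- by move=> k y z hy hz; rewrite !linearP /= !mulrDl -!scalerAl hy hz.
- move=> y z hy hz; rewrite !(antipodeM, rmorphM) /=.
  exact: mod_mul.
Qed.

Lemma sqrtC_half : (Num.sqrt (2 * p)%:R)%:C = (Num.sqrt (p%:R / 2))%:C * 2 :> R[i].
Proof.
rewrite (_ : (2 * p)%:R = 2 ^+ 2 * (p%:R / 2) :> R); last by rewrite natrM; field.
rewrite sqrtrM ?sqr_ge0 // sqrtr_sqr ger0_norm // mulrC rmorphM /=.
by rewrite (_ : 2%:C = 2 :> R[i]) // -[RHS](rmorph_nat (real_complex R)).
Qed.

Lemma int_coef_half : int_coef p (2 * p)%:R = int_coef p (p%:R / 2) * 2 :> R[i].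
Proof.
rewrite /int_coef sqrtC_half.
move: (Num.sqrt _)%:C (qfact _ _ _) (_ * _)^-1 => u v w; ring.
Qed.

(** The two halves of [e] give the exponents [2c] and [2c + 2p], both below [4p], so only [c = 0] in
    the first one contributes. The factor [1/2] is made up for by [sqrt (2p) = 2 sqrt (p/2)]. *)
Lemma bar_tauE x : blambda B (x * binv p bK) = tilde_tau (psi x).
Proof.
apply: (bar_ind (Q := fun x => blambda B (x * binv p bK) = tilde_tau (psi x))) => [a b c ap bp cp|k y z hy hz]; last first.
  by rewrite mulrDl -scalerAl linearP hy hz linearP tilde_tau_lin.
have [_ Kp' _ _ _] := bar_relE.
have -> : tilde_tau (psi (bE ^+ a * bF ^+ b * bK ^+ c)) =
    2^-1 * (tilde_tr (E ^+ a * F ^+ b * L ^+ (2 * c)) +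
            tilde_tr (E ^+ a * F ^+ b * L ^+ (2 * c + 2 * p))).
  rewrite -tilde_tau_e !rmorphM !rmorphXn /=.
  rewrite (mod_mul (mod_mul (mod_exp a psiEe) (mod_exp b psiFe)) (mod_exp c psiKe)).
  rewrite tilde_tau_e /tilde_tau /e -scalerAr tilde_trZ mulrDr mulr1 tilde_trD.
  by rewrite -!exprM -(mulrA (E ^+ a * F ^+ b)) -exprD.
have -> : blambda B (bE ^+ a * bF ^+ b * bK ^+ c * binv p bK) =
    int_coef p (p%:R / 2) * [&& a == p.-1, b == p.-1 & c == 0%N]%:R.
  rewrite -(mulrA _ (bK ^+ c)) /binv -exprD.
  case: c cp => [|c] cp; first by rewrite add0n blambdaE // !eqxx.
  rewrite addSnnS exprD Kp' mulr1 blambdaE ?(ltnW cp) //=.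
  by rewrite (ltn_eqF (_ : (c < m.+1)%N)).
rewrite !tilde_tr_mon // int_coef_half.
have -> : (4 * p %| 2 * c)%N = (c == 0%N).
  case: c cp => [|c] cp; first by rewrite muln0 dvdn0.
  by apply: gtnNdvd => //; lia.
have -> : (4 * p %| 2 * c + 2 * p)%N = false by apply: gtnNdvd; lia.
rewrite !andbF mulr0 addr0; move: (int_coef _ _) [&& _, _ & _] => u v.
by field.
Qed.

Lemma sum_even (V : lmodType R[i]) (N : nat) (f : nat -> V) :
  \sum_(0 <= i < 2 * N) (1 + (-1) ^+ i) *: f i = \sum_(0 <= i < N) 2 *: f (2 * i)%N.
Proof.
elim: N => [|N IH]; first by rewrite !big_nil.
rewrite mulnS addnC addn2 !big_nat_recr //= IH -addrA; congr (_ + _).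
have -> : (-1) ^+ (2 * N) = 1 :> R[i] by rewrite exprM sqrrN !expr1n.
by rewrite exprS exprM sqrrN !expr1n mulr1 subrr scale0r addr0.
Qed.

Lemma sum_double (V : nmodType) (N : nat) (f : nat -> V) :
  \sum_(0 <= i < 2 * N) f i = \sum_(0 <= i < N) (f i + f (i + N)%N).
Proof.
rewrite mul2n -addnn (big_cat_nat _ (leq_addr N N)) //= big_split /=; congr (_ + _).
by rewrite -{1}[N]add0n big_addn addnK.
Qed.

Lemma cartan_sum_half (x : R[i]) (h : nat -> nat -> R[i]) :
  x ^+ (2 * p) = -1 ->
  (forall a b, h (a + 2 * p)%N b = h a b) -> (forall a b, h a (b + 2 * p)%N = h a b) ->
  \sum_(0 <= a < 4 * p) \sum_(0 <= b < 4 * p) x ^+ (a * b) * h a b =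
  4 * \sum_(0 <= a < p) \sum_(0 <= b < p) x ^+ (4 * a * b) * h (2 * a)%N (2 * b)%N.
Proof.
move=> xp ha hb; have sumE N (f : nat -> R[i]) : \sum_(0 <= i < 2 * N) (1 + (-1) ^+ i) * f i =
    \sum_(0 <= i < N) 2 * f (2 * i)%N := @sum_even R[i]^o N f.
have e4 : (4 * p = 2 * (2 * p))%N by lia.
transitivity (\sum_(0 <= a < 2 * (2 * p)) (1 + (-1) ^+ a) *
    \sum_(0 <= b < 2 * p) x ^+ (a * b) * h a b).
  rewrite e4; apply: eq_bigr => a _; rewrite sum_double mulr_sumr.
  apply: eq_bigr => b _; rewrite hb mulnDr exprD (mulnC a (2 * p)%N) (exprM x (2 * p)) xp.
  by move: (_ ^+ (a * b)) (_ ^+ a) (h a b) => u v w; ring.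
rewrite sumE sum_double.
transitivity (\sum_(0 <= a < p) 2 * \sum_(0 <= b < 2 * p)
   (1 + (-1) ^+ b) * (x ^+ (2 * a * b) * h (2 * a)%N b)).
  apply: eq_bigr => a _; rewrite -mulrDr -big_split /=; congr (_ * _).
  apply: eq_bigr => b _; rewrite mulnDr ha mulnDl exprD (exprM x (2 * p)) xp.
  by move: (_ ^+ _) (_ ^+ b) (h _ b) => u v w; ring.
rewrite mulr_sumr; apply: eq_bigr => a _; rewrite sumE.
rewrite !mulr_sumr; apply: eq_bigr => b _.
have -> : (4 * a * b = 2 * a * (2 * b))%N by lia.
by move: (_ ^+ _) (h _ _) => u w; ring.
Qed.

Lemma rmatrix_sum (A : algType R[i]) (X Y Z : A) N (ka : nat -> nat -> R[i])
    (G : A -> A -> R[i]) :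
  \sum_(r <- rmatrix p [seq (ka a b, (X ^+ a, X ^+ b)) | a <- iota 0 N, b <- iota 0 N] Y Z)
     r.1 * G r.2.1 r.2.2 =
  \sum_(0 <= a < N) \sum_(0 <= b < N) ka a b *
     \sum_(0 <= n < p) (qbrace R p 1 ^+ n / qfact R p n * q ^+ (n * n.-1)./2) *
       G (X ^+ a * Y ^+ n) (X ^+ b * Z ^+ n).
Proof.
rewrite /rmatrix big_allpairs_dep /= big_allpairs_dep /= /index_iota !subn0.
apply: eq_bigr => a _; apply: eq_bigr => b _; rewrite mulr_sumr.
by apply: eq_bigr => n _; rewrite [RHS]mulrA.
Qed.

(** Modulo [e] the powers of [L] have period [2p], so [cartan_sum_half] applies; [4 / (4p) = 1/p]
    and [t^4 = q^2] then give the coefficients of the small R-matrix. *)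
Lemma rmat_psi (G : U -> U -> R[i]) :
  (forall a b, G (a * e) b = G a b) -> (forall a b, G a (b * e) = G a b) ->
  \sum_(r <- tU_rmat U) r.1 * G r.2.1 r.2.2 =
  \sum_(r <- bU_rmat B) r.1 * G (psi r.2.1) (psi r.2.2).
Proof.
move=> Gl Gr; pose x : R[i] := (t_root R p)^-1.
have x2p : x ^+ (2 * p) = -1 by rewrite /x exprVn t_rootX2p // invrN invr1.
have Gmod a a' b b' : a * e = a' * e -> b * e = b' * e -> G a b = G a' b'.
  by move=> ha hb; rewrite -Gl -Gr ha hb Gl Gr.
pose h a b := \sum_(0 <= n < p) (qbrace R p 1 ^+ n / qfact R p n * q ^+ (n * n.-1)./2) *
       G (L ^+ a * E ^+ n) (L ^+ b * F ^+ n).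
have Lper a (y : U) : L ^+ (a + 2 * p) * y * e = L ^+ a * y * e.
  rewrite exprD exprM -!(mulrA (L ^+ a)); congr (_ * _).
  by rewrite -mulrA -eC mulrA Kpe eC.
rewrite /tU_rmat (rmatrix_sum _ _ _ _ (fun a b => (4 * p)%:R^-1 * t_root R p ^- (a * b))).
transitivity (\sum_(0 <= a < 4 * p) \sum_(0 <= b < 4 * p)
    (4 * p)%:R^-1 * (x ^+ (a * b) * h a b)).
  by apply: eq_bigr => a _; apply: eq_bigr => b _; rewrite mulrA /x exprVn.
rewrite (_ : \sum_(_ <= _ < _) _ = (4 * p)%:R^-1 *
    \sum_(0 <= a < 4 * p) \sum_(0 <= b < 4 * p) x ^+ (a * b) * h a b); last first.
  by rewrite mulr_sumr; apply: eq_bigr => a _; rewrite mulr_sumr.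
rewrite cartan_sum_half //; last 2 first.
- by move=> a b; apply: eq_bigr => n _; rewrite (Gmod _ _ _ _ (Lper a _) (erefl _)).
- by move=> a b; apply: eq_bigr => n _; rewrite (Gmod _ _ _ _ (erefl _) (Lper b _)).
rewrite /bU_rmat.
have := rmatrix_sum bK bE bF p (fun a b => p%:R^-1 * q ^- (2 * a * b)) (fun y z => G (psi y) (psi z)).
move=> /= ->; rewrite mulrA !mulr_sumr; apply: eq_bigr => a _.
rewrite mulr_sumr; apply: eq_bigr => b _; rewrite mulrA; congr (_ * _).
  congr (_ * _).
    by rewrite natrM invfM mulrAC mulVf ?mul1r // pnatr_eq0.
  rewrite /x exprVn -(t_root2 R (isT : (1 < p)%N)) -exprM.
  by congr (_ ^- _); lia.
apply: eq_bigr => n _; congr (_ * _); apply: Gmod; rewrite rmorphM !rmorphXn /= exprM.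
  by apply: mod_mul; apply/esym; [apply: mod_exp psiKe | apply: mod_exp psiEe].
by apply: mod_mul; apply/esym; [apply: mod_exp psiKe | apply: mod_exp psiFe].
Qed.

Let q2 : q ^+ p = -1 := q_rootXp R (isT : (1 < p)%N).

Lemma coint_coef_half : coint_coef p (p%:R / 2) = coint_coef p (2 * p)%:R * 2 :> R[i].
Proof.
rewrite /coint_coef sqrtC_half.
move: (Num.sqrt _)%:C (qfact _ _ _) ((0 +i* 1) ^+ _ * _) => u v w.
by rewrite !invfM; move: (u^-1) (v^-1) => u' v'; field.
Qed.

(* Twice the even powers of the generator in [top 0] are [top 0 + top p], as
   [q ^+ p = -1]; [coint_odd] below collects the odd ones. *)
Definition coint_even : U :=
  (2^-1 * coint_coef p (2 * p)%:R) *: (top q m E F L 0 + top q m E F L p).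

(** The even powers of [L] are the [K ^+ a] with [a < 2p], and modulo [e] each power of [K] occurs
    twice among them; this matches the ratio 2 of the normalizations. *)
Lemma psi_coint : psi (bU_coint B) * e = coint_even * e.
Proof.
rewrite /coint_even /top /weight_proj -mulrDr -big_split /= -(big_mkord xpredT (fun a =>
  (q ^- 0) ^+ a *: L ^+ a + (q ^- p) ^+ a *: L ^+ a)).
rewrite (eq_bigr (fun a => (1 + (-1) ^+ a) *: L ^+ a)); last first.
  by move=> a _; rewrite q2 expr0 invrN invr1 expr1n scalerDl.
rewrite (_ : (4 * p = 2 * (2 * p))%N); last by lia.
rewrite sum_even sum_double -scalerAl -(mulrA (E ^+ m.+1 * F ^+ m.+1)) mulr_suml.
have Kper a : (2 *: L ^+ (2 * a) + 2 *: L ^+ (2 * (a + p))) * e = 4 *: (K ^+ a * e).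
  rewrite mulrDl -!scalerAl !exprM exprD -mulrA Kpe -scalerDl; congr (_ *: _).
  by rewrite -natrD.
rewrite (eq_bigr (fun a => 4 *: (K ^+ a * e))) => [|a _]; last exact: Kper.
rewrite -scaler_sumr -(scalerAr 4 (E ^+ m.+1 * F ^+ m.+1)) scalerA /bU_coint linearZ /= -scalerAl coint_coef_half.
have -> : 2^-1 * coint_coef p (2 * p)%:R * 4 = coint_coef p (2 * p)%:R * 2 :> R[i].
  by move: (coint_coef _ _) => u; field.
congr (_ *: _); rewrite linear_sum /= mulr_suml mulr_sumr big_mkord.
apply: eq_bigr => a _; rewrite !rmorphM !rmorphXn /=.
rewrite (mod_mul (mod_mul (mod_exp _ psiEe) (mod_exp _ psiFe)) (mod_exp a psiKe)).
by rewrite mulrA.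
Qed.

Lemma psi_piv : psi bK * e = tU_piv U * e.
Proof. by rewrite psiKe /tU_piv (exprS K) -mulrA Kpe. Qed.

Lemma psi_pivV : psi (binv p bK) * e = tU_pivV U * e.
Proof.
rewrite psiKVe /tU_pivV /tinv (exprS KV) -mulrA (_ : KV ^+ p * e = e) //.
by rewrite -[X in _ * X]Kpe mulrA -exprMn_comm ?(root_KVK Lp) ?expr1n ?mul1r //
  /GRing.comm (root_KVK Lp) (root_KKV Lp).
Qed.

Lemma psi_cross i s (G : U -> U -> R[i]) :
  (forall a b, G (a * e) b = G a b) -> (forall a b, G a (b * e) = G a b) ->
  \sum_(t <- piece_beads (tU_data U) (Cross i s))
     t.1 * G (head 1 t.2) (head 1 (behead t.2)) =
  \sum_(t <- piece_beads (bU_data B) (Cross i s))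
     t.1 * G (psi (head 1 t.2)) (psi (head 1 (behead t.2))).
Proof.
move=> Gl Gr; rewrite /piece_beads !big_map; case: s; first exact: rmat_psi.
rewrite /= (rmat_psi (G := fun x y => G (S x) y)) // => [|a b].
  by apply: eq_bigr => r _; rewrite -[in RHS]Gl psiS Gl.
by rewrite antipodeM (tilde_Se U) eC Gl.
Qed.

Definition even_beads (pc : piece) : seq (R[i] * seq U) :=
  if pc is Dotted _ l then iter_comul H l coint_even
  else piece_beads (tU_data U) pc.

Lemma evaluate_bar w fr n va : wf_front fr n ->
  evaluate HB (fun x => blambda B (x * binv p bK)) (piece_beads (bU_data B)) w fr n va =
  evaluate H (@tilde_tau R m U) even_beads w fr n (fun l => psi (va l)).
Proof.
have [[coE coF coL coK] [cE cF cL cK] _] := tilde_hopfE.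
have [[cobE cobF cobK] [cbE cbF cbK] _] := bU_hopfE B.
have coKp : tensor_eq (comul H (K ^+ p)) [:: (K ^+ p, K ^+ p)] by exact: grouplikeX.
have cKp : counit H (K ^+ p) = 1 by rewrite rmorphXn /= cK expr1n.
have eE : e = 2^-1 *: (1 + K ^+ p) by [].
apply: (evaluate_psi (e := e) eC ee (tilde_Se U) (@tilde_tau_lin R m U)
  (@tilde_tau_e R m U) psiS bar_tauE (g := tU_piv U) (gV := tU_pivV U)
  (La := coint_even) (bg := bK) (bgV := binv p bK) (bLa := bU_coint B)) => //.
- exact: psi_pivV.
- exact: psi_piv.
- by move=> i s G _; exact: psi_cross.
move=> fr' f G va' sub uf GM.
rewrite (act_psi eC (tilde_Se U) coKp cKp Kpe eE psiEe psiFe psiKe psiKVe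
  coE coF coK cobE cobF cobK cE cF cK cbE cbF cbK bar_gen _ _ sub uf GM).
exact: (act_mod_e eC (tilde_Se U) coKp cKp Kpe eE _ psi_coint sub uf GM).
Qed.
End Psi.
End SmallQuantumGroup.

(** * Symmetry of the beads *)

Lemma sum_shift (V : nmodType) (N : nat) (f : nat -> V) :
  (forall a, f (a + N)%N = f a) ->
  \sum_(0 <= a < N) f (a + 2)%N = \sum_(0 <= a < N) f a.
Proof.
have shift1 (g : nat -> V) : (forall a, g (a + N)%N = g a) ->
    \sum_(0 <= a < N) g a.+1 = \sum_(0 <= a < N) g a.
  case: N => [|N] gN; first by rewrite !big_nil.
  by rewrite big_nat_recr //= [RHS]big_nat_recl //= addrC -(gN 0%N).
move=> fN; rewrite -(shift1 f) // -(shift1 (fun a => f a.+1)) => [|a]; last by rewrite -addSn fN.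
by apply: eq_bigr => a _; rewrite addn2.
Qed.

Section Symmetry.
Variables (R : realType) (m : nat).
Local Notation p := m.+2.
Variable U : Utilde R p.
Local Notation q := (q_root R p).
Local Notation t := (t_root R p).
Local Notation d := (q - q^-1).
Local Notation E := (tE U).
Local Notation F := (tF U).
Local Notation L := (tK U).
Local Notation LV := (L ^+ (4 * p).-1).
Local Notation K := (L ^+ 2).
Local Notation KV := (LV ^+ 2).
Local Notation H := (tU_hopf U).
Local Notation S := (antipode H).
Let q0 : q != 0 := q_root_neq0 R (isT : (1 < p)%N).
Let d0 : d != 0 := q_subV_neq0 R (isT : (1 < p)%N).
Let qp : q ^+ p = -1 := q_rootXp R (isT : (1 < p)%N).
Let Ep : E ^+ p = 0. Proof. by have [[]] := tilde_relE U. Qed.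
Let Fp : F ^+ p = 0. Proof. by have [[]] := tilde_relE U. Qed.
Let Lp : L ^+ (4 * p) = 1. Proof. by have [] := tilde_relE U. Qed.
Let LE : L * E = q *: (E * L). Proof. by have [] := tilde_relE U. Qed.
Let LF : L * F = q^-1 *: (F * L). Proof. by have [] := tilde_relE U. Qed.
Let EF : E * F - F * E = d^-1 *: (K - KV). Proof. by have [] := tilde_relE U. Qed.
Let KKV : K * KV = 1 := root_KKV Lp.
Let KVK : KV * K = 1 := root_KVK Lp.
Let KE : K * E = q ^+ 2 *: (E * K) := root_KE LE.
Let KF : K * F = q ^- 2 *: (F * K) := root_KF LF.

Definition cartan_coef (a b : nat) : R[i] := (4 * p)%:R^-1 * t ^- (a * b).
Definition cartan_sum (h : nat -> nat -> R[i]) : R[i] :=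
  \sum_(0 <= a < 4 * p) \sum_(0 <= b < 4 * p) cartan_coef a b * h a b.
Definition theta (n : nat) : R[i] :=
  qbrace R p 1 ^+ n / qfact R p n * q ^+ (n * n.-1)./2.

Lemma t4p : t ^+ (4 * p) = 1.
Proof.
rewrite (_ : (4 * p = 2 * p * 2)%N); last by lia.
by rewrite exprM t_rootX2p // sqrrN expr1n.
Qed.

Lemma cartan_coefC a b : cartan_coef a b = cartan_coef b a.
Proof. by rewrite /cartan_coef (mulnC a). Qed.

Lemma cartan_coefD2 a b : cartan_coef (a + 2) b = q ^- b * cartan_coef a b.
Proof.
rewrite /cartan_coef mulnDl exprD (exprM t 2 b) t_root2 // invfM.
by move: (4 * p)%:R^-1 (t ^- _) (q ^- _) => u v w; ring.
Qed.

Lemma cartan_coef_period a b : cartan_coef (a + 4 * p) b = cartan_coef a b.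
Proof. by rewrite /cartan_coef mulnDl exprD (exprM t (4 * p)) t4p expr1n mulr1. Qed.

Lemma cartan_sumC h : cartan_sum h = cartan_sum (fun a b => h b a).
Proof.
rewrite /cartan_sum exchange_big; apply: eq_bigr => a _; apply: eq_bigr => b _.
by rewrite cartan_coefC.
Qed.

Lemma eq_cartan_sum h h' : (forall a b, h a b = h' a b) -> cartan_sum h = cartan_sum h'.
Proof. by move=> hh; apply: eq_bigr => a _; apply: eq_bigr => b _; rewrite hh. Qed.

Lemma cartan_sum_lin k h h' :
  cartan_sum (fun a b => k * h a b + h' a b) = k * cartan_sum h + cartan_sum h'.
Proof.
rewrite /cartan_sum mulr_sumr -big_split; apply: eq_bigr => a _ /=.
rewrite mulr_sumr -big_split; apply: eq_bigr => b _ /=.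
by rewrite mulrDr mulrCA.
Qed.

(** The factor [q ^- b] from moving [E] past [L ^+ b] is undone by a [K = L ^+ 2] on the other
    strand, because the sum over [a] is cyclic modulo [4p]. *)
Lemma cartan_sum_shiftl h : (forall a b, h (a + 4 * p)%N b = h a b) ->
  cartan_sum (fun a b => q ^- b * h (a + 2)%N b) = cartan_sum h.
Proof.
move=> hp; rewrite /cartan_sum.
rewrite -(sum_shift (f := fun a => \sum_(0 <= b < 4 * p) cartan_coef a b * h a b)).
  by apply: eq_bigr => a _; apply: eq_bigr => b _; rewrite cartan_coefD2 mulrCA mulrA.
by move=> a; apply: eq_bigr => b _; rewrite cartan_coef_period hp.
Qed.

Lemma cartan_sum_shiftr h : (forall a b, h a (b + 4 * p)%N = h a b) ->
  cartan_sum (fun a b => q ^- a * h a (b + 2)%N) = cartan_sum h.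
Proof. 
move=> hp; rewrite cartan_sumC [RHS]cartan_sumC.
by rewrite -(cartan_sum_shiftl (h := fun b a => h a b)). Qed.

Lemma tilde_rmat_sum (G : U -> U -> R[i]) :
  \sum_(r <- tU_rmat U) r.1 * G r.2.1 r.2.2 =
  \sum_(0 <= n < p) theta n *
     cartan_sum (fun a b => G (L ^+ a * E ^+ n) (L ^+ b * F ^+ n)).
Proof.
rewrite /tU_rmat (rmatrix_sum m L E F (4 * p) cartan_coef G) /cartan_sum.
under [RHS]eq_bigr => n _ do rewrite mulr_sumr.
rewrite [RHS]exchange_big; apply: eq_bigr => a _ /=.
under [RHS]eq_bigr => n _ do rewrite mulr_sumr.
rewrite [RHS]exchange_big; apply: eq_bigr => b _ /=.
by rewrite mulr_sumr; apply: eq_bigr => n _; rewrite mulrCA.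
Qed.

(** The recursion behind the quasi R-matrix: it matches the commutator of [E] with [F ^+ n.+1]
    against the Cartan terms of one degree less. *)
Lemma thetaS n : (n < m.+1)%N ->
  theta n.+1 * ((q ^+ n.+1 - q ^- n.+1) / d / d) = theta n * q ^+ n.
Proof.
move=> np; have bn : q ^+ n.+1 - q ^- n.+1 != 0.
  by apply: qbrace_neq0; rewrite //= ltnS.
rewrite /theta /qfact (big_nat_recr n.+1) //= -/(qfact R p n) /qint.
rewrite exprS /qbrace expr1 !invfM invrK.
have -> : (n.+1 * n)./2 = ((n * n.-1)./2 + n)%N.
  have -> : (n.+1 * n = n * n.-1 + n.*2)%N by case: (n) => // k; rewrite -muln2 /=; lia.
  by rewrite halfD odd_double andbF doubleK.
rewrite exprD.
move: (d ^+ n) (qfact _ _ _)^-1 (q ^+ (n * _)./2) (q ^+ n) => u v w z.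
by move: bn d0; move: (q ^+ n.+1 - _) d => x y hx hy; field; rewrite hx hy.
Qed.

Section Over.
Variable G : U -> U -> R[i].
Hypothesis Gb : bilin G.

Lemma bilin_addl x y z : G (x + y) z = G x z + G y z.
Proof. by have := Gb.1 1 x y z; rewrite scale1r mul1r. Qed.
Lemma bilin_addr x y z : G z (x + y) = G z x + G z y.
Proof. by have := Gb.2 1 x y z; rewrite scale1r mul1r. Qed.
Lemma bilin_scaler k x y : G x (k *: y) = k * G x y.
Proof.
have G0 : G x 0 = 0 by apply: (addIr (G x 0)); rewrite -bilin_addr !add0r.
by have := Gb.2 k y 0 x; rewrite !addr0 G0 addr0.
Qed.
Lemma bilin_scalel k x y : G (k *: x) y = k * G x y.
Proof.
have G0 : G 0 y = 0 by apply: (addIr (G 0 y)); rewrite -bilin_addl !add0r.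
by have := Gb.1 k x 0 y; rewrite !addr0 G0 addr0.
Qed.

Lemma rmat_commK :
  \sum_(r <- tU_rmat U) r.1 * G (r.2.1 * K) (r.2.2 * K) =
  \sum_(r <- tU_rmat U) r.1 * G (K * r.2.1) (K * r.2.2).
Proof.
rewrite (tilde_rmat_sum (fun x y => G (x * K) (y * K))).
rewrite (tilde_rmat_sum (fun x y => G (K * x) (K * y))).
apply: eq_bigr => n _; congr (_ * _); apply: eq_cartan_sum => a b.
have KLC c : K * L ^+ c = L ^+ c * K by rewrite -!exprD addnC.
have hE := scal_commX n KE; have hF := scal_commX n KF.
move: (K) KLC hE hF => Z ZL hE hF.
rewrite !mulrA !ZL -!(mulrA (L ^+ _)) hE hF -!scalerAr bilin_scalel bilin_scaler.
by rewrite [RHS]mulrA -exprMn mulfV ?expf_neq0 // expr1n mul1r.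
Qed.

(** The R-matrix intertwines the coproduct of [E] with its opposite. Once [E] and [K] have crossed
    the Cartan part, the terms are sorted by the power of [E] on the first strand. *)
Lemma rmat_commE :
  \sum_(r <- tU_rmat U) r.1 * G (r.2.1 * E) (r.2.2 * K) +
  \sum_(r <- tU_rmat U) r.1 * G r.2.1 (r.2.2 * E) =
  \sum_(r <- tU_rmat U) r.1 * G (K * r.2.1) (E * r.2.2) +
  \sum_(r <- tU_rmat U) r.1 * G (E * r.2.1) r.2.2.
Proof.
pose Phi n y := cartan_sum (fun a b => G (L ^+ a * E ^+ n) (L ^+ b * y)).
have PhiP n k y z : Phi n (k *: y + z) = k * Phi n y + Phi n z.
  rewrite -cartan_sum_lin; apply: eq_cartan_sum => a b.
  by rewrite mulrDr -scalerAr bilin_addr bilin_scaler.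
have PhiD n y z : Phi n (y + z) = Phi n y + Phi n z.
  by have := PhiP n 1 y z; rewrite scale1r mul1r.
have Phi0 n : Phi n 0 = 0 by apply: (addIr (Phi n 0)); rewrite -PhiD !add0r.
have PhiZ n k y : Phi n (k *: y) = k * Phi n y.
  by have := PhiP n k y 0; rewrite !addr0 Phi0 addr0.
have PhiB n y z : Phi n (y - z) = Phi n y - Phi n z.
  by rewrite PhiD -scaleN1r PhiZ mulN1r.
have Phip y : Phi p y = 0.
  rewrite /Phi Ep (eq_cartan_sum (h' := fun a b => 0 * 0 + 0)).
    by rewrite cartan_sum_lin mul0r add0r; apply: big1 => a _; apply: big1 => b _; rewrite mulr0.
  move=> a b; rewrite mulr0 mul0r addr0.
  by have := bilin_scalel 0 0 (L ^+ b * y); rewrite scale0r mul0r.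
have ELX c : E * L ^+ c = q ^- c *: (L ^+ c * E).
  by rewrite (commX_scal c LE) scalerA mulVf ?expf_neq0 // scale1r.
have Lper c : L ^+ (c + 4 * p) = L ^+ c by rewrite exprD Lp mulr1.
rewrite (tilde_rmat_sum (fun x y => G (x * E) (y * K))).
rewrite (tilde_rmat_sum (fun x y => G x (y * E))).
rewrite (tilde_rmat_sum (fun x y => G (K * x) (E * y))).
rewrite (tilde_rmat_sum (fun x y => G (E * x) y)).
rewrite (eq_bigr (fun n => theta n * Phi n.+1 (F ^+ n * K))); last first.
  by move=> n _; congr (_ * _); apply: eq_cartan_sum => a b; rewrite (exprSr E) -(mulrA (L ^+ a)) -(mulrA (L ^+ b)).
rewrite [X in _ + X = _](eq_bigr (fun n => theta n * Phi n (F ^+ n * E))); last first.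
  by move=> n _; congr (_ * _); apply: eq_cartan_sum => a b; rewrite !mulrA.
rewrite [X in _ = X + _](eq_bigr (fun n => theta n * Phi n (E * F ^+ n))); last first.
  move=> n _; congr (_ * _); rewrite /Phi -[RHS]cartan_sum_shiftl => [|a b]; last by rewrite Lper.
  apply: eq_cartan_sum => a b; rewrite (mulrA K) -exprD (addnC 2) (mulrA E) ELX.
  by rewrite -scalerAl bilin_scaler -(mulrA (L ^+ b)).
rewrite [X in _ = _ + X](eq_bigr (fun n => theta n * Phi n.+1 (KV * F ^+ n))); last first.
  move=> n _; congr (_ * _); rewrite /Phi -[RHS]cartan_sum_shiftr => [|a b]; last by rewrite Lper.
  apply: eq_cartan_sum => a b; rewrite (mulrA E) ELX -scalerAl bilin_scalel.
  rewrite exprD -(mulrA (L ^+ b)) (mulrA K) KKV mul1r.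
  by rewrite -(mulrA (L ^+ a)) -(exprS E).
suff : \sum_(0 <= n < p) theta n * Phi n (E * F ^+ n - F ^+ n * E) =
    \sum_(0 <= n < p) theta n * Phi n.+1 (F ^+ n * K - KV * F ^+ n).
  rewrite (eq_bigr (fun n => theta n * Phi n (E * F ^+ n) - theta n * Phi n (F ^+ n * E))); last first.
    by move=> n _; rewrite PhiB mulrBr.
  rewrite [RHS](eq_bigr (fun n => theta n * Phi n.+1 (F ^+ n * K) - theta n * Phi n.+1 (KV * F ^+ n))); last first.
    by move=> n _; rewrite PhiB mulrBr.
  by rewrite !sumrB => /(canRL (subrK _)) ->; rewrite [RHS]addrAC subrK.
(* In degree 0 there is no commutator and in degree [p] the power of [E] is zero, so the two sums
   match after a shift by one. *)
rewrite big_nat_recl // [RHS]big_nat_recr //= Phip mulr0 addr0.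
rewrite expr0 mulr1 mul1r subrr Phi0 mulr0 add0r.
rewrite !big_nat; apply: eq_bigr => n /andP[_ np].
rewrite (sl2_EFn q0 d0 KKV KVK KF EF) addrC addKr.
rewrite (scal_commX n (sl2_KVF q0 KKV KVK KF)).
have -> : F ^+ n * K - q ^+ 2 ^+ n *: (F ^+ n * KV) =
    q ^+ n *: (F ^+ n * (q ^- n *: K - q ^+ n *: KV)).
  rewrite mulrBr -!scalerAr scalerBr !scalerA mulfV ?expf_neq0 // scale1r.
  by rewrite -exprM mul2n -addnn exprD.
by rewrite -scalerAr !PhiZ mulrA thetaS // mulrA.
Qed.

End Over.

Lemma bilin_sum (I : Type) (ts : seq I) (c : I -> R[i]) (f : I -> U -> U -> R[i]) :
  (forall t, bilin (f t)) -> bilin (fun a b => \sum_(t <- ts) c t * f t a b).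
Proof.
move=> fb; split=> a x y z; rewrite mulr_sumr -big_split; apply: eq_bigr => s _ /=.
  by rewrite (fb s).1 mulrDr mulrCA.
by rewrite (fb s).2 mulrDr mulrCA.
Qed.

Lemma bilin_comp (G : U -> U -> R[i]) (f g : U -> U) : bilin G -> linear f -> linear g ->
  bilin (fun x y => G (f x) (g y)).
Proof. by move=> [Gl Gr] fl gl; split=> a x y z; rewrite ?fl ?gl ?Gl ?Gr. Qed.

Lemma bilin_swap (G : U -> U -> R[i]) : bilin G -> bilin (fun x y => G y x).
Proof. by case=> Gl Gr; split. Qed.

Lemma linear_mull (a : U) : linear ( *%R a).
Proof. by move=> k x y; rewrite mulrDr scalerAr. Qed.

Lemma linear_mulr (a : U) : linear ( *%R^~ a).
Proof. by move=> k x y; rewrite mulrDl scalerAl. Qed.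

Lemma linear_mulS (a b : U) : linear (fun x => a * S x * b).
Proof. by move=> k x y; rewrite linearP mulrDr mulrDl -scalerAr -scalerAl. Qed.

Lemma rmat_commK_under (G : U -> U -> R[i]) : bilin G ->
  \sum_(r <- tU_rmat U) r.1 * G (S r.2.1 * K) (r.2.2 * K) =
  \sum_(r <- tU_rmat U) r.1 * G (K * S r.2.1) (K * r.2.2).
Proof.
have [_ _ [_ _ _ SK]] := tilde_hopfE U; move=> Gb.
have Gb' : bilin (fun x y => G (K * S x * K) y).
  by apply: (bilin_comp (f := fun x => K * S x * K) (g := id)) => //; exact: linear_mulS.
have := rmat_commK Gb'; move: SK KKV KVK; move: (K) (KV) => k kV Sk kk' k'k.
under eq_bigr => r _ do rewrite antipodeM Sk mulrA kk' mul1r.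
under [in RHS]eq_bigr => r _ do rewrite antipodeM Sk -!mulrA k'k mulr1.
by [].
Qed.

(** This crossing carries the R-matrix with [S] on its first factor, so [rmat_commE] is applied to
    the form [G (S x * K) y]. As [S E = - E K^-1], the final [K] cancels the inverses, except in one
    term that [rmat_commK_under] rewrites. *)
Lemma rmat_commE_under (G : U -> U -> R[i]) : bilin G ->
  \sum_(r <- tU_rmat U) r.1 * G (S r.2.1 * K) (r.2.2 * E) +
  \sum_(r <- tU_rmat U) r.1 * G (S r.2.1 * E) r.2.2 =
  \sum_(r <- tU_rmat U) r.1 * G (E * S r.2.1) (K * r.2.2) +
  \sum_(r <- tU_rmat U) r.1 * G (S r.2.1) (E * r.2.2).
Proof.
have [_ _ [SE _ _ SK]] := tilde_hopfE U; move=> Gb.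
have Gb1 : bilin (fun x y => G (S x * K) y).
  apply: (bilin_comp (f := fun x => S x * K) (g := id)) => //.
  by move=> k x y; rewrite linearP mulrDl -scalerAl.
have Gb2 : bilin (fun x y => G (E * KV * x) y).
  by apply: (bilin_comp (f := fun x => E * KV * x) (g := id)) => //; exact: linear_mull.
have h1 := rmat_commE Gb1; have := rmat_commK_under Gb2.
move: SE SK KKV KVK h1; move: (K) (KV) => k kV SE Sk kk' k'k h1.
have -> : \sum_(r <- tU_rmat U) r.1 * G (E * S r.2.1) (k * r.2.2) =
    \sum_(r <- tU_rmat U) r.1 * G (E * kV * (k * S r.2.1)) (k * r.2.2).
  by apply: eq_bigr => r _; rewrite mulrA -(mulrA E) k'k mulr1.
move=> <-; move: h1.
have -> : \sum_(r <- tU_rmat U) r.1 * G (S (r.2.1 * E) * k) (r.2.2 * k) =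
    - \sum_(r <- tU_rmat U) r.1 * G (E * kV * (S r.2.1 * k)) (r.2.2 * k).
  rewrite -sumrN; apply: eq_bigr => r _; rewrite antipodeM SE !mulNr -scaleN1r.
  by rewrite (bilin_scalel Gb) mulN1r mulrN mulrA.
have -> : \sum_(r <- tU_rmat U) r.1 * G (S (k * r.2.1) * k) (E * r.2.2) =
    \sum_(r <- tU_rmat U) r.1 * G (S r.2.1) (E * r.2.2).
  by apply: eq_bigr => r _; rewrite antipodeM Sk -mulrA k'k mulr1.
have -> : \sum_(r <- tU_rmat U) r.1 * G (S (E * r.2.1) * k) r.2.2 =
    - \sum_(r <- tU_rmat U) r.1 * G (S r.2.1 * E) r.2.2.
  rewrite -sumrN; apply: eq_bigr => r _; rewrite antipodeM SE mulrN mulNr -scaleN1r.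
  by rewrite (bilin_scalel Gb) mulN1r mulrN -!mulrA k'k mulr1.
by move=> /(canRL (addNKr _)) ->; rewrite -!addrA addNr addr0.
Qed.

Lemma tilde_coint_top : tU_coint U = coint_coef p (2 * p)%:R *: top q m E F L 0.
Proof.
rewrite /tU_coint /top /weight_proj mulr_sumr; congr (_ *: _); apply: eq_bigr => a _.
by rewrite expr0 invr1 expr1n scale1r.
Qed.

Lemma commE_top j : q ^+ (2 * j) = 1 -> E * top q m E F L j = top q m E F L j * E.
Proof. by move=> qj; rewrite (E_top q F L Ep) (top_E q0 d0 qp Lp Ep LE LF EF qj). Qed.

Lemma commK_top j : K * top q m E F L j = top q m E F L j * K.
Proof.
by rewrite !expr2 -mulrA (top_L m q0 LE LF) mulrA (top_L m q0 LE LF) mulrA.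
Qed.

Lemma cross_sum i s (G : U -> U -> R[i]) :
  \sum_(t <- piece_beads (tU_data U) (Cross i s))
     t.1 * G (head 1 t.2) (head 1 (behead t.2)) =
  \sum_(r <- tU_rmat U) r.1 * G (if s then r.2.1 else S r.2.1) r.2.2.
Proof. by rewrite /piece_beads big_map. Qed.

Lemma tilde_KVpC x : KV ^+ p * x = x * KV ^+ p.
Proof.
have KpV : KV ^+ p * K ^+ p = 1.
  by rewrite -exprMn_comm ?KVK ?expr1n // /GRing.comm KVK KKV.
have KpV' : K ^+ p * KV ^+ p = 1.
  by rewrite -exprMn_comm ?KKV ?expr1n // /GRing.comm KVK KKV.
move: (KV ^+ p) (K ^+ p) (tilde_KpC x) KpV KpV' => a b xb ab ba.
by rewrite -[x in RHS]mul1r -ab -(mulrA a) xb -!mulrA ba mulr1.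
Qed.

Lemma tilde_commK : commutes_with_beads H (piece_beads (tU_data U)) (tU_piv U)
  (tU_pivV U) (tU_coint U) K.
Proof.
have [[_ _ _ coK] [_ _ _ cK] [_ _ _ SK]] := tilde_hopfE U; split.
- rewrite (tensor_eq_lmodP (f := fun u v => v * tU_pivV U * S u) coK) => [|z|z].
  + rewrite big_seq1 /= SK cK scale1r /tU_pivV /tinv (exprS KV) (mulrA K) KKV mul1r.
    by rewrite -(exprSr KV) (exprS KV).
  + by move=> a x y; rewrite linearP mulrDr -scalerAr.
  + by move=> a x y; rewrite !mulrDl -!scalerAl.
- rewrite (tensor_eq_lmodP (f := fun u v => S v * tU_piv U * u) coK) => [|z|z].
  + rewrite big_seq1 /= SK cK scale1r /tU_piv (exprS K) (mulrA KV) KVK mul1r.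
    by rewrite -(exprSr K) (exprS K).
  + by move=> a x y; rewrite mulrDr -scalerAr.
  + by move=> a x y; rewrite linearP !mulrDl -!scalerAl.
- by rewrite tilde_coint_top -scalerAr commK_top scalerAl.
- move=> i G Gb.
  rewrite (tensor_eqP (f := fun u v => \sum_(t <- _) t.1 * G (_ * u) (_ * v)) coK); last first.
    by apply: bilin_sum => t; apply: bilin_comp Gb _ _; exact: linear_mull.
  rewrite (tensor_eqP (f := fun u v => \sum_(t <- _) t.1 * G (v * _) (u * _)) coK); last first.
    by apply: bilin_sum => t; apply/bilin_swap/bilin_comp => //; exact: linear_mulr.
  rewrite !big_seq1 /= (cross_sum i true (fun x y => G (x * K) (y * K))).
  rewrite (cross_sum i true (fun x y => G (K * x) (K * y))).
  exact: rmat_commK.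
move=> i G Gb.
rewrite (tensor_eqP (f := fun u v => \sum_(t <- _) t.1 * G (_ * v) (_ * u)) coK); last first.
  by apply: bilin_sum => t; apply/bilin_swap/bilin_comp => //; exact: linear_mull.
rewrite (tensor_eqP (f := fun u v => \sum_(t <- _) t.1 * G (u * _) (v * _)) coK); last first.
  by apply: bilin_sum => t; apply: bilin_comp Gb _ _; exact: linear_mulr.
rewrite !big_seq1 /= (cross_sum i false (fun x y => G (x * K) (y * K))).
rewrite (cross_sum i false (fun x y => G (K * x) (K * y))).
exact: rmat_commK_under.
Qed.

Lemma tilde_commE : commutes_with_beads H (piece_beads (tU_data U)) (tU_piv U)
  (tU_pivV U) (tU_coint U) E.
Proof.
have [[coE _ _ _] [cE _ _ _] [SE _ _ SK]] := tilde_hopfE U.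
have big2 (f : U * U -> R[i]) : \sum_(u <- [:: (E, K); (1, E)]) f u = f (E, K) + f (1, E).
  by rewrite big_cons big_seq1.
split.
- rewrite (tensor_eq_lmodP (f := fun u v => v * tU_pivV U * S u) coE) => [|z|z].
  + rewrite big_cons big_seq1 /= SE cE scale0r antipode1 mulr1 /tU_pivV /tinv.
    rewrite (exprS KV) mulrN (mulrA K) KKV mul1r (mulrA (KV ^+ p)) tilde_KVpC.
    by rewrite -(mulrA E) -(exprSr KV) (exprS KV) addNr.
  + by move=> a x y; rewrite linearP mulrDr -scalerAr.
  + by move=> a x y; rewrite !mulrDl -!scalerAl.
- rewrite (tensor_eq_lmodP (f := fun u v => S v * tU_piv U * u) coE) => [|z|z].
  + rewrite big_cons big_seq1 /= SE SK cE scale0r /tU_piv (exprS K) mulr1 mulNr.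
    by rewrite (mulrA KV) KVK mul1r -(mulrA E) (mulrA KV) KVK mul1r tilde_KpC subrr.
  + by move=> a x y; rewrite mulrDr -scalerAr.
  + by move=> a x y; rewrite linearP !mulrDl -!scalerAl.
- by rewrite tilde_coint_top -scalerAr commE_top ?muln0 ?expr0 // scalerAl.
- move=> i G Gb.
  rewrite (tensor_eqP (f := fun u v => \sum_(t <- _) t.1 * G (_ * u) (_ * v)) coE); last first.
    by apply: bilin_sum => t; apply: bilin_comp Gb _ _; exact: linear_mull.
  rewrite (tensor_eqP (f := fun u v => \sum_(t <- _) t.1 * G (v * _) (u * _)) coE); last first.
    by apply: bilin_sum => t; apply/bilin_swap/bilin_comp => //; exact: linear_mulr.
  rewrite !big2 /= (cross_sum i true (fun x y => G (x * E) (y * K))).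
  rewrite (cross_sum i true (fun x y => G (K * x) (E * y))).
  rewrite (cross_sum i true (fun x y => G (x * 1) (y * E))).
  rewrite (cross_sum i true (fun x y => G (E * x) (1 * y))).
  under [X in _ + X = _]eq_bigr => r _ do rewrite mulr1.
  under [X in _ = _ + X]eq_bigr => r _ do rewrite mul1r.
  exact: rmat_commE.
move=> i G Gb.
rewrite (tensor_eqP (f := fun u v => \sum_(t <- _) t.1 * G (_ * v) (_ * u)) coE); last first.
  by apply: bilin_sum => t; apply/bilin_swap/bilin_comp => //; exact: linear_mull.
rewrite (tensor_eqP (f := fun u v => \sum_(t <- _) t.1 * G (u * _) (v * _)) coE); last first.
  by apply: bilin_sum => t; apply: bilin_comp Gb _ _; exact: linear_mulr.
rewrite !big2 /= (cross_sum i false (fun x y => G (x * K) (y * E))).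
rewrite (cross_sum i false (fun x y => G (E * x) (K * y))).
rewrite (cross_sum i false (fun x y => G (x * E) (y * 1))).
rewrite (cross_sum i false (fun x y => G (1 * x) (E * y))).
under [X in _ + X = _]eq_bigr => r _ do rewrite mulr1.
under [X in _ = _ + X]eq_bigr => r _ do rewrite mul1r.
exact: rmat_commE_under.
Qed.

End Symmetry.

(** * Vanishing of the odd part of the cointegral *)

Section Final.
Variables (R : realType) (m : nat).
Local Notation p := m.+2.
Variable U : Utilde R p.
Local Notation q := (q_root R p).
Local Notation d := (q - q^-1).
Local Notation E := (tE U).
Local Notation F := (tF U).
Local Notation L := (tK U).
Local Notation LV := (L ^+ (4 * p).-1).
Local Notation K := (L ^+ 2).
Local Notation KV := (LV ^+ 2).
Local Notation H := (tU_hopf U).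
Let q0 : q != 0 := q_root_neq0 R (isT : (1 < p)%N).
Let d0 : d != 0 := q_subV_neq0 R (isT : (1 < p)%N).
Let qp : q ^+ p = -1 := q_rootXp R (isT : (1 < p)%N).
Let Ep : E ^+ p = 0. Proof. by have [[]] := tilde_relE U. Qed.
Let Fp : F ^+ p = 0. Proof. by have [[]] := tilde_relE U. Qed.
Let Lp : L ^+ (4 * p) = 1. Proof. by have [] := tilde_relE U. Qed.
Let LE : L * E = q *: (E * L). Proof. by have [] := tilde_relE U. Qed.
Let LF : L * F = q^-1 *: (F * L). Proof. by have [] := tilde_relE U. Qed.
Let EF : E * F - F * E = d^-1 *: (K - KV). Proof. by have [] := tilde_relE U. Qed.
Let KKV : K * KV = 1 := root_KKV Lp.
Let KVK : KV * K = 1 := root_KVK Lp.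
Let KE : K * E = q ^+ 2 *: (E * K) := root_KE LE.
Let KF : K * F = q ^- 2 *: (F * K) := root_KF LF.
Local Notation s := (2^-1 * coint_coef p (2 * p)%:R).
Local Notation top j := (top q m E F L j).
Let qpow0 : q ^+ (2 * 0) = 1. Proof. by rewrite muln0. Qed.
Let qpowp : q ^+ (2 * p) = 1 := q2p qp.

Definition coint_odd : U := s *: (top 0 - top p).

Lemma coint_split : tU_coint U = coint_even U + coint_odd.
Proof.
rewrite tilde_coint_top /coint_even /coint_odd.
move: (top 0) (top p) (coint_coef _ _) => u v c.
rewrite -scalerDr addrACA subrr addr0 -(mulr2n u) -(scaler_nat 2 u) scalerA; congr (_ *: _).
by rewrite mulrAC mulVf ?mul1r // pnatr_eq0.
Qed.

Lemma coint_odd_vanish f1 f2 f3 Th G : uniq (f1 ++ f2 ++ f3) ->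
  invariant H (tilde_e U) K E (f1 ++ f2 ++ f3) Th ->
  multilin (tilde_e U) (f1 ++ f2 ++ f3) G ->
  (forall va, act H H idfun (f1 ++ f2 ++ f3) E G va = 0) ->
  Th (act H H idfun f2 coint_odd G) = 0.
Proof.
move=> uf Thi GM Gx; have [[coE _ _ coK] [cE _ _ cK] _] := tilde_hopfE U.
pose z0 := s *: top_primitive q m E F L.
have Kz : K * z0 = q ^- 2 *: (z0 * K).
  by rewrite /z0 -scalerAr (top_primitive_weight q0 qp LE LF) -scalerAl !scalerA mulrC.
have Ez : E * z0 - z0 * E = coint_odd.
  rewrite /z0 -scalerAr -scalerAl -scalerBr.
  by rewrite (top_primitive_comm q0 d0 qp Lp LE LF EF).
have Fy : F * coint_odd = 0.
  rewrite -scalerAr mulrBr !(F_top q0 d0 qp Lp Fp LE LF EF) //.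
  by rewrite subrr scaler0.
have yF : coint_odd * F = 0.
  by rewrite -scalerAl mulrBl !(top_F E Fp LF) subrr scaler0.
have yK : coint_odd * K = coint_odd.
  by rewrite -scalerAl mulrBl !(top_K q0 qp E F Lp).
apply: (inv_vanish (@tilde_eC R m U) coK coE cK cE uf Thi GM Gx (N := m)
  (c := fun n => q ^- (2 * n.+1)) (mu := chain_scalar q) (z := chain q F z0) KE) => //.
- by move=> n; exact: chain_weight.
- by move=> n _; exact: (chain_comm q0 d0 KKV KVK KF EF n Kz Ez Fy yF).
(* As [n < m = p - 2], both [n + 1] and [n + 2] lie strictly between 0 and [p]. *)
- move=> n nm; rewrite /chain_scalar mulNr oppr_eq0 !mulf_neq0 ?invr_neq0 ?expf_neq0 //.
    by apply: qbrace_neq0; lia.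
  by apply: qbrace_neq0; lia.
(* At the end of the chain the weight [q ^- (2 * m.+1)] equals [q ^+ 2], because
   [q ^+ (2 * p) = 1]. *)
apply: (mulIf (expf_neq0 (2 * m.+1) q0)).
by rewrite mulVf ?expf_neq0 // -exprD -[LHS]qpowp; congr (_ ^+ _); lia.
Qed.

Lemma tilde_evaluate_even (w : seq piece) :
  evaluate H (@tilde_tau R m U) (piece_beads (tU_data U)) w [::] 0 (fun=> 1) =
  evaluate H (@tilde_tau R m U) (even_beads U) w [::] 0 (fun=> 1).
Proof.
have [[coE _ _ coK] [cE _ _ cK] _] := tilde_hopfE U.
have commZ z : (forall j, q ^+ (2 * j) = 1 -> z * top j = top j * z) ->
    z * coint_even U = coint_even U * z.
  by move=> h; rewrite -scalerAr -scalerAl mulrDr mulrDl !h.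
(* Below the diagram the row is empty, and invariance of evaluation there is the definition of [act]
   on the empty list. *)
pose Th (G : (nat -> U) -> R[i]) := G (fun=> 1); rewrite -[LHS]/(Th _) -[RHS]/(Th _).
apply: (evaluate_replace (@tilde_eC R m U) (@tilde_tau_lin R m U) (@tilde_tauC R m U)
  (@tilde_tau_e R m U) coK coE cE (T' := even_beads U) (g := tU_piv U)
  (gV := tU_pivV U) (La := tU_coint U) (La' := coint_even U) (y := coint_odd)) => //.
- by case.
- exact: tilde_commK.
- exact: tilde_commE.
- by apply: commZ => j _; exact: commK_top.
- by apply: commZ => j; exact: commE_top.
- exact: coint_split.
- exact: coint_odd_vanish.
Qed.

End Final.

Theorem proposition7p1 (R : realType) (p : nat) (p_ge2 : (2 <= p)%N)
    (p_even : ~~ odd p) (Ut : Utilde R p) (Ub : Ubar R p)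
    (D : kirby) (base : 'I_(size (components D)) -> nat) :
  J_U Ut base (relH2_zero D) = J_Ubar Ub base.
Proof.
case: p p_ge2 p_even Ut Ub => [|[|m]] // _ _ Ut Ub.
have [psi [psiE psiF psiK]] :
    exists f : {lrmorphism Ub -> Ut}, [/\ f (bE Ub) = tE Ut * tilde_e Ut,
      f (bF Ub) = tF Ut * tilde_e Ut & f (bK Ub) = tK Ut ^+ 2 * tilde_e Ut + (1 - tilde_e Ut)].
  by have [_ ex _] := bU_presented Ub; apply/ex/bar_rels_tilde.
have tauB := bar_tauE psiE psiF psiK.
have -> : J_U Ut base (relH2_zero D) =
    bead_invariant (tU_data Ut) base (fun=> @tilde_tau R m Ut).
  rewrite /J_U; congr bead_invariant.
  apply/funext => j; apply/funext => x; rewrite /= ffunE; exact: tilde_tauE.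
rewrite (bead_invariant_evaluate (tU_data Ut) (@tilde_tauC R m Ut)) /= tilde_evaluate_even.
rewrite /J_Ubar (bead_invariant_evaluate (bU_data Ub)
  (tau := fun x => blambda Ub (x * binv m.+2 (bK Ub)))) => [|x y]; last first.
  (* The functional on the small quantum group inherits cyclicity from [tilde_tau] through [psi]. *)
  by rewrite !tauB !rmorphM tilde_tauC.
rewrite /= (evaluate_bar psiE psiF psiK) //; congr evaluate.
by apply/funext => l; rewrite rmorph1.
Qed.
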